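(* Assume $1<\alpha<2$. For every integer $k\ge1$, the site overlap satisfies $$\lim_{N\to\infty}\mathbb E\langle R_{2k}^2\rangle=0\quad\text{for every }0<\beta<\beta_\alpha,$$ and $$\lim_{\beta\to\infty}\liminf_{N\to\infty}\mathbb E\langle R_{2k}^2\rangle=1 .$$ Furthermore, for every $0<\beta<\beta_\alpha$ and every $K>0$, the bond overlap satisfies $$\lim_{N\to\infty}\mathbb E\Bigl\langle\Bigl(Q_K-\alpha K^\alpha\int_K^\infty\frac{\tanh^2(\beta x)}{x^{1+\alpha}}dx\Bigr)^2\Bigr\rangle=0 .$$
   Context: Lévy spin glass model. Let $0<\alpha<2$ and let $X$ be a symmetric real random variable with $\mathbb P(|X|>x)=L(x)/x^\alpha$ for all $x>0$, where $L:(0,\infty)\to(0,\infty)$ is slowly varying at $\infty$, i.e. $\lim_{x\to\infty}L(tx)/L(x)=1$ for every $t>0$. For $N\ge1$ set $a_N=\inf\{x>0: N\,\mathbb P(|X|>x)\le 1\}$ and $J=a_N^{-1}X$ ($a_N>0$ for all large $N$, and only large $N$ matter). Let $(J_{ij})_{1\le i<j\le N}$ be i.i.d. copies of $J$. For $\beta>0$ and $\sigma\in\{-1,1\}^N$ let $-H_N(\sigma)=\beta\sum_{1\le i<j\le N}J_{ij}\sigma_i\sigma_j$, $Z_N=\sum_{\sigma}e^{-H_N(\sigma)}$, and let $G_N(\sigma)=e^{-H_N(\sigma)}/Z_N$ be the Gibbs measure. Let $\sigma^1,\sigma^2,\ldots$ be i.i.d. samples (replicas) from $G_N$ and $\langle\cdot\rangle$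 the expectation with respect to them given the disorder $(J_{ij})$; $\mathbb E$ is the expectation over the disorder. Site overlap: $R_k=\frac1N\sum_{i=1}^N\sigma_i^1\sigma_i^2\cdots\sigma_i^k$ for $k\ge1$. Bond overlap: for $K\ge0$, with $M=\sum_{i<j}\mathbf 1_{\{|J_{ij}|\ge K\}}$, set $Q_K=\frac1M\sum_{i<j}\mathbf 1_{\{|J_{ij}|\ge K\}}\sigma_i^1\sigma_j^1\sigma_i^2\sigma_j^2$ if $M\ge1$ and $Q_K=0$ if $M=0$. The critical temperature is $\beta_\alpha=\Bigl(\alpha\int_0^\infty \frac{\tanh^2(x)}{x^{\alpha+1}}dx\Bigr)^{-1/\alpha}$. *)

(* Defs.v *)
From HB Require Import structures.
From mathcomp Require Import all_boot all_order all_algebra.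
From mathcomp Require Import all_classical all_reals all_analysis.

Set Implicit Arguments.
Unset Strict Implicit.
Unset Printing Implicit Defensive.

Import Order.TTheory GRing.Theory Num.Theory.
Import numFieldNormedType.Exports.

Local Open Scope classical_set_scope.
Local Open Scope ring_scope.

Section Probability.
Context {R : realType}.

Definition symmetric_rv {d} {T : measurableType d} (P : probability T R)
    (X : {RV P >-> R}) : Prop :=
  forall A : set R, measurable A ->
    P (X @^-1` A) = P ((fun w => - X w) @^-1` A).

Definition mutually_independent {d} {T : measurableType d}
    (P : probability T R) {I : finType} (X : I -> {RV P >-> R}) : Prop :=
  forall (S : {set I}) (B : I -> set R), (forall i, measurable (B i)) ->
    P (\bigcap_(i in [set i | i \in S]) (X i @^-1` B i)) =
    (\prod_(i in S) fine (P (X i @^-1` B i)))%:E.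

Definition slowly_varying (L : R -> R) : Prop :=
  forall t : R, 0 < t -> L (t * x) / L x @[x --> +oo] --> (1 : R).

Definition tail {d} {T : measurableType d} (P : probability T R)
    (X : {RV P >-> R}) (x : R) : \bar R := P [set w | x < `|X w|].

(* The normalization a_N. It may vanish for finitely many small N; then
   (scaling X N)^-1 = 0 by the convention 0^-1 = 0. *)
Definition scaling {d} {T : measurableType d} (P : probability T R)
    (X : {RV P >-> R}) (N : nat) : R :=
  inf [set x : R | 0 < x /\ (N%:R%:E * tail X x <= 1)%E].

End Probability.

Section SpinGlass.
Context {R : realType}.

Definition bond (N : nat) : finType := {e : 'I_N * 'I_N | (e.1 < e.2)%N}.

(* [true] encodes the spin -1 and [false] the spin +1. *)
Definition config (N : nat) : finType := {ffun 'I_N -> bool}.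

Definition spin {N} (s : config N) (i : 'I_N) : R := (-1) ^+ s i.

Definition bond_spin {N} (s : config N) (e : bond N) : R :=
  spin s (val e).1 * spin s (val e).2.

(* This is - H_N, with the inverse temperature included. *)
Definition neg_hamiltonian {N} (beta : R) (J : bond N -> R) (s : config N) : R :=
  beta * \sum_(e : bond N) J e * bond_spin s e.

Definition partition_function {N} (beta : R) (J : bond N -> R) : R :=
  \sum_(s : config N) expR (neg_hamiltonian beta J s).

Definition gibbs {N} (beta : R) (J : bond N -> R) (s : config N) : R :=
  expR (neg_hamiltonian beta J s) / partition_function beta J.

(* The bracket < f(s^1, ..., s^n) >: integration of a function of n replicas
   against the n-fold product of the Gibbs measure. *)
Definition gibbs_average {N} (beta : R) (J : bond N -> R) (n : nat)
    (f : ('I_n -> config N) -> R) : R :=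
  \sum_(s : {ffun 'I_n -> config N}) (\prod_(l < n) gibbs beta J (s l)) * f s.

Definition site_overlap {N} (k : nat) (s : 'I_k -> config N) : R :=
  N%:R^-1 * \sum_(i < N) \prod_(l < k) spin (s l) i.

Definition bond_overlap {N} (K : R) (J : bond N -> R) (s1 s2 : config N) : R :=
  let M := #|[pred e : bond N | K <= `|J e|]| in
  if M == 0%N then 0
  else M%:R^-1 * \sum_(e : bond N | K <= `|J e|) bond_spin s1 e * bond_spin s2 e.

Definition tanh (x : R) : R :=
  (expR x - expR (- x)) / (expR x + expR (- x)).

Definition beta_critical (alpha : R) : R :=
  (alpha * \int[lebesgue_measure]_(x in `]0, +oo[)
             (tanh x ^+ 2 / x `^ (alpha + 1))) `^ (- alpha^-1).

Definition bond_overlap_limit (alpha beta K : R) : R :=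
  alpha * K `^ alpha *
  \int[lebesgue_measure]_(x in `]K, +oo[)
    (tanh (beta * x) ^+ 2 / x `^ (1 + alpha)).

End SpinGlass.

Section Disorder.
Context {R : realType}.

(* The couplings (J_ij)_{i<j} of the system of size N are i.i.d. copies of
   X / a_N; they may live on a different probability space than X. *)
Definition levy_couplings {d0} {T0 : measurableType d0} (P0 : probability T0 R)
    (X : {RV P0 >-> R}) (N : nat) {d} {T : measurableType d}
    (P : probability T R) (J : bond N -> {RV P >-> R}) : Prop :=
  mutually_independent J /\
  (forall (e : bond N) (A : set R), measurable A ->
     P (J e @^-1` A) = P0 ((fun w => (scaling X N)^-1 * X w) @^-1` A)).

(* E < R_k^2 > *)
Definition mean_site_overlap_sq {d} {T : measurableType d}
    (P : probability T R) {N : nat} (J : bond N -> {RV P >-> R})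
    (beta : R) (k : nat) : \bar R :=
  'E_P[fun w => gibbs_average beta (fun e => J e w)
         (fun s : 'I_k -> config N => site_overlap s ^+ 2)].

(* E < (Q_K - c)^2 > *)
Definition mean_bond_overlap_dev_sq {d} {T : measurableType d}
    (P : probability T R) {N : nat} (J : bond N -> {RV P >-> R})
    (beta K c : R) : \bar R :=
  'E_P[fun w => gibbs_average beta (fun e => J e w)
         (fun s : 'I_2 -> config N =>
            (bond_overlap K (fun e => J e w) (s ord0) (s ord_max) - c) ^+ 2)].

End Disorder.

(* Main.v *)
Require Import Defs.
From HB Require Import structures.
From mathcomp Require Import all_boot all_order all_algebra.
From mathcomp Require Import all_classical all_reals all_analysis.
From mathcomp Require Import measurable_realfun ring lra.

Set Implicit Arguments.
Unset Strict Implicit.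
Unset Printing Implicit Defensive.

Import Order.TTheory GRing.Theory Num.Theory.
Import numFieldNormedType.Exports.

Local Open Scope classical_set_scope.
Local Open Scope ring_scope.


(** Why the theorem is true.

    Write [t e] for [tanh (beta * J e)], [s e] for the product of the two spins of the
    bond [e], and [< >] for Gibbs means. Since [<R_2k ^+ 2>] is the average over
    pairs of sites of [<s_i s_j> ^+ (2 * k)], the site overlap tends to zero, or to
    one, as soon as the average of [<s e> ^+ 2] over the bonds does
    ([site_overlap_le], [site_overlap_ge]).

    High temperature. Divide [Z] by [2 ^+ N] and by the factors
    [cosh (beta * J e)]. The reduced partition function is the average of
    [\prod_e (1 + t e * s e)] over the configurations and has expectation one, as the
    couplings are symmetric. Let the deficit [D beta >= 0] be minus the expectation of
    its logarithm. Two facts play against each other. First, [beta < beta_alpha]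
    says precisely that [N * E (t ^+ 2)] stays below a constant smaller than one
    ([tsq_subcritical]). This leaves room to couple two replicas by their bond overlap
    with a strength [kappa] of order [N^-1] while the expected partition function of
    the pair remains of order [N]; Jensen's inequality then gives
    [kappa * \sum_e E <s e> ^+ 2 <= ln (2 * N + 2) + 2 * D beta]
    ([sum_sqr_edge_le]). Second, when [beta] is raised by [h], the growth of the
    deficit is governed by the energy of the bonds. In the energy of one bond, expanded
    in the mean [m e] of [s e] in the system without that bond, the linear term is odd
    in [J e] and disappears on average, so that only the sum of [E (m e ^+ 2)] and an
    error [N * O (h `^ alpha)] remain ([deficit_step]). As [alpha > 1], summing over a
    grid of temperatures that becomes finer and finer and applying Gronwall's
    inequality yields [D beta = o (N)] ([deficit_sublinear]). Inserted in the first
    fact, this makes the sum of [E <s e> ^+ 2] of order [o (N ^+ 2)].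

    Low temperature. The energy [\sum_e J e * <s e>] is at most
    [ln Z] at inverse temperature one, which is of order [N] whatever [beta] is. The
    cavity expansion bounds its expectation below by
    [E (J * tanh (beta * J)) / 2] times the sum of [E (1 - m e ^+ 2)]. Because
    [alpha > 1], the number [N * E (J * tanh (beta * J))] is at least of order
    [beta `^ (alpha - 1)], so the average of [1 - m e ^+ 2] is
    [O (beta `^ (1 - alpha))] ([site_sq_low_temperature]).

    Bond overlap. Remove two heavy bonds [e] and [f]. By the high temperature result
    the means of [s e], [s f] and [s e * s f] in the remaining system are small in the
    mean square sense, so that the two bonds behave like free spins in independent
    fields: [<s e * s f>] is close to [t e * t f] ([double_cavity_dist]). Hence the
    second moment of the sum, over the heavy bonds, of the centred two-replica
    products is the square of [N ^+ 2 / 2] times the expectation of [t ^+ 2 - c] on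
    the event that a coupling is heavy, up to [o (N ^+ 2)]. With [c] the mean of
    [tanh ^+ 2] under the limiting law of a heavy coupling this is [o (N ^+ 2)] too,
    whereas the number of heavy bonds concentrates around a multiple of [N]
    ([bond_deviation_le], [bond_deviation_cvg]).

    The couplings. Regular variation gives the limit [x `^ (- alpha)] of
    [N * P (`|J| > x)], and, by iterating over scales as in Karamata's theorem, bounds
    on the truncated moments of [J] that are uniform in [N]. Expectations of
    [tanh ^+ 2] over heavy couplings converge because this function is uniformly
    approximated by combinations of indicators of the events [`|J| > x]. *)

(** * Hyperbolic functions *)

Section Hyperbolic.
Context {R : realType}.
Implicit Types x y s t m : R.

Definition cosh x : R := (expR x + expR (- x)) / 2.

Definition sinh x : R := (expR x - expR (- x)) / 2.

Definition logcosh x : R := ln (cosh x).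

Lemma cosh_gt0 x : 0 < cosh x.
Proof. by rewrite divr_gt0 // addr_gt0 // expR_gt0. Qed.

Lemma coshN x : cosh (- x) = cosh x.
Proof. by rewrite /cosh opprK addrC. Qed.

Lemma sinhN x : sinh (- x) = - sinh x.
Proof. by rewrite /sinh opprK -mulNr opprB. Qed.

Lemma tanhE x : tanh x = sinh x / cosh x.
Proof.
have := expR_gt0 x; have := expR_gt0 (- x); rewrite /tanh /sinh /cosh => ? ?.
by field; rewrite gt_eqF //; lra.
Qed.

Lemma tanhN x : tanh (- x) = - tanh x.
Proof. by rewrite !tanhE sinhN coshN mulNr. Qed.

Lemma tanh0 : tanh (0 : R) = 0.
Proof. by rewrite /tanh oppr0 subrr mul0r. Qed.

Lemma sqr_cosh x : cosh x ^+ 2 = 1 + sinh x ^+ 2.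
Proof.
have h : expR x * expR (- x) = 1 by rewrite expRxMexpNx_1.
by rewrite /cosh /sinh; field: h.
Qed.

Lemma cosh_ge1 x : 1 <= cosh x.
Proof.
have := cosh_gt0 x; have := sqr_cosh x; have := sqr_ge0 (sinh x).
by rewrite expr2 => ? ? ?; nra.
Qed.

Lemma logcosh_ge0 x : 0 <= logcosh x.
Proof. by rewrite ln_ge0 // cosh_ge1. Qed.

Lemma expR_logcosh x : expR (logcosh x) = cosh x.
Proof. by rewrite lnK // posrE cosh_gt0. Qed.

Lemma logcosh_le_norm x : logcosh x <= `|x|.
Proof.
rewrite -ler_expR expR_logcosh /cosh.
have a : expR x <= expR `|x| by rewrite ler_expR ler_norm.
have b : expR (- x) <= expR `|x| by rewrite ler_expR lerNl lerNnormlW.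
lra.
Qed.

Lemma ge0_tanh x : 0 <= x -> 0 <= tanh x.
Proof.
move=> x0; apply: divr_ge0; last by rewrite addr_ge0 ?expR_ge0.
by rewrite subr_ge0 ler_expR; lra.
Qed.

Lemma norm_tanh_lt1 x : `|tanh x| < 1.
Proof.
have ? := expR_gt0 x; have ? := expR_gt0 (- x).
by rewrite ltr_norml ltr_pdivlMr ?ltr_pdivrMr ?addr_gt0 //; lra.
Qed.

Lemma tanh_lt : {homo (@tanh R) : x y / x < y}.
Proof.
move=> x y; rewrite -ltr_expR => xy.
have ex := expR_gt0 x; have ey := expR_gt0 y.
rewrite /tanh !expRN ltr_pdivrMr ?addr_gt0 ?invr_gt0 //.
rewrite mulrAC ltr_pdivlMr ?addr_gt0 ?invr_gt0 //.
set a := expR x in xy ex *; set b := expR y in xy ey *.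
have ha : a * a^-1 = 1 by rewrite divff // gt_eqF.
have hb : b * b^-1 = 1 by rewrite divff // gt_eqF.
have : 0 < b * a^-1 - a * b^-1.
  rewrite subr_gt0 (@lt_trans _ _ 1) //.
    by rewrite ltr_pdivrMr // mul1r.
  by rewrite ltr_pdivlMr // mul1r.
lra.
Qed.

Lemma tanh_le : {homo (@tanh R) : x y / x <= y}.
Proof. by move=> x y; rewrite le_eqVlt => /orP[/eqP->//|/tanh_lt/ltW]. Qed.

Lemma tanh_surj s : 0 <= s < 1 -> exists2 y, 0 <= y & tanh y = s.
Proof.
move=> /andP[s0 s1]; pose q := (1 + s) / (1 - s).
have q1 : 1 <= q by rewrite /q ler_pdivlMr; lra.
have q0 : 0 < q by lra.
exists (ln q / 2); first by rewrite divr_ge0 ?ln_ge0.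
have e2 : expR (ln q / 2) * expR (ln q / 2) = q by rewrite -expRD -splitr lnK.
have e0 := expR_gt0 (ln q / 2).
rewrite /tanh expRN; move: (expR _) e2 e0 => e e2 e0.
have -> : (e - e^-1) / (e + e^-1) = (e * e - 1) / (e * e + 1).
  by field; rewrite !gt_eqF //; nra.
rewrite e2 /q; field; rewrite !gt_eqF //; lra.
Qed.

Lemma tanh_norm x : tanh `|x| = `|tanh x|.
Proof.
case: (ler0P x) => x0.
  by rewrite tanhN ler0_norm // -oppr_ge0 -tanhN ge0_tanh // oppr_ge0.
by rewrite ger0_norm // ge0_tanh // ltW.
Qed.

Lemma mul_tanh_norm b x : 0 <= b -> x * tanh (b * x) = `|x| * tanh (b * `|x|).
Proof.
move=> b0; case: (ler0P x) => // _; first by rewrite mulrN tanhN mulrNN.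
Qed.

Lemma mul_tanh_ge0 b x : 0 <= b -> 0 <= x * tanh (b * x).
Proof. by move=> b0; rewrite mul_tanh_norm // mulr_ge0 // ge0_tanh // mulr_ge0. Qed.

(** An Ising bond weight is affine in the sign [s], which makes the cavity formulas
    below rational in [tanh]. *)
Lemma expR_spin x s : s ^+ 2 = 1 -> expR (x * s) = cosh x * (1 + tanh x * s).
Proof.
move=> s1; rewrite tanhE mulrDr mulr1 mulrA mulrCA divff ?gt_eqF ?cosh_gt0 // mulr1.
have /orP[/eqP->|/eqP->] : (s == 1) || (s == - 1).
  by rewrite -sqrf_eq1 s1 eqxx.
- by rewrite !mulr1 /cosh /sinh; field.
- by rewrite !mulrN1 /cosh /sinh; field.
Qed.

Let homo_of_ge0_derive (f g : R -> R) x :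
  (forall y, is_derive y (1 : R) f (g y)) -> (forall y, 0 <= y -> 0 <= g y) ->
  0 <= x -> f 0 <= f x.
Proof.
move=> df g0 x0.
apply: (@ger0_derive1_ndecry _ f 0) => // [y|].
- rewrite in_itv /= andbT => /ltW y0; rewrite derive1E.
  by have [_ ->] := df y; exact: g0.
- apply: derivable_within_continuous => y _; by have [] := df y.
Qed.

#[local] Instance is_derive_cosh y : is_derive y (1 : R) cosh (sinh y).
Proof.
rewrite /cosh /sinh; apply: is_derive_eq.
by rewrite /GRing.scale /=; field.
Qed.

#[local] Instance is_derive_sinh y : is_derive y (1 : R) sinh (cosh y).
Proof.
rewrite /cosh /sinh; apply: is_derive_eq.
by rewrite /GRing.scale /=; field.
Qed.

Lemma sinh_ge0 x : 0 <= x -> 0 <= sinh x.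
Proof. by move=> x0; rewrite divr_ge0 // subr_ge0 ler_expR; lra. Qed.

Lemma sinh_le_mul_cosh x : 0 <= x -> sinh x <= x * cosh x.
Proof.
move=> x0; rewrite -subr_ge0.
have -> : 0 = 0 * cosh 0 - sinh 0 by rewrite mul0r /sinh oppr0 subrr mul0r subr0.
apply: (homo_of_ge0_derive (f := fun y => y * cosh y - sinh y)
  (g := fun y => y * sinh y)) => // [y|y y0].
  by apply: is_derive_eq; rewrite /GRing.scale /=; ring.
by rewrite mulr_ge0 // sinh_ge0.
Qed.

Lemma cosh_le_expR_sqr x : cosh x <= expR (x ^+ 2 / 2).
Proof.
wlog x0 : x / 0 <= x.
  move=> H; have /orP[/H //|] := le_total 0 x.
  by rewrite -oppr_ge0 => /H; rewrite coshN sqrrN.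
have : - 1 <= - (expR (- (x ^+ 2 / 2)) * cosh x).
  have -> : - 1 = - (expR (- (0 ^+ 2 / 2)) * cosh 0) :> R.
    by rewrite expr0n /= mul0r oppr0 expR0 /cosh oppr0 expR0 divff ?mulr1.
  apply: (homo_of_ge0_derive (f := fun y => - (expR (- (y ^+ 2 / 2)) * cosh y))
    (g := fun y => expR (- (y ^+ 2 / 2)) * (y * cosh y - sinh y))) => // [y|y y0].
    apply: is_derive_eq; rewrite /GRing.scale /=.
    by move: (expR _) (sinh y) (cosh y) => E sh ch; field.
  by rewrite mulr_ge0 ?expR_ge0 // subr_ge0 sinh_le_mul_cosh.
by rewrite lerN2 expRN ler_pdivrMl ?expR_gt0 // mulr1.
Qed.

Lemma logcosh_le_sqr x : logcosh x <= x ^+ 2 / 2.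
Proof. by rewrite -ler_expR expR_logcosh cosh_le_expR_sqr. Qed.

Lemma norm_tanh_le x : `|tanh x| <= `|x|.
Proof.
rewrite -tanh_norm tanhE ler_pdivrMr ?cosh_gt0 //.
exact: sinh_le_mul_cosh.
Qed.

Lemma sqr_tanh_le x : tanh x ^+ 2 <= x ^+ 2.
Proof. by rewrite -[leLHS]real_normK ?num_real // -[leRHS]real_normK ?num_real //
  lerXn2r ?nnegrE // norm_tanh_le. Qed.

(** Second-order control of [logcosh] that survives an infinite second moment:
    the error is again a [logcosh], hence at most linear for large [y]. *)
Lemma logcoshD_le x y : 0 <= x * y ->
  logcosh (x + y) <= logcosh x + tanh x * y + logcosh y.
Proof.
move=> xy; rewrite -ler_expR !expRD !expR_logcosh.
have e : cosh (x + y) = cosh x * cosh y * (1 + tanh x * tanh y).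
  have tc z : tanh z * cosh z = sinh z.
    by rewrite tanhE divfK // gt_eqF // cosh_gt0.
  have -> : cosh x * cosh y * (1 + tanh x * tanh y) =
    cosh x * cosh y + tanh x * cosh x * (tanh y * cosh y) by ring.
  rewrite !tc /cosh /sinh opprD !expRD.
  by move: (expR x) (expR y) (expR _) (expR _) => *; field.
rewrite e -mulrA [leRHS]mulrAC -[leRHS]mulrA.
apply: ler_wpM2l; first exact/ltW/cosh_gt0.
apply: ler_wpM2l; first exact/ltW/cosh_gt0.
apply: le_trans (expR_ge1Dx _) _; rewrite ler_expR.
have txy : 0 <= tanh x * y.
  case: (ler0P x) => x0; last first.
    by rewrite mulr_ge0 ?ge0_tanh ?(ltW x0) // -(pmulr_rge0 _ x0).
  move: x0; rewrite le_eqVlt => /orP[/eqP->|x0]; first by rewrite tanh0 mul0r.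
  rewrite -mulrNN -tanhN mulr_ge0 ?ge0_tanh ?oppr_ge0 ?(ltW x0) //.
  by rewrite -(nmulr_rge0 _ x0).
rewrite -(ger0_norm txy); apply: le_trans (ler_norm _) _.
rewrite (normrM (tanh x)) (normrM (tanh x) y).
by rewrite ler_wpM2l // norm_tanh_le.
Qed.

End Hyperbolic.

(** * Gibbs means for fixed couplings *)

Section GibbsAlgebra.
Context {R : realType} {N : nat}.
Implicit Types (beta : R) (J : bond N -> R) (f g : config N -> R)
  (s : config N) (e : bond N).

Definition mean beta J f : R := \sum_(s : config N) gibbs beta J s * f s.

Definition delete J e : bond N -> R := fun b => if b == e then 0 else J b.

Lemma sqr_spin s i : (spin s i : R) ^+ 2 = 1.
Proof. by rewrite sqrr_sign. Qed.

Lemma norm_spin s i : `|spin s i : R| = 1.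
Proof. by rewrite /spin normrX normrN1 expr1n. Qed.

Lemma sqr_bond_spin s e : (bond_spin s e : R) ^+ 2 = 1.
Proof. by rewrite /bond_spin exprMn !sqr_spin mulr1. Qed.

Lemma norm_bond_spin s e : `|bond_spin s e : R| = 1.
Proof. by rewrite /bond_spin normrM !norm_spin mulr1. Qed.

Lemma partition_function_gt0 beta J : 0 < partition_function beta J.
Proof.
rewrite /partition_function (bigD1 [ffun=> false]) //= ltr_pwDl ?expR_gt0 //.
by apply: sumr_ge0 => s _; exact: expR_ge0.
Qed.

Lemma gibbs_ge0 beta J s : 0 <= gibbs beta J s.
Proof. by rewrite divr_ge0 ?expR_ge0 // ltW // partition_function_gt0. Qed.

Lemma sum_gibbs beta J : \sum_s gibbs beta J s = 1.
Proof.
by rewrite -mulr_suml divff // gt_eqF // partition_function_gt0.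
Qed.

Lemma eq_mean beta J f g : f =1 g -> mean beta J f = mean beta J g.
Proof. by move=> fg; apply: eq_bigr => s _; rewrite fg. Qed.

Lemma mean_cst beta J (c : R) : mean beta J (fun=> c) = c.
Proof. by rewrite /mean -mulr_suml sum_gibbs mul1r. Qed.

Lemma meanD beta J f g :
  mean beta J (fun s => f s + g s) = mean beta J f + mean beta J g.
Proof. by rewrite /mean -big_split; apply: eq_bigr => s _; rewrite mulrDr. Qed.

Lemma meanZl beta J (c : R) f : mean beta J (fun s => c * f s) = c * mean beta J f.
Proof. by rewrite /mean mulr_sumr; apply: eq_bigr => s _; rewrite mulrCA. Qed.

Lemma meanB beta J f g :
  mean beta J (fun s => f s - g s) = mean beta J f - mean beta J g.
Proof.
rewrite -[RHS]/(_ + _) -mulN1r -meanZl -meanD.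
by apply: eq_mean => s; rewrite mulN1r.
Qed.

Lemma mean_sum beta J (I : Type) (r : seq I) (p : pred I) (F : I -> config N -> R) :
  mean beta J (fun s => \sum_(i <- r | p i) F i s) =
  \sum_(i <- r | p i) mean beta J (F i).
Proof.
by rewrite /mean exchange_big /=; apply: eq_bigr => s _; rewrite mulr_sumr.
Qed.

Lemma ler_mean beta J f g : (forall s, f s <= g s) -> mean beta J f <= mean beta J g.
Proof. by move=> fg; apply: ler_sum => s _; rewrite ler_wpM2l // gibbs_ge0. Qed.

Lemma norm_mean_le_mean beta J f : `|mean beta J f| <= mean beta J (fun s => `|f s|).
Proof.
apply: le_trans (ler_norm_sum _ _ _) _; apply: ler_sum => s _.
by rewrite normrM ger0_norm // gibbs_ge0.
Qed.

Lemma norm_mean_le beta J f (c : R) : (forall s, `|f s| <= c) -> `|mean beta J f| <= c.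
Proof.
move=> fc; apply: le_trans (norm_mean_le_mean _ _ _) _.
by rewrite -[leRHS](mean_cst beta J); exact: ler_mean.
Qed.

(** Jensen's inequality, from the tangent of the exponential at the mean. *)
Lemma expR_mean_le beta J f : expR (mean beta J f) <= mean beta J (fun s => expR (f s)).
Proof.
set a := mean beta J f.
have H s : expR a * (1 + f s - a) <= expR (f s).
  rewrite -[X in _ <= expR X](subrKC a) expRD ler_wpM2l ?expR_ge0 //.
  by rewrite -addrA expR_ge1Dx.
apply: le_trans (ler_mean beta J H).
by rewrite meanZl meanB meanD !mean_cst -/a addrK mulr1.
Qed.

Lemma mean_unnormalized beta J f : mean beta J f =
  (\sum_s expR (neg_hamiltonian beta J s) * f s) / partition_function beta J.
Proof. by rewrite mulr_suml; apply: eq_bigr => s _; rewrite mulrAC. Qed.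

Lemma expR_neg_hamiltonian_delete beta J e s :
  expR (neg_hamiltonian beta J s) =
  cosh (beta * J e) * (1 + tanh (beta * J e) * bond_spin s e) *
  expR (neg_hamiltonian beta (delete J e) s).
Proof.
rewrite -expR_spin ?sqr_bond_spin // -expRD; congr expR.
rewrite /neg_hamiltonian (bigD1 e) //= [in RHS](bigD1 e) //= /delete eqxx.
rewrite mul0r add0r mulrDr mulrA; congr (_ + _ * _).
by apply: eq_bigr => b /negPf ->.
Qed.

Lemma partition_function_delete beta J e :
  partition_function beta J =
  cosh (beta * J e) * partition_function beta (delete J e) *
  (1 + tanh (beta * J e) * mean beta (delete J e) (fun s => bond_spin s e)).
Proof.
rewrite mean_unnormalized mulrDr mulr1.
have Z0 : partition_function beta (delete J e) != 0.
  by rewrite gt_eqF ?partition_function_gt0.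
have -> (a b c d : R) : b != 0 -> a * b * (c * (d / b)) = a * (c * d).
  by move=> b0; field.
- rewrite [LHS](eq_bigr _ (fun s _ => expR_neg_hamiltonian_delete beta J e s)).
  rewrite -mulrDr /partition_function [c in _ = _ * (_ + c)]mulr_sumr -big_split mulr_sumr.
  by apply: eq_bigr => s _ /=; ring.
- exact: Z0.
Qed.

Lemma norm_mul_lt1 (t m : R) : `|t| < 1 -> `|m| <= 1 -> `|t * m| < 1.
Proof.
move=> t1 m1; rewrite normrM; apply: le_lt_trans t1.
by rewrite ler_piMr.
Qed.

Lemma mul_tanh_lt1 (x m : R) : `|m| <= 1 -> 0 < 1 + tanh x * m.
Proof.
by move=> m1; have := norm_mul_lt1 (norm_tanh_lt1 x) m1; rewrite ltr_norml => /andP[]; lra.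
Qed.

Lemma norm_mean_bond beta J e : `|mean beta J (fun s => bond_spin s e)| <= 1.
Proof. by apply: norm_mean_le => s; rewrite norm_bond_spin. Qed.

(** The cavity formula: putting one bond back tilts the Gibbs measure by
    [1 + t * bond_spin]. *)
Lemma mean_delete beta J e f :
  let t := tanh (beta * J e) in
  mean beta J f =
  (mean beta (delete J e) f + t * mean beta (delete J e) (fun s => f s * bond_spin s e))
  / (1 + t * mean beta (delete J e) (fun s => bond_spin s e)).
Proof.
move=> t; have Z0 := partition_function_gt0 beta (delete J e).
have c0 := cosh_gt0 (beta * J e).
have d0 : 0 < 1 + t * mean beta (delete J e) (fun s => bond_spin s e).
  exact/mul_tanh_lt1/norm_mean_bond.
rewrite mean_unnormalized (partition_function_delete beta J e) -/t.
have -> : \sum_s expR (neg_hamiltonian beta J s) * f s =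
    cosh (beta * J e) * partition_function beta (delete J e) *
   (mean beta (delete J e) f + t * mean beta (delete J e) (fun s => f s * bond_spin s e)).
  rewrite -mulrA mulrDr [_ * (t * _)]mulrCA !mean_unnormalized.
  rewrite !(mulrC (partition_function _ _)) !divfK ?gt_eqF //.
  rewrite mulr_sumr -big_split mulr_sumr; apply: eq_bigr => s _ /=.
  rewrite (expR_neg_hamiltonian_delete _ _ e) -/t; ring.
by field; rewrite !gt_eqF.
Qed.

Lemma mean_bond_delete beta J e :
  let t := tanh (beta * J e) in
  let m := mean beta (delete J e) (fun s => bond_spin s e) in
  mean beta J (fun s => bond_spin s e) = (t + m) / (1 + t * m).
Proof.
move=> t m; rewrite (mean_delete beta J e) -/t -/m addrC; congr ((_ + _) / _).
rewrite -[RHS]mulr1 -(mean_cst beta (delete J e) 1); congr (_ * _).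
by apply: eq_mean => s; rewrite -expr2 sqr_bond_spin.
Qed.

(** The covariance of a bounded function with a sign is at most the variance of
    the sign, and [1 - m ^+ 2 <= 2 * (1 + t * m)] absorbs the denominator of the
    cavity formula, even when [t] and [m] are close to [1] and [-1]. *)
Lemma mean_delete_dist beta J e f : (forall s, `|f s| <= 1) ->
  `|mean beta J f - mean beta (delete J e) f| <= 2 * `|tanh (beta * J e)|.
Proof.
move=> f1; rewrite (mean_delete beta J e).
set t := tanh _; set a := mean _ _ f; set b := mean _ _ (fun s => bond_spin s e).
set c := mean _ _ _.
have b1 : `|b| <= 1 by exact: norm_mean_bond.
have d0 : 0 < 1 + t * b by exact: mul_tanh_lt1.
have -> : (a + t * c) / (1 + t * b) - a = t * (c - a * b) / (1 + t * b).
  by field; rewrite gt_eqF.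
rewrite normrM normfV (gtr0_norm d0) ler_pdivrMr // normrM.
rewrite [leRHS]mulrAC [leRHS]mulrC ler_wpM2l //.
have cov : `|c - a * b| <= 1 - b ^+ 2.
  have -> : c - a * b = mean beta (delete J e) (fun s => f s * (bond_spin s e - b)).
    under eq_mean do rewrite mulrBr (mulrC _ b).
    by rewrite meanB meanZl mulrC.
  apply: le_trans (norm_mean_le_mean _ _ _) _.
  have -> : 1 - b ^+ 2 = mean beta (delete J e) (fun s => 1 - b * bond_spin s e).
    by rewrite meanB mean_cst meanZl expr2.
  apply: ler_mean => s; rewrite normrM; apply: le_trans (ler_piMl _ (f1 s)) _ => //.
  have /orP[/eqP->|/eqP->] : (bond_spin s e == 1 :> R) || (bond_spin s e == - 1 :> R).
  - by rewrite -sqrf_eq1 sqr_bond_spin.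
  - by rewrite mulr1 ger0_norm //; move: b1; rewrite ler_norml; lra.
  - by rewrite mulrN1 ler0_norm //; move: b1; rewrite ler_norml; lra.
apply: le_trans cov _.
have : `|t| < 1 by exact: norm_tanh_lt1.
move: b1; rewrite ler_norml ltr_norml => /andP[? ?] /andP[? ?].
by have [?|?] := lerP 0 b; nra.
Qed.

(** The free energy is convex in [beta] and lies above its tangents. *)
Lemma ln_partition_gradient beta h J :
  ln (partition_function beta J) +
    h * \sum_e J e * mean beta J (fun s => bond_spin s e) <=
  ln (partition_function (beta + h) J).
Proof.
have Z0 := partition_function_gt0 beta J.
rewrite -ler_expR expRD !lnK ?posrE ?partition_function_gt0 //.
have -> : h * \sum_e J e * mean beta J (fun s => bond_spin s e) =
    mean beta J (fun s => h * \sum_e J e * bond_spin s e).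
  rewrite meanZl mean_sum; congr (_ * _); apply: eq_bigr => e _.
  by rewrite -meanZl.
apply: (@le_trans _ _ (partition_function beta J *
  mean beta J (fun s => expR (h * \sum_e J e * bond_spin s e)))).
  by rewrite ler_wpM2l ?expR_mean_le // ltW.
rewrite mean_unnormalized mulrC divfK ?gt_eqF //.
by apply: ler_sum => s _; rewrite -expRD /neg_hamiltonian -mulrDl.
Qed.

(** A single configuration already bounds the partition function at inverse
    temperature one, so the energy per site stays bounded for every [beta]. *)
Lemma sum_mean_le_ln_partition beta J :
  \sum_e J e * mean beta J (fun s => bond_spin s e) <= ln (partition_function 1 J).
Proof.
have -> : \sum_e J e * mean beta J (fun s => bond_spin s e) =
    mean beta J (fun s => \sum_e J e * bond_spin s e).
  by rewrite mean_sum; apply: eq_bigr => e _; rewrite -meanZl.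
rewrite -[leRHS](mean_cst beta J); apply: ler_mean => s.
rewrite -ler_expR lnK ?posrE ?partition_function_gt0 //.
rewrite /partition_function (bigD1 s) //= /neg_hamiltonian mul1r lerDl.
by apply: sumr_ge0 => s' _; exact: expR_ge0.
Qed.

End GibbsAlgebra.

(** * Replicas and overlaps *)

Section PairSums.
Context {R : realType} {N : nat}.

Lemma sum_bond (F : 'I_N * 'I_N -> R) :
  \sum_(e : bond N) F (val e) = \sum_(p : 'I_N * 'I_N | (p.1 < p.2)%N) F p.
Proof.
have [/eqP b0|/card_gt0P[e0 _]] := posnP #|bond N|.
  rewrite !big1 // => [p hp|e _]; last by have := card0_eq (eqP b0) e; rewrite inE.
  by have := card0_eq (eqP b0) (Sub p hp : bond N); rewrite inE.
rewrite (reindex_onto (val : bond N -> _) (insubd e0)) /= => [|p hp].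
  by apply: eq_big => [e|//]; rewrite valKd eqxx (valP e).
by rewrite insubdK.
Qed.

Lemma sum_pairs_bond (F : 'I_N -> 'I_N -> R) : (forall i j, F i j = F j i) ->
  \sum_i \sum_j F i j = \sum_i F i i + 2 * \sum_(e : bond N) F (val e).1 (val e).2.
Proof.
move=> FC; rewrite (sum_bond (fun p => F p.1 p.2)).
rewrite -(pair_big_dep predT (fun i j : 'I_N => (i < j)%N) F) /=.
have H : \sum_(i : 'I_N) \sum_(j : 'I_N | (j < i)%N) F i j =
    \sum_(i : 'I_N) \sum_(j : 'I_N | (i < j)%N) F i j.
  rewrite (exchange_big_dep predT) //=; apply: eq_bigr => i _.
  by apply: eq_bigr => j _; exact: FC.
rewrite mulr_natl mulr2n -[X in _ + (X + _)]H -!big_split /=; apply: eq_bigr => i _.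
rewrite (bigD1 i) //= (bigID (fun j : 'I_N => (j < i)%N)) /=; congr (_ + (_ + _)).
  by apply: eq_bigl => j; rewrite -val_eqE neq_ltn; case: ltngtP.
by apply: eq_bigl => j; rewrite -val_eqE neq_ltn; case: ltngtP.
Qed.

Lemma sqr_sum_sign (x : 'I_N -> R) : (forall i, x i ^+ 2 = 1) ->
  (\sum_i x i) ^+ 2 = N%:R + 2 * \sum_(e : bond N) x (val e).1 * x (val e).2.
Proof.
move=> x1; rewrite expr2 big_distrlr /= sum_pairs_bond; last by move=> *; rewrite mulrC.
congr (_ + _); rewrite (eq_bigr (fun=> 1)); last by move=> i _; rewrite -expr2.
by rewrite sumr_const card_ord.
Qed.

Lemma card_bond : 2 * #|bond N|%:R = N%:R ^+ 2 - N%:R :> R.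
Proof.
have := @sqr_sum_sign (fun=> 1) (fun=> expr1n _ 2).
under [X in _ + _ * X]eq_bigr do rewrite mulr1.
by rewrite !sumr_const card_ord => ->; ring.
Qed.

Lemma card_bond_le : #|bond N|%:R <= N%:R ^+ 2 / 2 :> R.
Proof. by have := card_bond; have := ler0n R N; lra. Qed.

End PairSums.

Section Replicas.
Context {R : realType} {N : nat}.
Implicit Types (beta : R) (J : bond N -> R).

Definition corr beta J (i j : 'I_N) : R := mean beta J (fun s => spin s i * spin s j).

Lemma corr_sym beta J i j : corr beta J i j = corr beta J j i.
Proof. by apply: eq_mean => s; rewrite mulrC. Qed.

Lemma corr_diag beta J i : corr beta J i i = 1.
Proof.
rewrite -(mean_cst beta J 1); apply: eq_mean => s.
by rewrite -expr2 sqr_spin.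
Qed.

Lemma corr_bond beta J e :
  corr beta J (val e).1 (val e).2 = mean beta J (fun s => bond_spin s e).
Proof. by []. Qed.

Lemma norm_corr beta J i j : `|corr beta J i j| <= 1.
Proof. by apply: norm_mean_le => s; rewrite normrM !norm_spin mulr1. Qed.

Lemma sqr_corr_le1 beta J i j : corr beta J i j ^+ 2 <= 1.
Proof. by rewrite -(ger0_norm (sqr_ge0 _)) normrX exprn_ile1 // norm_corr. Qed.

Lemma gibbs_average_prod beta J n (h : 'I_n -> config N -> R) :
  gibbs_average beta J (fun s : 'I_n -> config N => \prod_(l < n) h l (s l)) =
  \prod_(l < n) mean beta J (h l).
Proof.
rewrite /gibbs_average /mean bigA_distr_bigA /=.
by apply: eq_bigr => s _; rewrite -big_split.
Qed.

Lemma eq_gibbs_average beta J n (f g : ('I_n -> config N) -> R) :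
  f =1 g -> gibbs_average beta J f = gibbs_average beta J g.
Proof. by move=> fg; apply: eq_bigr => s _; rewrite fg. Qed.

Lemma gibbs_averageZl beta J n (c : R) (f : ('I_n -> config N) -> R) :
  gibbs_average beta J (fun s => c * f s) = c * gibbs_average beta J f.
Proof. by rewrite /gibbs_average mulr_sumr; apply: eq_bigr => s _; rewrite mulrCA. Qed.

Lemma gibbs_averageD beta J n (f g : ('I_n -> config N) -> R) :
  gibbs_average beta J (fun s => f s + g s) =
  gibbs_average beta J f + gibbs_average beta J g.
Proof. by rewrite /gibbs_average -big_split; apply: eq_bigr => s _; rewrite mulrDr. Qed.

Lemma gibbs_average_sum beta J n (I : finType) (p : pred I)
    (F : I -> ('I_n -> config N) -> R) :
  gibbs_average beta J (fun s => \sum_(i | p i) F i s) =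
  \sum_(i | p i) gibbs_average beta J (F i).
Proof.
by rewrite /gibbs_average exchange_big /=; apply: eq_bigr => s _; rewrite mulr_sumr.
Qed.

Lemma gibbs_average_cst beta J n (c : R) :
  gibbs_average beta J (fun=> c : R) (n := n) = c.
Proof.
rewrite -[RHS]mulr1 -(expr1n R n) -[X in X ^+ _](mean_cst beta J 1).
rewrite -[n in _ ^+ n]card_ord -prodr_const -gibbs_average_prod -gibbs_averageZl.
by apply: eq_gibbs_average => s; rewrite big1 ?mulr1.
Qed.

Lemma ler_gibbs_average beta J n (f g : ('I_n -> config N) -> R) :
  (forall s, f s <= g s) -> gibbs_average beta J f <= gibbs_average beta J g.
Proof.
move=> fg; apply: ler_sum => s _; rewrite ler_wpM2l //.
by apply: prodr_ge0 => l _; exact: gibbs_ge0.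
Qed.

Lemma gibbs_average_site_overlap beta J k :
  gibbs_average beta J (fun s : 'I_k -> config N => site_overlap s ^+ 2) =
  N%:R^-1 ^+ 2 * \sum_i \sum_j corr beta J i j ^+ k.
Proof.
under eq_gibbs_average => s do rewrite /site_overlap exprMn.
rewrite gibbs_averageZl; congr (_ * _).
under eq_gibbs_average => s do rewrite expr2 big_distrlr /=.
rewrite gibbs_average_sum; apply: eq_bigr => i _.
rewrite gibbs_average_sum; apply: eq_bigr => j _.
under eq_gibbs_average => s do rewrite -big_split /=.
by rewrite (gibbs_average_prod _ _ (fun=> fun s => spin s i * spin s j))
  prodr_const card_ord.
Qed.

Lemma sum_sqr_corr beta J :
  \sum_i \sum_j corr beta J i j ^+ 2 =
  N%:R + 2 * \sum_e mean beta J (fun s => bond_spin s e) ^+ 2.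
Proof.
rewrite sum_pairs_bond; last by move=> i j; rewrite corr_sym.
congr (_ + _); rewrite (eq_bigr (fun=> 1)); last by move=> i _; rewrite corr_diag expr1n.
by rewrite sumr_const card_ord.
Qed.

Lemma site_overlap_ge0 beta J k :
  0 <= gibbs_average beta J (fun s : 'I_k -> config N => site_overlap s ^+ 2).
Proof.
rewrite -(gibbs_average_cst beta J k 0); apply: ler_gibbs_average => s.
exact: sqr_ge0.
Qed.

Lemma site_overlap_le beta J k : (0 < k)%N ->
  gibbs_average beta J (fun s : 'I_(2 * k) -> config N => site_overlap s ^+ 2) <=
  N%:R^-1 ^+ 2 * \sum_i \sum_j corr beta J i j ^+ 2.
Proof.
move=> k0; rewrite gibbs_average_site_overlap ler_wpM2l ?exprn_ge0 ?invr_ge0 //.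
apply: ler_sum => i _; apply: ler_sum => j _; rewrite exprM.
by rewrite ler_iXnr // ?sqr_ge0 ?sqr_corr_le1.
Qed.

(** Bernoulli's inequality. *)
Lemma bernoulli_le (x : R) k : 0 <= x <= 1 -> 1 - x ^+ k <= k%:R * (1 - x).
Proof.
move=> /andP[x0 x1]; elim: k => [|k IH]; first by rewrite expr0 subrr mul0r.
have : 0 <= x ^+ k <= 1 by rewrite exprn_ge0 //= exprn_ile1.
by rewrite exprS -natr1 => /andP[? ?]; nra.
Qed.

Lemma site_overlap_ge beta J k : (0 < N)%N ->
  1 - k%:R * (N%:R^-1 ^+ 2 * \sum_i \sum_j (1 - corr beta J i j ^+ 2)) <=
  gibbs_average beta J (fun s : 'I_(2 * k) -> config N => site_overlap s ^+ 2).
Proof.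
move=> N0; rewrite gibbs_average_site_overlap lerBlDl mulrCA -mulrDr.
have N0' : N%:R != 0 :> R by rewrite pnatr_eq0 -lt0n.
rewrite exprVn ler_pdivlMl ?exprn_gt0 ?ltr0n // mulr1.
have -> : N%:R ^+ 2 = \sum_(i < N) \sum_(j < N) 1 :> R.
  by rewrite !sumr_const card_ord expr2 -natrM -mulrnA.
rewrite !mulr_sumr -big_split /=; apply: ler_sum => i _.
rewrite !mulr_sumr -big_split /=; apply: ler_sum => j _.
by rewrite -lerBlDr exprM bernoulli_le // sqr_ge0 sqr_corr_le1.
Qed.

Lemma site_overlap_le1 beta J k : (0 < N)%N ->
  gibbs_average beta J (fun s : 'I_k -> config N => site_overlap s ^+ 2) <= 1.
Proof.
move=> N0; rewrite -[leRHS](gibbs_average_cst beta J k 1).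
apply: ler_gibbs_average => s.
rewrite -(ger0_norm (sqr_ge0 _)) normrX exprn_ile1 // /site_overlap normrM.
rewrite normfV normr_nat ler_pdivrMl ?ltr0n // mulr1.
apply: le_trans (ler_norm_sum _ _ _) _.
rewrite (eq_bigr (fun=> 1)) ?sumr_const ?card_ord // => i _.
by rewrite normr_prod big1 // => l _; rewrite norm_spin.
Qed.

Lemma prod_ord2 (F : 'I_2 -> R) : \prod_(l < 2) F l = F ord0 * F ord_max.
Proof. by rewrite big_ord_recl big_ord1; congr (_ * F _); apply: val_inj. Qed.

Lemma gibbs_average_prod2 beta J (h : config N -> R) :
  gibbs_average beta J (fun s : 'I_2 -> config N => h (s ord0) * h (s ord_max)) =
  mean beta J h ^+ 2.
Proof.
under eq_gibbs_average => s do rewrite -(prod_ord2 (fun l => h (s l))).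
by rewrite (gibbs_average_prod _ _ (fun=> h)) prodr_const card_ord.
Qed.

(** Four-spin correlations are controlled by two-spin ones, because the overlap
    of two replicas is bounded. *)
Lemma sum_sqr_mean_bond_pairs beta J :
  \sum_e \sum_f mean beta J (fun s => bond_spin s e * bond_spin s f) ^+ 2 <=
  N%:R ^+ 2 / 4 * (N%:R + \sum_i \sum_j corr beta J i j ^+ 2).
Proof.
pose x (s : 'I_2 -> config N) i : R := spin (s ord0) i * spin (s ord_max) i.
pose y (s : 'I_2 -> config N) e : R := bond_spin (s ord0) e * bond_spin (s ord_max) e.
have x1 s i : x s i ^+ 2 = 1 by rewrite exprMn !sqr_spin mulr1.
have yE s e : y s e = x s (val e).1 * x s (val e).2.
  by rewrite /y /x /bond_spin; ring.
have -> : \sum_e \sum_f mean beta J (fun s => bond_spin s e * bond_spin s f) ^+ 2 =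
    gibbs_average beta J (fun s => (\sum_e y s e) ^+ 2).
  under [RHS]eq_gibbs_average => s do rewrite expr2 big_distrlr /=.
  rewrite gibbs_average_sum; apply: eq_bigr => e _.
  rewrite gibbs_average_sum; apply: eq_bigr => f _.
  by rewrite -gibbs_average_prod2; apply: eq_gibbs_average => s; rewrite mulrACA.
have -> : N%:R + \sum_i \sum_j corr beta J i j ^+ 2 =
    gibbs_average beta J (fun s => N%:R + (\sum_i x s i) ^+ 2).
  rewrite gibbs_averageD gibbs_average_cst; congr (_ + _).
  under [RHS]eq_gibbs_average => s do rewrite expr2 big_distrlr /=.
  rewrite gibbs_average_sum; apply: eq_bigr => i _.
  rewrite gibbs_average_sum; apply: eq_bigr => j _.
  by rewrite -gibbs_average_prod2; apply: eq_gibbs_average => s; rewrite mulrACA.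
rewrite -gibbs_averageZl; apply: ler_gibbs_average => s.
rewrite (sqr_sum_sign (x1 s)); under [in leRHS]eq_bigr do rewrite -yE.
set S := \sum_e y s e.
have S_le : `|S| <= N%:R ^+ 2 / 2.
  apply: le_trans card_bond_le; apply: le_trans (ler_norm_sum _ _ _) _.
  rewrite (eq_bigr (fun=> 1)) ?sumr_const // => e _.
  by rewrite normrM !norm_bond_spin mulr1.
have NS : 0 <= N%:R + 2 * S.
  have := sqr_sum_sign (x1 s); under [in X in _ = X -> _]eq_bigr do rewrite -yE.
  by rewrite -/S => <-; exact: sqr_ge0.
have NR := ler0n R N.
by move: S_le; rewrite ler_norml => /andP[? ?]; nra.
Qed.

End Replicas.

(** * Independence *)

Section Integrability.
Context d (T : measurableType d) (R : realType) (P : probability T R).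
Implicit Types F G : T -> R.

Lemma integrable_measurable F : P.-integrable setT (EFin \o F) -> measurable_fun setT F.
Proof. by move=> /(measurable_int P) /measurable_EFinP. Qed.

Lemma le_integrable_real F G : measurable_fun setT F ->
  (forall w, `|F w| <= G w) -> P.-integrable setT (EFin \o G) ->
  P.-integrable setT (EFin \o F).
Proof.
move=> mF FG iG; apply: (le_integrable _ _ _ iG) => //; first exact/measurable_EFinP.
move=> w _ /=; rewrite lee_fin (le_trans (FG w)) //.
by rewrite ler_norm.
Qed.

Lemma bounded_integrable F (c : R) : measurable_fun setT F ->
  (forall w, `|F w| <= c) -> P.-integrable setT (EFin \o F).
Proof.
move=> mF Fc; apply: (le_integrable_real mF Fc).
exact: finite_measure_integrable_cst.
Qed.

Lemma integrable_sum_real (I : Type) (r : seq I) (p : pred I) (F : I -> T -> R) :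
  (forall i, P.-integrable setT (EFin \o F i)) ->
  P.-integrable setT (EFin \o (fun w => \sum_(i <- r | p i) F i w)).
Proof.
move=> iF; have -> : EFin \o (fun w => \sum_(i <- r | p i) F i w) =
    (fun w => (\sum_(i <- r | p i) (F i w)%:E)%E).
  by apply/funext => w /=; rewrite sumEFin.
by apply: integrable_sum => // i _; exact: iF.
Qed.

Lemma integrableD_real F G : P.-integrable setT (EFin \o F) ->
  P.-integrable setT (EFin \o G) ->
  P.-integrable setT (EFin \o (fun w => F w + G w)).
Proof.
by move=> iF iG; apply: eq_integrable (integrableD measurableT iF iG).
Qed.

Lemma integrableZl_real c F : P.-integrable setT (EFin \o F) ->
  P.-integrable setT (EFin \o (fun w => c * F w)).
Proof.
by move=> iF; apply: eq_integrable (integrableZl measurableT c iF).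
Qed.

Lemma integrableB_real F G : P.-integrable setT (EFin \o F) ->
  P.-integrable setT (EFin \o G) ->
  P.-integrable setT (EFin \o (fun w => F w - G w)).
Proof.
by move=> iF iG; apply: eq_integrable (integrableB measurableT iF iG).
Qed.

Lemma Rintegral_sum (I : Type) (r : seq I) (p : pred I) (F : I -> T -> R) :
  (forall i, P.-integrable setT (EFin \o F i)) ->
  \int[P]_w (\sum_(i <- r | p i) F i w) = \sum_(i <- r | p i) \int[P]_w F i w.
Proof.
move=> iF; elim: r => [|i r IH].
  by under eq_Rintegral do rewrite big_nil; rewrite Rintegral_cst // mul0r big_nil.
under eq_Rintegral do rewrite big_cons; rewrite big_cons.
case: (p i) => //; rewrite RintegralD // ?IH //.
exact: integrable_sum_real.
Qed.

Lemma integrable_cstT (c : R) : P.-integrable setT (EFin \o (fun=> c)).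
Proof. exact: finite_measure_integrable_cst. Qed.

Lemma Rintegral_cstT (c : R) : \int[P]_w c = c.
Proof.
rewrite Rintegral_cst // -[RHS]mulr1; congr (_ * _).
exact: (congr1 fine (probability_setT P)).
Qed.

Lemma ler_RintegralT F G : P.-integrable setT (EFin \o F) ->
  P.-integrable setT (EFin \o G) -> (forall w, F w <= G w) ->
  \int[P]_w F w <= \int[P]_w G w.
Proof. by move=> iF iG FG; apply: le_Rintegral. Qed.

End Integrability.

Section ProductExpectation.
Context d (T : measurableType d) (R : realType) (P : probability T R).

(** The joint law agrees with the product law on rectangles, hence everywhere, and
    Fubini's theorem applies. *)
Lemma Rintegral_mul_indep (Y Z : T -> R) :
  P.-integrable setT (EFin \o Y) -> P.-integrable setT (EFin \o Z) ->
  (forall A B : set R, measurable A -> measurable B ->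
     P (Y @^-1` A `&` Z @^-1` B) = (P (Y @^-1` A) * P (Z @^-1` B))%E) ->
  P.-integrable setT (EFin \o (fun w => Y w * Z w)) /\
  \int[P]_w (Y w * Z w) = \int[P]_w Y w * \int[P]_w Z w.
Proof.
move=> iY iZ indYZ.
have mY := integrable_measurable iY; have mZ := integrable_measurable iZ.
pose Y' : {RV P >-> R} := mfun_Sub (mem_set mY).
pose Z' : {RV P >-> R} := mfun_Sub (mem_set mZ).
have mYZ : measurable_fun setT (fun w => (Y w, Z w)) by apply: measurable_fun_pair.
pose YZ : {RV P >-> (R * R)%type} := mfun_Sub (mem_set mYZ).
pose f (z : R * R) : \bar R := (z.1 * z.2)%:E.
have mf : measurable_fun setT f.
  apply/measurable_EFinP; apply: measurable_funM; exact: measurable_fst || exact: measurable_snd.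
have lawE (A : set (R * R)) : measurable A ->
    (distribution P Y' \x distribution P Z')%E A = distribution P YZ A.
  apply: product_measure_unique => B C mB mC.
  by rewrite -indYZ.
pose id1 := EFin \o (idfun : R -> R).
have mid : measurable_fun setT id1.
  by apply/measurable_EFinP; exact: measurable_id.
have i1 : (distribution P Y').-integrable setT id1.
  exact: integrable_pushforward.
have i2 : (distribution P Z').-integrable setT id1.
  exact: integrable_pushforward.
have mid1 : measurable_fun setT (fun y : R => `|y|%:E).
  by apply/measurable_EFinP; exact: normr_measurable.
have i12 : (distribution P Y' \x distribution P Z')%E.-integrable setT f.
  apply/integrable12ltyP => //.
  have -> : (fun x => \int[distribution P Z']_y `|f (x, y)|)%E =
      (fun x => `|x|%:E * \int[distribution P Z']_y `|y|%:E)%E.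
    apply/funext => x; rewrite -ge0_integralZl //.
    by apply: eq_integral => y _; rewrite /f /= normrM.
  rewrite ge0_integralZr //; last by apply: integral_ge0 => y _; rewrite lee_fin.
  move/integrableP : i1 => [_ i1]; move/integrableP : i2 => [_ i2].
  by apply: lte_mul_pinfty => //; [apply: integral_ge0|rewrite ge0_fin_numE // integral_ge0].
have iYZ : (distribution P YZ).-integrable setT f.
  apply/integrableP; split => //.
  rewrite -(eq_measure_integral _ (fun A mA _ => lawE A mA)).
  by case/integrableP : i12.
have iP : P.-integrable setT (f \o YZ).
  apply/integrableP; split; first by apply: measurableT_comp => //; exact: mYZ.
  case/integrableP : iYZ => _; rewrite ge0_integral_distribution //.
  exact: measurableT_comp.
split; first exact: iP.
rewrite /Rintegral -[X in fine X = _](@integral_distribution _ _ _ _ _ P YZ f) //.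
rewrite -(eq_measure_integral _ (fun A mA _ => lawE A mA)) -integral12_prod_meas1 //.
have -> : (\int[P]_w (Y w)%:E = \int[distribution P Y']_x id1 x)%E.
  by rewrite integral_distribution //; exact/measurable_EFinP.
have -> : (\int[P]_w (Z w)%:E = \int[distribution P Z']_x id1 x)%E.
  by rewrite integral_distribution //; exact/measurable_EFinP.
have -> : (fubini_F (distribution P Z') f) =
      (fun x => id1 x * \int[distribution P Z']_y id1 y)%E.
    by apply/funext => x; rewrite /fubini_F -integralZl.
have f2 := integrable_fin_num measurableT i2.
rewrite -(fineK f2).
rewrite integralZr // fineM //.
exact: integrable_fin_num.
Qed.

End ProductExpectation.

Section Independence.
Context d (T : measurableType d) (R : realType) (P : probability T R)
  (I : finType) (X : I -> {RV P >-> R}).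
Hypothesis indX : mutually_independent X.

(** A pi-system generating the events that ignore the coordinate [i]. *)
Definition cylinders_without i : set (set T) :=
  [set A | exists2 B : I -> set R, (forall j, measurable (B j)) &
    A = \bigcap_(j in [set j | j \in [set~ i]%SET]) (X j @^-1` B j)].

(** Gibbs means of the system without the bond [i] have this property; it is what
    makes them independent of the coupling on [i]. *)
Definition measurable_without i (F : T -> R) :=
  measurable_fun setT (F : g_sigma_algebraType (cylinders_without i) -> R).

Lemma measurable_without_coord i j : j != i -> measurable_without i (X j).
Proof.
move=> ji _ B mB; rewrite setTI; apply: sub_sigma_algebra.
exists (fun k => if k == j then B else setT).
  by move=> k; case: ifP => _ //; exact: measurableT.
apply/seteqP; split => [w XB k _|w H].
  by rewrite /preimage /=; case: eqP => [->|].
by have := H j; rewrite /preimage /= !inE eqxx; apply.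
Qed.

Lemma cylinders_without_setI i : setI_closed (cylinders_without i).
Proof.
move=> _ _ [B mB ->] [C mC ->]; exists (fun j => B j `&` C j).
  by move=> j; exact: measurableI.
by rewrite -bigcapI.
Qed.

Lemma cylinders_without_measurable i : cylinders_without i `<=` measurable.
Proof.
move=> _ [B mB ->]; apply: fin_bigcap_measurable => //.
by move=> j _; rewrite -[X in measurable X]setTI; exact: measurable_funP.
Qed.

Lemma measurable_of_without i F : measurable_without i F -> measurable_fun setT F.
Proof.
move=> mF _ B mB; have := mF measurableT B mB.
apply: smallest_sub; first exact: sigma_algebra_measurable.
exact: cylinders_without_measurable.
Qed.

(** Dynkin's argument: the events independent of [X i] form a lambda-system that
    contains the cylinders over the other coordinates. *)
Lemma indep_without i (A C : set _) : measurable A ->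
  <<s cylinders_without i >> C ->
  P (X i @^-1` A `&` C) = (P (X i @^-1` A) * P C)%E.
Proof.
move=> mA.
have mXA : measurable (X i @^-1` A).
  by rewrite -[X in measurable X]setTI; exact: measurable_funP.
pose H := [set C | measurable C /\
  P (X i @^-1` A `&` C) = (P (X i @^-1` A) * P C)%E].
suff : <<s cylinders_without i >> `<=` H by move=> sub hC; have [] := sub _ hC.
apply: lambda_system_subset => //.
- exact: cylinders_without_setI.
- split => //.
  + by split => //; rewrite setIT probability_setT mule1.
  + move=> B D DB [mB PB] [mD PD]; split; first exact: measurableD.
    have PD' (U V : set T) : measurable U -> measurable V ->
        P (U `\` V) = (P U - P (U `&` V))%E.
      move=> mU mV; apply: measureD => //.
      by rewrite ltey_eq fin_num_measure.
    rewrite setIDA (PD' B) // (PD' (_ `&` B)) //; last exact: measurableI.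
    rewrite -setIA (setIidr DB) PB PD muleBr //.
      by rewrite fin_num_measure.
    by rewrite fin_num_adde_defr // fin_num_measure.
  + move=> F ndF HF; split.
      by apply: bigcup_measurable => k _; have [] := HF k.
    have mF k : measurable (F k) by have [] := HF k.
    have mU : measurable (\bigcup_k F k) by exact: bigcup_measurable.
    have h1 : P \o F @ \oo --> P (\bigcup_k F k) by exact: nondecreasing_cvg_mu.
    have h2 : P \o (fun k => X i @^-1` A `&` F k) @ \oo -->
        P (X i @^-1` A `&` \bigcup_k F k).
      rewrite setI_bigcupr; apply: nondecreasing_cvg_mu.
      - by move=> k; exact: measurableI.
      - by apply: bigcup_measurable => k _; exact: measurableI.
      - by move=> m n mn; apply/subsetPset; apply: setIS; exact/subsetPset/ndF.
    apply: (cvg_unique _ h2) => //.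
    have -> : P \o (fun k => X i @^-1` A `&` F k) =
        (fun k => P (X i @^-1` A) * (P \o F) k)%E.
      by apply/funext => k /=; have [_ ->] := HF k.
    by apply: cvgeZl => //; exact: fin_num_measure.
- move=> _ [B mB ->]; split.
    by apply: cylinders_without_measurable; exists B.
  pose B' j := if j == i then A else B j.
  have mB' j : measurable (B' j) by rewrite /B'; case: ifP.
  have -> : X i @^-1` A `&`
      \bigcap_(j in [set j | j \in [set~ i]%SET]) (X j @^-1` B j) =
      \bigcap_(j in [set j | j \in [set: I]%SET]) (X j @^-1` B' j).
    apply/seteqP; split => [w [wA wB] j _|w wB']; rewrite /B' /preimage /=.
      by case: eqP => [->//|/eqP ji]; apply: wB; rewrite /= !inE.
    split; first by have := wB' i; rewrite /B' /preimage /= eqxx inE; apply.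
    move=> j /=; rewrite !inE => ji; have := wB' j.
    by rewrite /B' /preimage /= (negPf ji) inE; apply.
  rewrite (indX _ mB') (indX _ mB) -[P (X i @^-1` A)]fineK ?fin_num_measure //.
  rewrite -EFinM (bigD1 i) ?inE //=; congr (_ * _)%:E; first by rewrite /B' eqxx.
  apply: eq_big => [j|j]; first by rewrite !inE.
  by rewrite !inE /B' => /negPf ->.
Qed.

Lemma Rintegral_mul_without i (g : R -> R) (F : T -> R) :
  measurable_fun setT g ->
  P.-integrable setT (EFin \o (fun w => g (X i w))) ->
  measurable_without i F -> P.-integrable setT (EFin \o F) ->
  P.-integrable setT (EFin \o (fun w => g (X i w) * F w)) /\
  \int[P]_w (g (X i w) * F w) = \int[P]_w g (X i w) * \int[P]_w F w.
Proof.
move=> mg ig mF iF; apply: Rintegral_mul_indep => // A B mA mB.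
have -> : (fun w => g (X i w)) @^-1` A = X i @^-1` (g @^-1` A) by [].
apply: indep_without; first by rewrite -[X in measurable X]setTI; exact: mg.
by have := mF measurableT B mB; rewrite setTI.
Qed.

Lemma Rintegral_prod (g : I -> R -> R) (c : R) :
  (forall i, measurable_fun setT (g i)) -> (forall i x, `|g i x| <= c) ->
  \int[P]_w (\prod_i g i (X i w)) = \prod_i \int[P]_w g i (X i w).
Proof.
move=> mg gc.
have mX i : measurable_fun setT (X i) by [].
have H (s : seq I) : uniq s ->
  \int[P]_w (\prod_(i <- s) g i (X i w)) = \prod_(i <- s) \int[P]_w g i (X i w).
  elim: s => [_|i s IH /= /andP[is_ us]].
    by under eq_Rintegral do rewrite big_nil; rewrite Rintegral_cstT big_nil.
  under eq_Rintegral do rewrite big_cons; rewrite big_cons -IH //.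
  apply: (@Rintegral_mul_without i (g i)
    (fun w => \prod_(j <- s) g j (X j w)) _ _ _ _).2 => //.
  - apply: (@bounded_integrable _ _ _ _ _ c) => //; exact: measurableT_comp.
  - apply: measurable_prod => j js; apply: measurableT_comp => //.
    by apply: measurable_without_coord; apply: contraNneq is_ => <-.
  - apply: (@bounded_integrable _ _ _ _ _ (c ^+ size s)).
      by apply: measurable_prod => j _; exact: measurableT_comp.
    move=> w; rewrite normr_prod; apply: (@le_trans _ _ (\prod_(j <- s) c)).
      by apply: ler_prod => j _; rewrite normr_ge0 gc.
    by rewrite big_const_seq count_predT iter_mulr_1.
by apply: H; exact: index_enum_uniq.
Qed.

End Independence.

(** * The reduced partition function *)

Section Reduced.
Context {R : realType} {N : nat}.
Implicit Types (beta : R) (J : bond N -> R) (s : config N) (e : bond N).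

(** Logarithm of the partition function divided by its mean over the signs of
    the couplings. *)
Definition ln_reduced beta J : R :=
  ln (partition_function beta J) - N%:R * ln 2 - \sum_e logcosh (beta * J e).

Lemma expR_neg_hamiltonian_prod beta J s : expR (neg_hamiltonian beta J s) =
  expR (\sum_e logcosh (beta * J e)) *
  \prod_e (1 + tanh (beta * J e) * bond_spin s e).
Proof.
rewrite expR_sum -big_split /= /neg_hamiltonian mulr_sumr expR_sum.
by apply: eq_bigr => e _; rewrite expR_logcosh mulrA expR_spin ?sqr_bond_spin.
Qed.

Lemma card_config : #|config N|%:R = 2 ^+ N :> R.
Proof. by rewrite card_ffun card_bool card_ord natrX. Qed.

Lemma expR_ln_card : expR (N%:R * ln 2) = 2 ^+ N :> R.
Proof. by rewrite expRM_natl lnK ?posrE. Qed.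

Lemma expR_ln_reduced beta J : expR (ln_reduced beta J) =
  2 ^- N * \sum_s \prod_e (1 + tanh (beta * J e) * bond_spin s e).
Proof.
rewrite /ln_reduced !expRB lnK ?posrE ?partition_function_gt0 // expR_ln_card.
rewrite /partition_function.
rewrite (eq_bigr _ (fun s _ => expR_neg_hamiltonian_prod beta J s)) -mulr_sumr.
set b := expR (\sum_e _); set c := \sum_s _.
have b0 : b != 0 by rewrite gt_eqF // expR_gt0.
by rewrite mulrAC [b * c / b]mulrAC divff // mul1r mulrC.
Qed.

Lemma neg_hamiltonian_norm beta J s :
  `|neg_hamiltonian beta J s| <= \sum_e `|beta * J e|.
Proof.
rewrite /neg_hamiltonian mulr_sumr; apply: le_trans (ler_norm_sum _ _ _) _.
by apply: ler_sum => e _; rewrite mulrA normrM norm_bond_spin mulr1.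
Qed.

Lemma norm_ln_partition beta J :
  `|ln (partition_function beta J) - N%:R * ln 2| <= \sum_e `|beta * J e|.
Proof.
have Z0 := partition_function_gt0 beta J.
rewrite ler_distl; apply/andP; split; rewrite -ler_expR ?expRD expR_ln_card lnK ?posrE //.
  rewrite -card_config -sum1_card natr_sum mulr_suml; apply: ler_sum => s _.
  by rewrite mul1r ler_expR; have := neg_hamiltonian_norm beta J s; rewrite ler_norml => /andP[].
rewrite -card_config -sum1_card natr_sum mulr_suml; apply: ler_sum => s _.
by rewrite mul1r ler_expR; have := neg_hamiltonian_norm beta J s; rewrite ler_norml => /andP[].
Qed.

Lemma norm_ln_reduced beta J : `|ln_reduced beta J| <= 2 * \sum_e `|beta * J e|.
Proof.
rewrite mulr_natl mulr2n; apply: le_trans (ler_normB _ _) _; apply: lerD.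
  exact: norm_ln_partition.
rewrite ger0_norm ?sumr_ge0 //; last by move=> e _; exact: logcosh_ge0.
by apply: ler_sum => e _; exact: logcosh_le_norm.
Qed.

(** Two copies of the system, coupled through their bond overlap. *)
Definition coupled_partition (kappa beta : R) J : R :=
  2 ^- N ^+ 2 * \sum_s \sum_s' \prod_e
    ((1 + tanh (beta * J e) * bond_spin s e) *
     (1 + tanh (beta * J e) * bond_spin s' e) *
     expR (kappa * (bond_spin s e * bond_spin s' e))).

(** Jensen's inequality in each replica; the coupled partition function is the square
    of the reduced one times the Gibbs mean of the exponentiated overlap. *)
Lemma coupled_partition_ge kappa beta J :
  expR (2 * ln_reduced beta J +
    kappa * \sum_e mean beta J (fun s => bond_spin s e) ^+ 2) <=
  coupled_partition kappa beta J.
Proof.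
pose f s s' := kappa * \sum_e bond_spin s e * bond_spin s' e.
have -> : kappa * \sum_e mean beta J (fun s => bond_spin s e) ^+ 2 =
    mean beta J (fun s => mean beta J (fun s' => f s s')).
  under [RHS]eq_mean => s do rewrite /f meanZl mean_sum.
  rewrite meanZl mean_sum; congr (_ * _); apply: eq_bigr => e _.
  under [RHS]eq_mean => s do rewrite meanZl mulrC.
  by rewrite meanZl expr2.
rewrite expRD.
apply: (@le_trans _ _ (expR (2 * ln_reduced beta J) *
    mean beta J (fun s => mean beta J (fun s' => expR (f s s'))))).
  rewrite ler_wpM2l ?expR_ge0 //; apply: le_trans (expR_mean_le _ _ _) _.
  by apply: ler_mean => s; exact: expR_mean_le.
have Z0 := partition_function_gt0 beta J.
rewrite le_eqVlt; apply/orP; left; apply/eqP.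
have -> : coupled_partition kappa beta J =
    (2 ^- N / expR (\sum_e logcosh (beta * J e))) ^+ 2 *
    \sum_s \sum_s' expR (neg_hamiltonian beta J s) *
      (expR (neg_hamiltonian beta J s') * expR (f s s')).
  rewrite exprMn -mulrA /coupled_partition; congr (_ * _).
  rewrite mulr_sumr; apply: eq_bigr => s _; rewrite mulr_sumr; apply: eq_bigr => s' _.
  rewrite (expR_neg_hamiltonian_prod _ _ s) (expR_neg_hamiltonian_prod _ _ s').
  rewrite /f mulr_sumr (expR_sum _ _ (fun e => kappa * _)) !big_split /=.
  set b := expR _; have b0 : b != 0 by rewrite gt_eqF // expR_gt0.
  by field.
have -> : \sum_s \sum_s' expR (neg_hamiltonian beta J s) *
      (expR (neg_hamiltonian beta J s') * expR (f s s')) =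
    partition_function beta J ^+ 2 *
    mean beta J (fun s => mean beta J (fun s' => expR (f s s'))).
  rewrite expr2 -mulrA [in RHS]mean_unnormalized.
  rewrite [_ * (_ / _)]mulrC divfK ?gt_eqF // mulr_sumr; apply: eq_bigr => s _.
  rewrite mean_unnormalized mulrCA [_ * (_ / _)]mulrC divfK ?gt_eqF //.
  by rewrite mulr_sumr.
rewrite mulrA; congr (_ * _); rewrite /ln_reduced expRM_natl !expRB.
rewrite lnK ?posrE // expR_ln_card -exprMn; congr (_ ^+ 2).
by rewrite [RHS]mulrC mulrA.
Qed.

(** Completing the square: [expR (S ^+ 2 / (2 * N))] is the largest of the
    finitely many Chernoff weights [expR (k * S / N - k ^+ 2 / (2 * N))], attained at
    the integer [k = S], and each of them has average at most one. *)
Lemma sum_expR_overlap_le (lambda : R) s : (0 < N)%N -> 0 <= lambda <= N%:R^-1 ->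
  \sum_s' expR (lambda * \sum_e bond_spin s e * bond_spin s' e) <=
  2 ^+ N * (2 * N.+1)%:R.
Proof.
move=> N0 /andP[l0 lN]; have N0' : 0 < N%:R :> R by rewrite ltr0n.
pose S s' : R := \sum_i spin s i * spin s' i.
(* the overlap [S] is an integer between [- N] and [N] *)
pose c (k : 'I_(2 * N.+1)) : R := k%:R - N%:R.
have chernoff (a : R) :
    \sum_s' expR (a * S s' - N%:R * (a ^+ 2 / 2)) <= 2 ^+ N.
  have -> : \sum_s' expR (a * S s' - N%:R * (a ^+ 2 / 2)) =
      expR (- (N%:R * (a ^+ 2 / 2))) *
      \sum_(s' : config N) \prod_i expR (a * (spin s i * (-1) ^+ s' i)).
    rewrite mulr_sumr; apply: eq_bigr => s' _.
    by rewrite addrC expRD /S mulr_sumr expR_sum.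
  rewrite -(bigA_distr_bigA (fun i (b : bool) => expR (a * (spin s i * (-1) ^+ b)))) /=.
  rewrite expRN ler_pdivrMl ?expR_gt0 // expRM_natl -exprMn.
  rewrite -[X in _ <= _ ^+ X]card_ord -prodr_const; apply: ler_prod => i _.
  rewrite big_bool /= expr0 expr1 mulr1 mulrN1 mulrN.
  rewrite addr_ge0 ?expR_ge0 //=; have := cosh_le_expR_sqr (a * spin s i).
  by rewrite exprMn sqr_spin mulr1 /cosh => ?; lra.
have SE s' : \sum_e bond_spin s e * bond_spin s' e = (S s' ^+ 2 - N%:R) / 2.
  rewrite /S sqr_sum_sign => [|i]; last by rewrite exprMn !sqr_spin mulr1.
  rewrite [N%:R + _]addrC addrK [2 * _]mulrC mulfK //; apply: eq_bigr => e _.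
  by rewrite /bond_spin; ring.
have S_int s' : exists k : 'I_(2 * N.+1), S s' = c k.
  pose n := #|[pred i | s i != s' i]|.
  have nN : (n <= N)%N by rewrite -[leqRHS]card_ord max_card.
  have kN : (2 * (N - n) < 2 * N.+1)%N by rewrite ltn_mul2l /= ltnS leq_subr.
  exists (Ordinal kN); rewrite /c /= natrM natrB // /n -sum1_card natr_sum.
  rewrite big_mkcond /= mulrBr mulr_sumr.
  have -> : N%:R = \sum_(i < N) 1 :> R by rewrite sumr_const card_ord.
  rewrite mulr_sumr -!sumrB; apply: eq_bigr => i _.
  rewrite /spin inE; case: (s i); case: (s' i); rewrite /= ?expr0 ?expr1; lra.
apply: (@le_trans _ _ (\sum_s' \sum_(k < 2 * N.+1)
    expR (c k / N%:R * S s' - N%:R * ((c k / N%:R) ^+ 2 / 2)))).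
  apply: ler_sum => s' _; have [k Sk] := S_int s'.
  rewrite (bigD1 k) //= -Sk.
  apply: (@le_trans _ _ (expR (S s' / N%:R * S s' - N%:R * ((S s' / N%:R) ^+ 2 / 2)))).
    rewrite ler_expR SE.
    have -> : S s' / N%:R * S s' - N%:R * ((S s' / N%:R) ^+ 2 / 2) =
        N%:R^-1 * S s' ^+ 2 / 2 by field; rewrite gt_eqF.
    rewrite mulrA ler_pM2r // -subr_ge0.
    have := ler_wpM2r (sqr_ge0 (S s')) lN.
    have := mulr_ge0 l0 (ltW N0'); rewrite mulrBr; lra.
  by rewrite lerDl sumr_ge0 // => *; exact: expR_ge0.
rewrite exchange_big /= mulr_natr -[X in _ <= _ *+ X]card_ord -sumr_const.
by apply: ler_sum => k _; exact: chernoff.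
Qed.

End Reduced.

(** * Cavity inequalities *)

Section Cavity.
Context {R : realType} {N : nat}.
Implicit Types (beta : R) (J : bond N -> R) (s : config N) (e : bond N).

Definition edge_mean beta J e : R := mean beta J (fun s => bond_spin s e).

Definition cavity_mean beta J e : R := edge_mean beta (delete J e) e.

Lemma norm_edge_mean beta J e : `|edge_mean beta J e| <= 1.
Proof. exact: norm_mean_bond. Qed.

Lemma norm_cavity_mean beta J e : `|cavity_mean beta J e| <= 1.
Proof. exact: norm_mean_bond. Qed.

Lemma sqr_le1_norm (m : R) : `|m| <= 1 -> m ^+ 2 <= 1.
Proof. by move=> m1; rewrite -(ger0_norm (sqr_ge0 _)) normrX exprn_ile1. Qed.

Let lt1 (x m : R) : `|m| <= 1 -> 0 < 1 + tanh x * m.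
Proof. exact: mul_tanh_lt1. Qed.

(** Each term on the left is a function of the coupling [x] times a power of the
    cavity mean [m], which are independent; the middle one is odd in [x] and
    averages to zero. *)
Lemma cavity_field_ge beta (x m t : R) : 0 <= beta -> `|m| <= 1 ->
  t = tanh (beta * x) ->
  x * t + x * (1 - t ^+ 2) * m - 3 * (x * t * m ^+ 2) <= x * ((t + m) / (1 + t * m)).
Proof.
move=> b0 m1 tE; have d0 := lt1 (beta * x) m1; rewrite -tE in d0.
have xt : 0 <= x * t by rewrite tE; exact: mul_tanh_ge0.
rewrite [leRHS]mulrA ler_pdivlMr // -subr_ge0.
have -> : x * (t + m) -
    (x * t + x * (1 - t ^+ 2) * m - 3 * (x * t * m ^+ 2)) * (1 + t * m) =
    x * t * m ^+ 2 * (2 + t ^+ 2 + 3 * (t * m)) by ring.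
apply: mulr_ge0; first by rewrite mulr_ge0 ?sqr_ge0.
have t1 : `|t| <= 1 by rewrite tE; exact/ltW/norm_tanh_lt1.
have : - `|t| <= t * m.
  apply: le_trans (lerNnormlW (lexx _)).
  by rewrite lerN2 normrM ler_piMr.
by have := normr_ge0 t; rewrite -(real_normK (num_real t)); nra.
Qed.

(** A lower bound for the energy of one bond whose first term is again odd in the
    coupling [x]; the second one is large unless [m] is close to a sign. *)
Lemma cavity_field_ge_linear beta (x m t : R) : 0 <= beta -> `|m| <= 1 ->
  t = tanh (beta * x) ->
  x * m + x * t * (1 - m ^+ 2) / 2 <= x * ((t + m) / (1 + t * m)).
Proof.
move=> b0 m1 tE; have d0 := lt1 (beta * x) m1; rewrite -tE in d0.
have xt : 0 <= x * t by rewrite tE; exact: mul_tanh_ge0.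
have m2 := sqr_le1_norm m1.
have -> : x * ((t + m) / (1 + t * m)) = x * m + x * t * (1 - m ^+ 2) / (1 + t * m).
  by field; rewrite gt_eqF.
rewrite lerD2l ler_wpM2l //; first by apply: mulr_ge0; rewrite ?subr_ge0.
rewrite lef_pV2 ?posrE //.
have := norm_mul_lt1 (norm_tanh_lt1 (beta * x)) m1.
by rewrite ltr_norml => /andP[_]; rewrite -tE; lra.
Qed.

Lemma edge_mean_cavity beta J e :
  edge_mean beta J e =
  (tanh (beta * J e) + cavity_mean beta J e) /
  (1 + tanh (beta * J e) * cavity_mean beta J e).
Proof. exact: mean_bond_delete. Qed.

(** Raising the inverse temperature by [h]: convexity of the free energy, then the
    cavity expansion of each bond energy. The leading terms [J e * tanh (beta * J e)]
    are exactly compensated by the change of the normalization. *)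
Lemma ln_reduced_step beta h J : 0 <= beta -> 0 <= h ->
  ln_reduced beta J +
    \sum_e (h * (J e * (1 - tanh (beta * J e) ^+ 2) * cavity_mean beta J e)
      - 3 * h * (J e * tanh (beta * J e) * cavity_mean beta J e ^+ 2)
      - logcosh (h * J e)) <=
  ln_reduced (beta + h) J.
Proof.
move=> b0 h0; pose t e := tanh (beta * J e); pose m e := cavity_mean beta J e.
rewrite -/(t _) -/(m _) /ln_reduced.
have := ln_partition_gradient beta h J.
have : \sum_e logcosh ((beta + h) * J e) <=
    \sum_e (logcosh (beta * J e) + t e * (h * J e) + logcosh (h * J e)).
  apply: ler_sum => e _; rewrite mulrDl logcoshD_le //.
  by rewrite mulrACA -expr2 mulr_ge0 ?sqr_ge0 // mulr_ge0.
have : h * \sum_e (J e * t e + J e * (1 - t e ^+ 2) * m e - 3 * (J e * t e * m e ^+ 2)) <=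
    h * \sum_e J e * edge_mean beta J e.
  rewrite ler_wpM2l //; apply: ler_sum => e _; rewrite edge_mean_cavity.
  exact: (cavity_field_ge b0 (norm_cavity_mean _ _ _) erefl).
have -> : h * \sum_e (J e * t e + J e * (1 - t e ^+ 2) * m e -
      3 * (J e * t e * m e ^+ 2)) =
    \sum_e t e * (h * J e) + \sum_e h * (J e * (1 - t e ^+ 2) * m e)
    - \sum_e 3 * h * (J e * t e * m e ^+ 2).
  by rewrite mulr_sumr -sumrN -!big_split /=; apply: eq_bigr => e _; ring.
rewrite (big_split _ _ _ _ (fun e => logcosh (h * J e))) /= big_split /=.
have -> : \sum_e (h * (J e * (1 - t e ^+ 2) * m e)
      - 3 * h * (J e * t e * m e ^+ 2) - logcosh (h * J e)) =
    \sum_e h * (J e * (1 - t e ^+ 2) * m e) - \sum_e 3 * h * (J e * t e * m e ^+ 2)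
    - \sum_e logcosh (h * J e).
  by rewrite -!sumrN -!big_split.
rewrite /edge_mean; lra.
Qed.

Lemma cavity_field_sum_le beta J : 0 <= beta ->
  \sum_e (J e * cavity_mean beta J e +
          J e * tanh (beta * J e) * (1 - cavity_mean beta J e ^+ 2) / 2) <=
  ln_reduced 1 J + N%:R * ln 2 + \sum_e logcosh (J e).
Proof.
move=> b0; rewrite /ln_reduced; under [X in _ - X + _ + _]eq_bigr do rewrite mul1r.
rewrite addrAC subrK addrNK; apply: le_trans (sum_mean_le_ln_partition beta J).
apply: ler_sum => e _; rewrite -/(edge_mean beta J e) edge_mean_cavity.
exact: (cavity_field_ge_linear b0 (norm_cavity_mean _ _ _) erefl).
Qed.

Lemma edge_cavity_dist beta J e :
  `|edge_mean beta J e - cavity_mean beta J e| <= 2 * `|tanh (beta * J e)|.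
Proof. by apply: mean_delete_dist => s; rewrite norm_bond_spin. Qed.

Lemma sqr_le_dist (a b c : R) : `|a - b| <= 2 * c -> b ^+ 2 <= 2 * a ^+ 2 + 8 * c ^+ 2.
Proof.
move=> abc; have : (a - b) ^+ 2 <= 4 * c ^+ 2.
  rewrite -(real_normK (num_real (a - b))).
  have -> : 4 * c ^+ 2 = (2 * c) ^+ 2 by ring.
  by rewrite lerXn2r ?nnegrE // (le_trans _ abc).
have := sqr_ge0 (2 * a - b); rewrite !expr2; lra.
Qed.

Lemma sqr_cavity_mean_le beta J e :
  cavity_mean beta J e ^+ 2 <= 2 * edge_mean beta J e ^+ 2 + 8 * tanh (beta * J e) ^+ 2.
Proof.
rewrite -(real_normK (num_real (tanh _))).
exact/sqr_le_dist/edge_cavity_dist.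
Qed.

Lemma one_sub_sqr_edge_mean_le beta J e :
  1 - edge_mean beta J e ^+ 2 <= 1 - cavity_mean beta J e ^+ 2 + 4 * `|tanh (beta * J e)|.
Proof.
have := edge_cavity_dist beta J e; have := norm_edge_mean beta J e.
have := norm_cavity_mean beta J e; have := normr_ge0 (tanh (beta * J e)).
move: (edge_mean _ _ _) (cavity_mean _ _ _) `|tanh _| => a b c c0.
rewrite !ler_norml => /andP[b0 b1] /andP[a0 a1] /andP[d0 d1].
by case: (lerP 0 (a + b)) => ?; nra.
Qed.

End Cavity.

(** * Averages over the couplings at finite volume *)

Section Measurability.
Context {R : realType}.

Lemma measurable_tanh : measurable_fun setT (@tanh R).
Proof. by apply: nondecreasing_measurable => //; exact: tanh_le. Qed.

Lemma measurable_mul_cst (b : R) : measurable_fun setT (fun x : R => b * x).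
Proof. by apply: measurable_funM. Qed.

Lemma measurable_tanhM (b : R) : measurable_fun setT (fun x => tanh (b * x)).
Proof. exact: measurableT_comp measurable_tanh (measurable_mul_cst b). Qed.

Lemma measurable_logcosh : measurable_fun setT (@logcosh R).
Proof.
apply: measurableT_comp; first exact: measurable_ln.
apply: measurable_funM => //; apply: measurable_funD; first exact: measurable_expR.
by apply: measurableT_comp; first exact: measurable_expR.
Qed.

Lemma measurable_logcoshM (b : R) : measurable_fun setT (fun x => logcosh (b * x)).
Proof. exact: measurableT_comp measurable_logcosh (measurable_mul_cst b). Qed.

Context {N : nat} {d} {T : measurableType d} (J : bond N -> T -> R).
Hypothesis mJ : forall e, measurable_fun setT (J e).

Lemma measurable_neg_hamiltonian beta s :
  measurable_fun setT (fun w => neg_hamiltonian beta (fun e => J e w) s).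
Proof.
by apply: measurable_funM => //; apply: measurable_sum => e; apply: measurable_funM.
Qed.

Lemma measurable_ln_partition beta :
  measurable_fun setT (fun w => ln (partition_function beta (fun e => J e w))).
Proof.
apply: measurableT_comp; first exact: measurable_ln.
apply: measurable_sum => s; apply: measurableT_comp; first exact: measurable_expR.
exact: measurable_neg_hamiltonian.
Qed.

Lemma measurable_mean beta f :
  measurable_fun setT (fun w => mean beta (fun e => J e w) f).
Proof.
apply: measurable_sum => s; apply: measurable_funM => //.
have -> : (fun w => gibbs beta (fun e => J e w) s) =
    (fun w => expR (neg_hamiltonian beta (fun e => J e w) s -
      ln (partition_function beta (fun e => J e w)))).
  apply/funext => w; rewrite expRB lnK // posrE; exact: partition_function_gt0.
apply: measurableT_comp; first exact: measurable_expR.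
apply: measurable_funB; first exact: measurable_neg_hamiltonian.
exact: measurable_ln_partition.
Qed.

Lemma measurable_ln_reduced beta :
  measurable_fun setT (fun w => ln_reduced beta (fun e => J e w)).
Proof.
apply: measurable_funB.
  by apply: measurable_funB => //; exact: measurable_ln_partition.
by apply: measurable_sum => e; exact: measurableT_comp (measurable_logcoshM _) (mJ e).
Qed.

End Measurability.

Section Law.
Context {R : realType} (mu : probability R R).
Hypothesis mu_sym : forall A : set R, measurable A -> mu A = mu (-%R @^-1` A).
Hypothesis mu_int : mu.-integrable setT (EFin \o (fun x : R => x)).

Lemma Rintegral_odd (phi : R -> R) : mu.-integrable setT (EFin \o phi) ->
  (forall x, phi (- x) = - phi x) -> \int[mu]_x phi x = 0.
Proof.
move=> iphi odd.
have mN : measurable_fun setT (-%R : R -> R) by exact: oppr_measurable.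
have mphi : measurable_fun setT (EFin \o phi) by exact: (measurable_int mu).
have iphiN : mu.-integrable setT ((EFin \o phi) \o -%R).
  apply: eq_integrable (integrableN iphi) => // x _ /=.
  by rewrite odd.
have E : (\int[mu]_x (phi x)%:E = \int[mu]_x ((EFin \o phi) \o -%R) x)%E.
  rewrite -[in RHS](preimage_setT (-%R : R -> R)) -integral_pushforward //.
  by apply: eq_measure_integral => A mA _; exact: mu_sym.
have : \int[mu]_x phi x = - \int[mu]_x phi x.
  rewrite -mulN1r -RintegralZl // {1}/Rintegral E.
  congr fine; apply: eq_integral => x _ /=.
  by rewrite odd mulN1r.
lra.
Qed.

Lemma integrable_norm_law : mu.-integrable setT (EFin \o (fun x : R => `|x|)).
Proof. exact: integrable_norm. Qed.

Lemma integrable_le_norm (c : R) (phi : R -> R) : measurable_fun setT phi ->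
  (forall x, `|phi x| <= c * `|x|) -> mu.-integrable setT (EFin \o phi).
Proof.
move=> mphi phic; apply: (le_integrable_real mphi phic).
exact/integrableZl_real/integrable_norm_law.
Qed.

Lemma integrable_logcosh b : mu.-integrable setT (EFin \o (fun x => logcosh (b * x))).
Proof.
apply: (@integrable_le_norm `|b|); first exact: measurable_logcoshM.
by move=> x; rewrite ger0_norm ?logcosh_ge0 // -normrM logcosh_le_norm.
Qed.

Lemma integrable_mul_tanh b : mu.-integrable setT (EFin \o (fun x => x * tanh (b * x))).
Proof.
apply: (@integrable_le_norm 1); first by apply: measurable_funM => //; exact: measurable_tanhM.
by move=> x; rewrite normrM mulrC ler_wpM2r // ltW // norm_tanh_lt1.
Qed.

Lemma sqr_tanh_le1 (x : R) : tanh x ^+ 2 <= 1.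
Proof. by apply/sqr_le1_norm/ltW/norm_tanh_lt1. Qed.

Lemma integrable_sqr_tanh b : mu.-integrable setT (EFin \o (fun x => tanh (b * x) ^+ 2)).
Proof.
apply: (@bounded_integrable _ _ _ _ _ 1).
  by apply: measurable_funX; exact: measurable_tanhM.
by move=> x; rewrite ger0_norm ?sqr_ge0 // sqr_tanh_le1.
Qed.

Lemma integrable_tanh b : mu.-integrable setT (EFin \o (fun x => tanh (b * x))).
Proof.
apply: (@bounded_integrable _ _ _ _ _ 1); first exact: measurable_tanhM.
by move=> x; exact/ltW/norm_tanh_lt1.
Qed.

Lemma integrable_odd_field b :
  mu.-integrable setT (EFin \o (fun x => x * (1 - tanh (b * x) ^+ 2))).
Proof.
apply: (@integrable_le_norm 1).
  apply: measurable_funM => //; apply: measurable_funB => //.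
  by apply: measurable_funX; exact: measurable_tanhM.
move=> x; rewrite normrM mulrC ler_wpM2r // ger0_norm ?subr_ge0 ?sqr_tanh_le1 //.
by rewrite gerBl sqr_ge0.
Qed.

End Law.

Section FiniteVolume.
Context {R : realType} {N : nat} {d} {T : measurableType d} (P : probability T R)
  (J : bond N -> {RV P >-> R}) (mu : probability R R).
Hypothesis indJ : mutually_independent J.
Hypothesis lawJ : forall e (A : set R), measurable A -> P (J e @^-1` A) = mu A.
Hypothesis mu_sym : forall A : set R, measurable A -> mu A = mu (-%R @^-1` A).
Hypothesis mu_int : mu.-integrable setT (EFin \o (fun x : R => x)).

Local Notation Jat w := (fun e => J e w).

Lemma integrable_coupling e (phi : R -> R) : mu.-integrable setT (EFin \o phi) ->
  P.-integrable setT (EFin \o (fun w => phi (J e w))).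
Proof.
move=> iphi; have mphi := integrable_measurable iphi.
apply/integrableP; split; first by apply/measurable_EFinP; exact: measurableT_comp.
have mabs : measurable_fun setT (fun x => `|phi x|%:E).
  by apply/measurable_EFinP; exact: measurableT_comp.
have /= := @ge0_integral_distribution _ _ _ _ _ P (J e) (fun x => `|phi x|%:E) mabs.
move=> <-; last by move=> x; rewrite lee_fin.
case/integrableP : iphi => _; congr (_ < _)%E.
by apply: eq_measure_integral => A mA _; exact/esym/lawJ.
Qed.

Lemma Rintegral_coupling e (phi : R -> R) : mu.-integrable setT (EFin \o phi) ->
  \int[P]_w phi (J e w) = \int[mu]_x phi x.
Proof.
move=> iphi; have mphi := integrable_measurable iphi.
rewrite /Rintegral; congr fine.
have /= <- := @integral_distribution _ _ _ _ _ P (J e) (EFin \o phi).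
- by apply: eq_measure_integral => A mA _; exact: lawJ.
- exact/measurable_EFinP.
- exact: integrable_coupling.
Qed.

Lemma measurable_coupling e : measurable_fun setT (J e).
Proof. by []. Qed.

Lemma integrable_norm_coupling b e : P.-integrable setT (EFin \o (fun w => `|b * J e w|)).
Proof.
apply: (@integrable_coupling e (fun x => `|b * x|)).
apply: (@integrable_le_norm _ _ mu_int `|b|).
  by apply: measurableT_comp => //; exact: measurable_mul_cst.
by move=> x; rewrite normr_id normrM.
Qed.

Lemma integrable_ln_reduced b :
  P.-integrable setT (EFin \o (fun w => ln_reduced b (Jat w))).
Proof.
have := integrableZl_real 2 (integrable_sum_real (index_enum (bond N)) predT
  (integrable_norm_coupling b)).
apply: le_integrable_real; first exact: measurable_ln_reduced.
by move=> w; exact: norm_ln_reduced.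
Qed.

(** The free energy lost by not averaging the partition function over the signs of
    the couplings. *)
Definition deficit b : R := - \int[P]_w ln_reduced b (Jat w).

Lemma measurable_edge_mean b e :
  measurable_fun setT (fun w => edge_mean b (Jat w) e).
Proof. exact: measurable_mean. Qed.

Lemma measurable_without_mean_delete b e f :
  measurable_without J e (fun w => mean b (delete (Jat w) e) f).
Proof.
apply: (@measurable_mean _ _ _ (g_sigma_algebraType (cylinders_without J e))
  (fun b' w => delete (Jat w) e b')) => b'.
rewrite /delete; case: eqVneq => [_|ne]; first exact: measurable_cst.
exact: measurable_without_coord.
Qed.

Lemma measurable_mean_delete b e f :
  measurable_fun setT (fun w => mean b (delete (Jat w) e) f).
Proof. exact: (measurable_of_without (@measurable_without_mean_delete b e f)). Qed.

Lemma bounded_sqr_integrable (F : T -> R) : measurable_fun setT F ->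
  (forall w, `|F w| <= 1) -> P.-integrable setT (EFin \o (fun w => F w ^+ 2)).
Proof.
move=> mF F1; apply: (@bounded_integrable _ _ _ _ _ 1); first exact: measurable_funX.
by move=> w; rewrite ger0_norm ?sqr_ge0 // sqr_le1_norm.
Qed.

Lemma integrable_sqr_edge b e :
  P.-integrable setT (EFin \o (fun w => edge_mean b (Jat w) e ^+ 2)).
Proof.
apply: bounded_sqr_integrable => [|w]; first exact: measurable_edge_mean.
exact: norm_edge_mean.
Qed.

Lemma integrable_sqr_cavity b e :
  P.-integrable setT (EFin \o (fun w => cavity_mean b (Jat w) e ^+ 2)).
Proof.
apply: bounded_sqr_integrable => [|w]; last exact: norm_cavity_mean.
exact: measurable_mean_delete.
Qed.

Lemma Rintegral_coupling_cavity b e (phi psi : R -> R) (c : R) :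
  mu.-integrable setT (EFin \o phi) -> measurable_fun setT psi ->
  (forall m, `|m| <= 1 -> `|psi m| <= c) ->
  P.-integrable setT (EFin \o (fun w => phi (J e w) * psi (cavity_mean b (Jat w) e))) /\
  \int[P]_w (phi (J e w) * psi (cavity_mean b (Jat w) e)) =
  \int[mu]_x phi x * \int[P]_w psi (cavity_mean b (Jat w) e).
Proof.
move=> iphi mpsi psic; rewrite -(Rintegral_coupling e iphi).
apply: (Rintegral_mul_without indJ (i := e) (g := phi)
  (F := fun w => psi (cavity_mean b (Jat w) e))).
- exact: integrable_measurable iphi.
- exact: integrable_coupling.
- apply: measurableT_comp => //; exact: measurable_without_mean_delete.
- apply: (@bounded_integrable _ _ _ _ _ c).
    by apply: measurableT_comp => //; exact: measurable_mean_delete.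
  by move=> w; apply: psic; exact: norm_cavity_mean.
Qed.

Local Notation tsq b := (\int[mu]_x (tanh (b * x) ^+ 2)).
Local Notation xtanh b := (\int[mu]_x (x * tanh (b * x))).
Local Notation lcosh h := (\int[mu]_x logcosh (h * x)).

Lemma tanh_mean0 b : \int[mu]_x tanh (b * x) = 0.
Proof. by apply: Rintegral_odd => // [|x]; [exact: integrable_tanh|rewrite mulrN tanhN]. Qed.

Lemma expR_ln_reduced_mean b :
  P.-integrable setT (EFin \o (fun w => expR (ln_reduced b (Jat w)))) /\
  \int[P]_w expR (ln_reduced b (Jat w)) = 1.
Proof.
pose F s w := \prod_e (1 + tanh (b * J e w) * bond_spin s e).
have mg (s : config N) e : measurable_fun setT (fun x => 1 + tanh (b * x) * bond_spin s e : R).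
  by apply: measurable_funD => //; apply: measurable_funM => //; exact: measurable_tanhM.
have g2 (s : config N) e x : `|1 + tanh (b * x) * bond_spin s e : R| <= 2.
  apply: le_trans (ler_normD _ _) _; rewrite normr1 normrM norm_bond_spin mulr1.
  by have := norm_tanh_lt1 (b * x); lra.
have iF s : P.-integrable setT (EFin \o F s).
  apply: (@bounded_integrable _ _ _ _ _ (\prod_(e : bond N) 2)).
    by apply: measurable_prod => e _; exact: measurableT_comp (mg s e) (measurable_coupling e).
  move=> w; rewrite normr_prod; apply: ler_prod => e _.
  by rewrite normr_ge0 g2.
have EF s : \int[P]_w F s w = 1.
  rewrite (Rintegral_prod indJ (g := fun e x => 1 + tanh (b * x) * bond_spin s e)
    (mg s) (g2 s)) big1 // => e _.
  rewrite (Rintegral_coupling e (phi := fun x => 1 + tanh (b * x) * bond_spin s e)).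
    rewrite RintegralD //; last 2 first.
    - exact: integrable_cstT.
    - under eq_fun do rewrite mulrC; exact/integrableZl_real/integrable_tanh.
    rewrite Rintegral_cstT RintegralZr ?tanh_mean0 ?mul0r ?addr0 //.
    exact: integrable_tanh.
  by apply: bounded_integrable (mg s e) (g2 s e).
have E w : expR (ln_reduced b (Jat w)) = 2 ^- N * \sum_s F s w.
  exact: expR_ln_reduced.
split.
  have -> : (fun w => expR (ln_reduced b (Jat w))) = (fun w => 2 ^- N * \sum_s F s w).
    by apply/funext.
  exact/integrableZl_real/integrable_sum_real.
under eq_Rintegral do rewrite E.
rewrite RintegralZl //; last exact: integrable_sum_real.
rewrite Rintegral_sum // (eq_bigr _ (fun s _ => EF s)) sumr_const card_config.
by rewrite mulVf // expf_neq0.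
Qed.

(** Jensen's inequality, from [1 + x <= expR x]. *)
Lemma deficit_ge0 b : 0 <= deficit b.
Proof.
have [iE E1] := expR_ln_reduced_mean b.
rewrite oppr_ge0.
have -> : 0 = \int[P]_w (expR (ln_reduced b (Jat w)) - 1).
  rewrite RintegralB // ?E1 ?Rintegral_cstT ?subrr //.
  exact: integrable_cstT.
apply: ler_RintegralT; first exact: integrable_ln_reduced.
  by apply: integrableB_real => //; exact: integrable_cstT.
by move=> w; have := expR_ge1Dx (ln_reduced b (Jat w)); lra.
Qed.

(** The terms linear in [tanh] average to zero by symmetry, and the remaining ones
    have the form [c * (1 + x)] with [1 + x <= expR x]. *)
Lemma Rintegral_bond_factor b kappa (s s' : config N) e :
  let g x := (1 + tanh (b * x) * bond_spin s e) *
    (1 + tanh (b * x) * bond_spin s' e) *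
    expR (kappa * (bond_spin s e * bond_spin s' e)) in
  mu.-integrable setT (EFin \o g) /\
  0 <= \int[mu]_x g x <= expR ((tsq b + kappa) * (bond_spin s e * bond_spin s' e)).
Proof.
move=> g; set y := bond_spin s e; set y' := bond_spin s' e.
set c := expR (kappa * (y * y')).
have gE : g = (fun x => c + c * (y + y') * tanh (b * x) +
    c * (y * y') * tanh (b * x) ^+ 2).
  by apply/funext => x; rewrite /g -/y -/y' -/c; ring.
have i0 := integrable_cstT mu c.
have i1 := integrableZl_real (c * (y + y')) (integrable_tanh mu b).
have i2 := integrableZl_real (c * (y * y')) (integrable_sqr_tanh mu b).
have i01 := integrableD_real i0 i1.
have ig : mu.-integrable setT (EFin \o g) by rewrite gE; exact: integrableD_real.
split => //; apply/andP; split.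
  apply: Rintegral_ge0 => x _; rewrite mulr_ge0 ?expR_ge0 // mulr_ge0 //.
    by apply/ltW/mul_tanh_lt1; rewrite norm_bond_spin.
  by apply/ltW/mul_tanh_lt1; rewrite norm_bond_spin.
have e1 : \int[mu]_x (c * (y + y') * tanh (b * x)) = 0.
  rewrite RintegralZl //; last exact: integrable_tanh.
  by rewrite tanh_mean0 mulr0.
have e2 : \int[mu]_x (c * (y * y') * tanh (b * x) ^+ 2) = c * (y * y') * tsq b.
  by rewrite RintegralZl //; exact: integrable_sqr_tanh.
rewrite gE RintegralD // RintegralD // e1 e2 Rintegral_cstT addr0.
rewrite mulrDl expRD -/c [leRHS]mulrC -mulrA -[c in c + _]mulr1 -mulrDr.
by rewrite ler_wpM2l ?expR_ge0 // mulrC expR_ge1Dx.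
Qed.

(** Replica coupling: the annealed two-replica partition function stays
    polynomial as long as [N * (E t ^+ 2 + kappa) <= 1], so that Jensen's inequality
    bounds the bond overlap by the free energy deficit. *)
Lemma sum_sqr_edge_le b kappa : (0 < N)%N -> 0 <= kappa ->
  N%:R * (tsq b + kappa) <= 1 ->
  kappa * \sum_e \int[P]_w edge_mean b (Jat w) e ^+ 2 <=
  ln (2 * N.+1)%:R + 2 * deficit b.
Proof.
move=> N0 k0 sub.
set c : R := (2 * N.+1)%:R; have c0 : 0 < c by rewrite ltr0n.
pose g (s s' : config N) e x := (1 + tanh (b * x) * bond_spin s e) *
    (1 + tanh (b * x) * bond_spin s' e) *
    expR (kappa * (bond_spin s e * bond_spin s' e)).
pose F s s' w := \prod_e g s s' e (J e w).
have mg s s' e : measurable_fun setT (g s s' e).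
  have [ig _] := Rintegral_bond_factor b kappa s s' e.
  exact: integrable_measurable ig.
have gb s s' e x : `|g s s' e x| <= 4 * expR kappa.
  rewrite /g !normrM (ger0_norm (expR_ge0 _)).
  have h (y : R) : `|y| = 1 -> `|1 + tanh (b * x) * y| <= 2.
    move=> y1; apply: le_trans (ler_normD _ _) _; rewrite normr1 normrM y1 mulr1.
    by have := norm_tanh_lt1 (b * x); lra.
  apply: ler_pM => //; rewrite ?mulr_ge0 ?expR_ge0 //.
    have -> : 4 = 2 * 2 :> R by lra.
    by apply: ler_pM => //; apply: h; exact: norm_bond_spin.
  rewrite ler_expR ler_piMr // (le_trans (ler_norm _)) //.
  by rewrite normrM !norm_bond_spin mulr1.
have iF s s' : P.-integrable setT (EFin \o F s s').
  apply: (@bounded_integrable _ _ _ _ _ (\prod_(e : bond N) (4 * expR kappa))).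
    by apply: measurable_prod => e _; exact: measurableT_comp (mg s s' e) (measurable_coupling e).
  by move=> w; rewrite normr_prod; apply: ler_prod => e _; rewrite normr_ge0 gb.
have EF s s' : \int[P]_w F s s' w <=
    expR ((tsq b + kappa) * \sum_e bond_spin s e * bond_spin s' e).
  rewrite (Rintegral_prod indJ (mg s s') (gb s s')) mulr_sumr expR_sum.
  apply: ler_prod => e _; have [ig] := Rintegral_bond_factor b kappa s s' e.
  by rewrite (Rintegral_coupling e (phi := g s s' e)).
have WE w : coupled_partition kappa b (Jat w) = 2 ^- N ^+ 2 * \sum_s \sum_s' F s s' w.
  by [].
have iW : P.-integrable setT (EFin \o (fun w => coupled_partition kappa b (Jat w))).
  under eq_fun do rewrite WE.
  by apply/integrableZl_real/integrable_sum_real => s; apply: integrable_sum_real.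
have EW : \int[P]_w coupled_partition kappa b (Jat w) <= c.
  under eq_Rintegral do rewrite WE.
  have iFs s : P.-integrable setT (EFin \o (fun w => \sum_s' F s s' w)).
    exact: integrable_sum_real.
  rewrite RintegralZl //; last exact: integrable_sum_real.
  rewrite exprVn ler_pdivrMl ?exprn_gt0 // Rintegral_sum //.
  apply: (@le_trans _ _ (\sum_(s : config N) 2 ^+ N * c)).
    apply: ler_sum => s _; rewrite Rintegral_sum //.
    have tsq0 : 0 <= tsq b by apply: Rintegral_ge0 => x _; exact: sqr_ge0.
    apply: le_trans (sum_expR_overlap_le s N0 (lambda := tsq b + kappa) _).
      by apply: ler_sum => s' _; exact: EF.
    by rewrite addr_ge0 //= -[leRHS]mulr1 ler_pdivlMl // ltr0n.
  by rewrite sumr_const -[_ *+ _]mulr_natl card_config mulrA -expr2.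
have iedge : P.-integrable setT (EFin \o (fun w => \sum_e edge_mean b (Jat w) e ^+ 2)).
  by apply: integrable_sum_real => e; exact: integrable_sqr_edge.
have ilr := integrable_ln_reduced b.
have key w : 2 * ln_reduced b (Jat w) + kappa * \sum_e edge_mean b (Jat w) e ^+ 2 <=
    ln c - 1 + c^-1 * coupled_partition kappa b (Jat w).
  set x := 2 * _ + _.
  have xW : expR x <= coupled_partition kappa b (Jat w) by exact: coupled_partition_ge.
  have := expR_ge1Dx (x - ln c); rewrite expRB lnK ?posrE // => h.
  have : expR x / c <= c^-1 * coupled_partition kappa b (Jat w).
    by rewrite mulrC ler_wpM2l // invr_ge0 ltW.
  move=> /(le_trans h); move: (c^-1 * _) (ln c) => u v; lra.
have i1 := integrableZl_real 2 ilr; have i2 := integrableZl_real kappa iedge.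
have i3 := integrable_cstT P (ln c - 1); have i4 := integrableZl_real c^-1 iW.
have := ler_RintegralT (integrableD_real i1 i2) (integrableD_real i3 i4) key.
rewrite RintegralD // RintegralD // Rintegral_cstT (RintegralZl _ _ ilr) //.
rewrite (RintegralZl _ _ iedge) // (RintegralZl _ _ iW) // Rintegral_sum; last first.
  by move=> e; exact: integrable_sqr_edge.
have : c^-1 * \int[P]_w coupled_partition kappa b (Jat w) <= 1.
  by rewrite ler_pdivrMl // mulr1.
rewrite /deficit; move: (c^-1 * _) (ln c) => u v; lra.
Qed.

(** The term linear in the cavity mean averages to zero, so that the growth of the
    deficit is driven by squared cavity means, which the deficit itself controls. *)
Lemma deficit_step b h : 0 <= b -> 0 <= h ->
  deficit (b + h) <= deficit b +
    3 * h * xtanh b * \sum_e \int[P]_w cavity_mean b (Jat w) e ^+ 2 +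
    #|bond N|%:R * lcosh h.
Proof.
move=> b0 h0.
have A e := Rintegral_coupling_cavity b e (phi := fun x => x * (1 - tanh (b * x) ^+ 2))
  (psi := fun m => m) (c := 1) (integrable_odd_field mu_int b) (@measurable_id _ _ _)
  (fun m m1 => m1).
have odd0 : \int[mu]_x (x * (1 - tanh (b * x) ^+ 2)) = 0.
  apply: Rintegral_odd => // [|x]; first exact: integrable_odd_field.
  by rewrite mulrN tanhN sqrrN mulNr.
have sqr1 (m : R) : `|m| <= 1 -> `|m ^+ 2| <= 1.
  by move=> m1; rewrite ger0_norm ?sqr_ge0 // sqr_le1_norm.
have B e := Rintegral_coupling_cavity b e (phi := fun x => x * tanh (b * x))
  (psi := fun m => m ^+ 2) (c := 1) (integrable_mul_tanh mu_int b)
  (@exprn_measurable _ _ 2) sqr1.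
have C e := integrable_coupling e (integrable_logcosh mu_int h).
pose x1 e w := J e w * (1 - tanh (b * J e w) ^+ 2) * cavity_mean b (Jat w) e.
pose x2 e w := J e w * tanh (b * J e w) * cavity_mean b (Jat w) e ^+ 2.
pose x3 e w := logcosh (h * J e w).
have i1 e : P.-integrable setT (EFin \o (fun w => h * x1 e w)).
  by apply: integrableZl_real; have [] := A e.
have i2 e : P.-integrable setT (EFin \o (fun w => 3 * h * x2 e w)).
  by apply: integrableZl_real; have [] := B e.
have i12 e := integrableB_real (i1 e) (i2 e).
have i123 e := integrableB_real (i12 e) (C e).
have iln := integrable_ln_reduced.
have step w : ln_reduced b (Jat w) + \sum_e (h * x1 e w - 3 * h * x2 e w - x3 e w) <=
    ln_reduced (b + h) (Jat w) by exact: ln_reduced_step.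
have iS : P.-integrable setT
    (EFin \o (fun w => \sum_e (h * x1 e w - 3 * h * x2 e w - x3 e w))).
  by apply: integrable_sum_real => e; exact: i123.
have := ler_RintegralT (integrableD_real (iln b) iS) (iln (b + h)) step.
rewrite RintegralD // Rintegral_sum; last by move=> e; exact: i123.
have E e : \int[P]_w (h * x1 e w - 3 * h * x2 e w - x3 e w) =
    - (3 * h * xtanh b * \int[P]_w cavity_mean b (Jat w) e ^+ 2 + lcosh h).
  rewrite (RintegralB _ (i12 e) (C e)) // (RintegralB _ (i1 e) (i2 e)) //.
  rewrite (RintegralZl _ _ (A e).1) // (A e).2 odd0.
  rewrite (RintegralZl _ _ (B e).1) // (B e).2.
  rewrite (Rintegral_coupling e (integrable_logcosh mu_int h)); ring.
rewrite (eq_bigr _ (fun e _ => E e)) sumrN big_split /= -mulr_sumr sumr_const.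
rewrite -(mulr_natl (lcosh h)) /deficit.
move: (\int[P]_w ln_reduced b _) (\int[P]_w ln_reduced (b + h) _) => u v.
move: (#|_|%:R * _) (3 * h * _ * _) => x y; lra.
Qed.

Lemma sum_sqr_cavity_le b :
  \sum_e \int[P]_w cavity_mean b (Jat w) e ^+ 2 <=
  2 * \sum_e \int[P]_w edge_mean b (Jat w) e ^+ 2 + 8 * (#|bond N|%:R * tsq b).
Proof.
have -> : #|bond N|%:R * tsq b = \sum_(e : bond N) tsq b by rewrite sumr_const mulr_natl.
rewrite !mulr_sumr -big_split /=; apply: ler_sum => e _.
have it := integrable_coupling e (integrable_sqr_tanh mu b).
rewrite -(Rintegral_coupling e (integrable_sqr_tanh mu b)).
have i1 := integrableZl_real 2 (integrable_sqr_edge b e).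
have i2 := integrableZl_real 8 it.
rewrite -!RintegralZl //; last exact: integrable_sqr_edge.
rewrite -RintegralD //; apply: ler_RintegralT => [||w].
- exact: integrable_sqr_cavity.
- exact: integrableD_real.
- exact: sqr_cavity_mean_le.
Qed.

Lemma one_sub_sqr_integrable (F : T -> R) :
  P.-integrable setT (EFin \o (fun w => F w ^+ 2)) ->
  P.-integrable setT (EFin \o (fun w => 1 - F w ^+ 2)).
Proof. by move=> iF; apply: integrableB_real => //; exact: integrable_cstT. Qed.

(** Energy bound: strong bonds would contribute too much energy if their end spins
    were not already aligned by the other bonds. *)
Lemma sum_one_sub_sqr_cavity_le b : 0 <= b ->
  xtanh b / 2 * \sum_e \int[P]_w (1 - cavity_mean b (Jat w) e ^+ 2) <=
  N%:R * ln 2 + #|bond N|%:R * lcosh 1.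
Proof.
move=> b0.
have A e := Rintegral_coupling_cavity b e (phi := fun x => x)
  (psi := fun m => m) (c := 1) mu_int (@measurable_id _ _ _) (fun m m1 => m1).
have odd0 : \int[mu]_x x = 0 by exact: Rintegral_odd.
have m1 : measurable_fun setT (fun m : R => 1 - m ^+ 2).
  by apply: measurable_funB => //; exact: measurable_funX.
have sqr1 (m : R) : `|m| <= 1 -> `|1 - m ^+ 2| <= 1.
  move=> mle1; have := sqr_le1_norm mle1; have := sqr_ge0 m => ? ?.
  by rewrite ger0_norm; lra.
have B e := Rintegral_coupling_cavity b e (phi := fun x => x * tanh (b * x))
  (psi := fun m => 1 - m ^+ 2) (c := 1) (integrable_mul_tanh mu_int b) m1 sqr1.
have i2 e := integrableZl_real 2^-1 (B e).1.
have i12 e := integrableD_real (A e).1 (i2 e).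
have iC e := integrable_coupling e (integrable_logcosh mu_int 1).
have iln := integrable_ln_reduced 1.
have iS2 := integrable_sum_real (index_enum (bond N)) predT iC.
have i3 := integrableD_real iln (integrable_cstT P (N%:R * ln 2)).
have iS1 := integrable_sum_real (index_enum (bond N)) predT i12.
have key w : \sum_e (J e w * cavity_mean b (Jat w) e + 2^-1 *
      (J e w * tanh (b * J e w) * (1 - cavity_mean b (Jat w) e ^+ 2))) <=
    ln_reduced 1 (Jat w) + N%:R * ln 2 + \sum_e logcosh (1 * J e w).
  under [in leRHS]eq_bigr do rewrite mul1r.
  apply: le_trans (cavity_field_sum_le (Jat w) b0).
  by apply: ler_sum => e _; rewrite [_ / 2]mulrC.
have := ler_RintegralT iS1 (integrableD_real i3 iS2) key.
rewrite (RintegralD _ i3 iS2) // (RintegralD _ iln) //; last exact: integrable_cstT.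
rewrite Rintegral_cstT !Rintegral_sum //.
have E e : \int[P]_w (J e w * cavity_mean b (Jat w) e + 2^-1 *
      (J e w * tanh (b * J e w) * (1 - cavity_mean b (Jat w) e ^+ 2))) =
    xtanh b / 2 * \int[P]_w (1 - cavity_mean b (Jat w) e ^+ 2).
  rewrite (RintegralD _ (A e).1 (i2 e)) //.
  rewrite (A e).2 odd0 mul0r add0r (RintegralZl _ _ (B e).1) // (B e).2; ring.
rewrite (eq_bigr _ (fun e _ => E e)) -mulr_sumr.
rewrite [X in _ <= _ + X](eq_bigr (fun=> lcosh 1)); last first.
  by move=> e _; rewrite (Rintegral_coupling e (integrable_logcosh mu_int 1)).
rewrite sumr_const -(mulr_natl (lcosh 1)).
have := deficit_ge0 1; rewrite /deficit.
by move: (\int[P]_w ln_reduced 1 _) (N%:R * ln 2) (#|_|%:R * _) (_ / 2 * _) => *; lra.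
Qed.

Lemma sum_one_sub_sqr_edge_le b :
  \sum_e \int[P]_w (1 - edge_mean b (Jat w) e ^+ 2) <=
  \sum_e \int[P]_w (1 - cavity_mean b (Jat w) e ^+ 2) +
  4 * (#|bond N|%:R * \int[mu]_x `|tanh (b * x)|).
Proof.
set a := \int[mu]_x `|_|.
have -> : #|bond N|%:R * a = \sum_(e : bond N) a by rewrite sumr_const mulr_natl.
rewrite mulr_sumr -big_split /=; apply: ler_sum => e _.
have iat : mu.-integrable setT (EFin \o (fun x => `|tanh (b * x)|)).
  exact/integrable_norm/integrable_tanh.
have it := integrable_coupling e iat.
rewrite /a -(Rintegral_coupling e iat).
have i1 := one_sub_sqr_integrable (integrable_sqr_cavity b e).
have i2 := integrableZl_real 4 it.
rewrite -RintegralZl // -RintegralD //; apply: ler_RintegralT => [||w].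
- exact/one_sub_sqr_integrable/integrable_sqr_edge.
- exact: integrableD_real.
- exact: one_sub_sqr_edge_mean_le.
Qed.

End FiniteVolume.

(** * Regularly varying tails *)

Lemma gt1_ltr_powR {R : realType} (c x y : R) : 1 < c -> x < y -> c `^ x < c `^ y.
Proof.
move=> c1 xy; rewrite /powR gt_eqF ?(lt_trans ltr01) // ltr_expR ltr_pM2r //.
exact: ln_gt0.
Qed.

Section RegularVariation.
Context {R : realType} (alpha : R) (u : R -> R) (a : nat -> R).
Hypothesis alpha_gt0 : 0 < alpha.
Hypothesis u_gt0 : forall x : R, 0 < x -> 0 < u x.
Hypothesis u_noninc : forall x y : R, 0 < x -> x <= y -> u y <= u x.
Hypothesis u_ratio : forall t : R, 0 < t -> u (t * x) / u x @[x --> +oo] --> t `^ (- alpha).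
Hypothesis a_pinfty : forall A : R, \forall n \near \oo, A <= a n.
Hypothesis a_above : forall n (x : R), 0 < x -> a n < x -> n%:R * u x <= 1.
Hypothesis a_below : forall n (x : R), 0 < x -> x < a n -> 1 <= n%:R * u x.

Lemma u_ratio_at_scale (x y : R) : 0 < x -> 0 < y ->
  u (a n * x) / u (a n * y) @[n --> \oo] --> (x / y) `^ (- alpha).
Proof.
move=> x0 y0; apply/cvgrPdist_lt => e e0.
have /cvgrPdist_lt/(_ e e0) := u_ratio (divr_gt0 x0 y0).
move=> [M [_ HM]]; near=> n.
have -> : a n * x = x / y * (a n * y) by field; rewrite gt_eqF.
apply: HM; rewrite -ltr_pdivrMr //; apply: (@lt_le_trans _ _ (M / y + 1)).
  by rewrite ltrDl.
by near: n; exact: a_pinfty.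
Unshelve. all: by end_near. Qed.

(** The hypotheses on [a n] pin [n * u (a n)] only up to a possible jump of [u] at
    [a n]; comparing with the nearby scales [rho * a n] and [a n / rho] removes the
    ambiguity. *)
Lemma tail_at_scale (x : R) : 0 < x ->
  n%:R * u (a n * x) @[n --> \oo] --> x `^ (- alpha).
Proof.
move=> x0; apply/cvgrPdist_le => e e0.
have p0 : 0 < x `^ (- alpha) by rewrite powR_gt0.
pose del := Num.min 1 (e / (2 * x `^ (- alpha))).
have d0 : 0 < del by rewrite lt_min ltr01 divr_gt0 // mulr_gt0.
have d1 : del <= 1 by rewrite ge_min lexx.
have de : del * (2 * x `^ (- alpha)) <= e.
  by rewrite -ler_pdivlMr ?mulr_gt0 // ge_min lexx orbT.
(* the scale ratio that changes the limit by the factor [1 + del] *)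
pose rho := (1 + del) `^ alpha^-1.
have rho_a : rho `^ alpha = 1 + del.
  by rewrite -powRrM mulVf ?gt_eqF // powRr1 // addr_ge0 // ltW.
have rho1 : 1 < rho.
  suff : 1 `^ alpha^-1 < rho by rewrite powR1.
  by apply: gt0_ltr_powR; rewrite ?invr_gt0 // ?nnegrE; lra.
have rho0 : 0 < rho by exact: lt_trans rho1.
have up := u_ratio_at_scale x0 rho0.
have lo := u_ratio_at_scale x0 (y := rho^-1) (etrans (invr_gt0 _) rho0).
have rV : rho^-1 `^ alpha = (1 + del)^-1.
  by rewrite -powR_inv1 ?ltW // -powRrM mulN1r powRN rho_a.
have E1 : (x / rho) `^ (- alpha) = x `^ (- alpha) * (1 + del).
  by rewrite powRM ?invr_ge0 ?ltW // (powRN rho^-1) rV invrK.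
have E2 : (x / rho^-1) `^ (- alpha) = x `^ (- alpha) / (1 + del).
  by rewrite invrK powRM ?ltW // (powRN rho) rho_a.
move/cvgrPdist_lt : up => /(_ (e / 2)) up; move/cvgrPdist_lt : lo => /(_ (e / 2)) lo.
near=> n.
have an : 0 < a n by apply: (@lt_le_trans _ _ 1) => //; near: n; exact: a_pinfty.
have anx : 0 < a n * x by rewrite mulr_gt0.
have n0 : 0 < n%:R :> R by rewrite ltr0n; near: n; exact: nbhs_infty_gt.
have H1 : n%:R * u (a n * rho) <= 1.
  by apply: a_above; rewrite ?mulr_gt0 // ltr_pMr.
have H2 : 1 <= n%:R * u (a n / rho).
  by apply: a_below; rewrite ?divr_gt0 // ltr_pdivrMr // ltr_pMr.
have u1 : 0 < u (a n * rho) by rewrite u_gt0 // mulr_gt0.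
have u2 : 0 < u (a n / rho) by rewrite u_gt0 // divr_gt0.
have u3 : 0 < u (a n * x) by exact: u_gt0.
have B1 : n%:R * u (a n * x) <= u (a n * x) / u (a n * rho).
  by rewrite ler_pdivlMr // mulrAC -[leRHS]mul1r ler_wpM2r // ltW.
have B2 : u (a n * x) / u (a n / rho) <= n%:R * u (a n * x).
  by rewrite ler_pdivrMr // mulrAC -[leLHS]mul1r ler_wpM2r // ltW.
have C1 : `|(x / rho) `^ (- alpha) - u (a n * x) / u (a n * rho)| < e / 2.
  by near: n; apply: up; rewrite divr_gt0.
have C2 : `|(x / rho^-1) `^ (- alpha) - u (a n * x) / u (a n / rho)| < e / 2.
  by near: n; apply: lo; rewrite divr_gt0.
rewrite E1 in C1; rewrite E2 in C2.
have D : x `^ (- alpha) * (1 - del) <= x `^ (- alpha) / (1 + del).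
  apply: ler_wpM2l; first exact: ltW.
  rewrite -[leRHS]mul1r ler_pdivlMr; last lra.
  by have := sqr_ge0 del; rewrite expr2; lra.
move: C1 C2; rewrite !ltr_distl ler_distl => /andP[C1 C1'] /andP[C2 C2'].
move: B1 B2 C1 C1' C2 C2' D de.
move: (x `^ (- alpha)) (x `^ (- alpha) / (1 + del)) (u (a n * x) / u (a n * rho))
  (u (a n * x) / u (a n / rho)) (n%:R * u (a n * x)) => p q v w z *.
by apply/andP; split; lra.
Unshelve. all: by end_near. Qed.

(** The ratio of the tail over one doubling tends to [2 `^ (- alpha)], strictly between
    a quarter and a half: doubling the level increases [x ^+ 2 * u x] and decreases
    [x * u x] geometrically. *)
Lemma doubling : alpha < 2 -> 1 < alpha ->
  exists r s x0 : R, [/\ 0 < r < 4, 0 < s < 2^-1, 0 < x0 &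
    forall x, x0 <= x -> u x <= r * u (2 * x) /\ u (2 * x) <= s * u x].
Proof.
move=> a2 a1; set p : R := 2 `^ (- alpha).
have p1 : p < 2^-1.
  by rewrite -powR_inv1 //; apply: gt1_ltr_powR; lra.
have p2 : 4^-1 < p.
  have -> : 4^-1 = 2 `^ (- 2%:R) :> R by rewrite powR_invn //; congr _^-1; lra.
  by apply: gt1_ltr_powR; lra.
have p0 : 0 < p by lra.
pose s := (p + 2^-1) / 2; pose q := (p + 4^-1) / 2.
have := @u_ratio 2 ltac:(lra) => /cvgrPdist_lt.
pose e := Num.min (s - p) (p - q).
have e0 : 0 < e by rewrite lt_min; apply/andP; split; rewrite /s /q; lra.
move=> /(_ e e0) [M [_ HM]].
exists q^-1, s, (Num.max 1 (M + 1)); split.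
- rewrite invr_gt0; apply/andP; split; first by rewrite /q; lra.
  by rewrite invf_plt ?posrE // /q; lra.
- by rewrite /s; apply/andP; split; lra.
- by rewrite lt_max ltr01.
move=> x; rewrite ge_max => /andP[x1 xM].
have ux : 0 < u x by apply: u_gt0; lra.
have := HM x ltac:(lra); rewrite ltr_distl => /andP[h1 h2].
have es : e <= s - p by rewrite ge_min lexx.
have eq' : e <= p - q by rewrite ge_min lexx orbT.
have q0 : 0 < q by rewrite /q; lra.
split.
  rewrite ler_pdivlMl // -ler_pdivlMr //.
  by move: h1 h2; rewrite -/p; lra.
by rewrite -ler_pdivrMr //; move: h1 h2; rewrite -/p; lra.
Qed.

End RegularVariation.

(** * Truncated moments of the couplings *)

Section Indicators.
Context d (T : measurableType d) (R : realType) (P : probability T R).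

Lemma measurable_lt_indicator (h : T -> R) (x : R) : measurable_fun setT h ->
  measurable_fun setT (fun w => (x < h w)%R%:R : R).
Proof.
move=> mh; have -> : (fun w => (x < h w)%R%:R : R) = \1_[set w | (x < h w)%R].
  by apply/funext => w; rewrite indicE mem_setE.
apply: measurable_indic.
rewrite [X in measurable X](_ : _ = setT `&` h @^-1` `]x, +oo[%classic).
  by apply: mh.
by apply/seteqP; split => w /=; rewrite in_itv /= andbT; [split|case].
Qed.

Lemma measurable_le_indicator (h : T -> R) (x : R) : measurable_fun setT h ->
  measurable_fun setT (fun w => (h w <= x)%R%:R : R).
Proof.
move=> mh; have -> : (fun w => (h w <= x)%R%:R : R) = (fun w => 1 - (x < h w)%R%:R).
  by apply/funext => w; rewrite leNgt; case: (x < h w); rewrite /= ?subrr ?subr0.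
by apply: measurable_funB => //; exact: measurable_lt_indicator.
Qed.

Lemma integrable_lt_indicator (h : T -> R) (x : R) : measurable_fun setT h ->
  P.-integrable setT (EFin \o (fun w => (x < h w)%R%:R)).
Proof.
move=> mh; apply: (@bounded_integrable _ _ _ _ _ 1); first exact: measurable_lt_indicator.
by move=> w; case: (x < h w); rewrite ?normr1 ?normr0.
Qed.

Lemma Rintegral_lt_indicator (h : T -> R) (x : R) : measurable_fun setT h ->
  \int[P]_w (x < h w)%R%:R = fine (P [set w | x < h w]).
Proof.
move=> mh; rewrite /Rintegral; congr fine.
rewrite -[X in _ = P X]setIT -integral_indic //; last first.
  rewrite [X in measurable X](_ : _ = setT `&` h @^-1` `]x, +oo[%classic).
    by apply: mh.
  by apply/seteqP; split => w /=; rewrite in_itv /= andbT; [split|case].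
by apply: eq_integral => w _; rewrite indicE mem_setE.
Qed.

End Indicators.

Section HeavyTail.
Context {R : realType} (alpha : R) (u : R -> R) d (T : measurableType d)
  (P : probability T R) (X : {RV P >-> R}).
Hypothesis a1 : 1 < alpha.
Hypothesis a2 : alpha < 2.
Hypothesis u_gt0 : forall x : R, 0 < x -> 0 < u x.
Hypothesis u_ratio : forall t : R, 0 < t -> u (t * x) / u x @[x --> +oo] --> t `^ (- alpha).
Hypothesis u_tail : forall x : R, 0 < x -> P [set w | x < `|X w|] = (u x)%:E.

Lemma measurable_norm_rv : measurable_fun setT (fun w => `|X w|).
Proof. exact: measurableT_comp. Qed.

Lemma tail_noninc (x y : R) : 0 < x -> x <= y -> u y <= u x.
Proof.
move=> x0 xy; rewrite -lee_fin -!u_tail //; last exact: lt_le_trans xy.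
have m z : measurable [set w | z < `|X w|].
  rewrite [X in measurable X](_ : _ = setT `&` (fun w => `|X w|) @^-1` `]z, +oo[%classic).
    by apply: measurable_norm_rv.
  by apply/seteqP; split => w /=; rewrite in_itv /= andbT; [split|case].
by apply: le_measure; rewrite ?inE // => w /=; exact: le_lt_trans.
Qed.

Lemma Rintegral_tail (x : R) : 0 < x -> \int[P]_w (x < `|X w|)%R%:R = u x.
Proof. by move=> x0; rewrite Rintegral_lt_indicator ?u_tail //; exact: measurable_norm_rv. Qed.

Definition small_sqr (x : R) w : R := X w ^+ 2 * (`|X w| <= x)%R%:R.

Definition large_abs (x y : R) w : R := `|X w| * ((x < `|X w|)%R%:R * (`|X w| <= y)%R%:R).

Lemma integrable_small_sqr x : 0 <= x -> P.-integrable setT (EFin \o small_sqr x).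
Proof.
move=> x0; apply: (@bounded_integrable _ _ _ _ _ (x ^+ 2)).
  apply: measurable_funM; first exact: measurable_funX.
  exact/measurable_le_indicator/measurable_norm_rv.
move=> w; rewrite /small_sqr; case: (leP `|X w| x) => h /=; rewrite ?mulr1n ?mulr0n.
  by rewrite mulr1 normrX lerXn2r ?nnegrE.
by rewrite mulr0 normr0 sqr_ge0.
Qed.

Lemma integrable_large_abs x y : P.-integrable setT (EFin \o large_abs x y).
Proof.
apply: (@bounded_integrable _ _ _ _ _ `|y|).
  apply: measurable_funM; first exact: measurable_norm_rv.
  apply: measurable_funM; first exact/measurable_lt_indicator/measurable_norm_rv.
  exact/measurable_le_indicator/measurable_norm_rv.
move=> w; rewrite /large_abs.
case: (x < _); case: (leP `|X w| y) => h /=; rewrite ?mulr1n ?mulr0n ?mul0r ?mulr0 ?normr0 //.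
by rewrite !mulr1 normr_id (le_trans h) // ler_norm.
Qed.

(** Karamata-type bounds, obtained by iterating the doubling inequalities; the
    exponents [1 < alpha < 2] make both geometric sums converge. *)
Lemma karamata : exists C x0 : R, [/\ 0 < C, 0 < x0 &
  forall x, x0 <= x -> \int[P]_w small_sqr x w <= C * (x ^+ 2 * u x) /\
    forall n, \int[P]_w large_abs x (2 ^+ n * x) w <= C * (x * u x)].
Proof.
have [r [s [x0 [/andP[r0 r4] /andP[s0 s2] x00 dbl]]]] := doubling u_gt0 u_ratio a2 a1.
have u2 : 0 < u (2 * x0) by apply: u_gt0; lra.
have ux0 : 0 < x0 ^+ 2 * u (2 * x0) by rewrite mulr_gt0 ?exprn_gt0.
(* the first two values absorb one doubling of the large and of the small part, and the
   third one covers the initial range of levels *)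
pose C := Num.max (2 / (1 - 2 * s)) (Num.max (4 * r / (4 - r)) (4 * x0 ^+ 2 / (x0 ^+ 2 * u (2 * x0)))).
have C1 : 2 <= C * (1 - 2 * s).
  by rewrite -ler_pdivrMr; [rewrite /C le_max lexx|lra].
have C2 : 4 * r <= C * (4 - r).
  by rewrite -ler_pdivrMr; [rewrite /C !le_max lexx orbT|lra].
have C3 : 4 * x0 ^+ 2 <= C * (x0 ^+ 2 * u (2 * x0)).
  by rewrite -ler_pdivrMr // /C !le_max lexx !orbT.
have C0 : 0 < C by nra.
exists C, x0; split => // x xx0; split; last first.
  move=> n; elim: n x xx0 => [|n IH] x xx0.
    have xp : 0 < x by lra.
    rewrite expr0 mul1r.
    have -> : large_abs x x = fun=> 0.
      apply/funext => w; rewrite /large_abs leNgt.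
      by case: (x < _); rewrite /= ?mulr1n ?mulr0n ?mul0r ?mulr0.
    by rewrite Rintegral_cstT mulr_ge0 ?ltW // mulr_gt0 // u_gt0.
  have xp : 0 < x by lra.
  have ux := u_gt0 xp.
  have [_ d2] := dbl x xx0.
  have := IH (2 * x) ltac:(lra).
  have -> : 2 ^+ n * (2 * x) = 2 ^+ n.+1 * x by rewrite exprSr mulrA.
  move=> IHx.
  have iT := integrable_lt_indicator P x measurable_norm_rv.
  have iT2 := integrableZl_real (2 * x) iT.
  apply: (@le_trans _ _ (2 * x * u x + C * (2 * x * u (2 * x)))).
    rewrite -(Rintegral_tail xp) -(RintegralZl _ _ iT) //.
    apply: le_trans (lerD (lexx _) IHx).
    rewrite -RintegralD //; last exact: integrable_large_abs.
    apply: ler_RintegralT; first exact: integrable_large_abs.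
      by apply: integrableD_real => //; exact: integrable_large_abs.
    move=> w; rewrite /large_abs; have := normr_ge0 (X w).
    by case: (ltP x `|X w|) => ?; case: (leP `|X w| (2 ^+ n.+1 * x)) => ?; case: (ltP (2 * x) `|X w|) => ?;
      rewrite /= ?mulr1n ?mulr0n => ?; lra.
  have g1 : 0 <= (C * (1 - 2 * s) - 2) * (x * u x) 
    by apply: mulr_ge0; [rewrite subr_ge0|apply: mulr_ge0; exact: ltW].
  have g2 : 0 <= C * (2 * x) * (s * u x - u (2 * x)).
    by apply: mulr_ge0; [apply: mulr_ge0; lra|rewrite subr_ge0].
  lra.
have smallE y : x0 <= y -> y <= 2 * x0 -> \int[P]_w small_sqr y w <= C * (y ^+ 2 * u y).
  move=> y1 y2; apply: (@le_trans _ _ (4 * x0 ^+ 2)).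
    rewrite -[leRHS](Rintegral_cstT P); apply: ler_RintegralT.
    - by apply: integrable_small_sqr; lra.
    - exact: integrable_cstT.
    move=> w; rewrite /small_sqr -(real_normK (num_real (X w))).
    have := normr_ge0 (X w); case: (leP `|X w| y) => ? ?; last first.
      by rewrite /= mulr0n mulr0 mulr_ge0 ?sqr_ge0.
    by rewrite /= mulr1n mulr1 !expr2; nra.
  apply: le_trans C3 _; rewrite ler_pM2l //.
  apply: ler_pM; [exact: sqr_ge0|exact: ltW|by rewrite lerXn2r // nnegrE; lra|].
  by apply: tail_noninc; lra.
have H n y : x0 <= y -> y <= 2 ^+ n * x0 -> \int[P]_w small_sqr y w <= C * (y ^+ 2 * u y).
  elim: n y => [|n IH] y y1 y2; first by apply: smallE => //; move: y2; rewrite expr0; lra.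
  have [|yl] := leP y (2 * x0); first exact: smallE.
  have yE : y = 2 * (y / 2) by field.
  have y3 : y / 2 <= 2 ^+ n * x0.
    by rewrite ler_pdivrMr // mulrC mulrA -exprS.
  have := IH (y / 2) ltac:(lra) y3.
  have [d1 _] := dbl (y / 2) ltac:(lra).
  rewrite -yE in d1.
  have zp : 0 < y / 2 by lra.
  have := u_gt0 zp; have uy : 0 < u y by apply: u_gt0; lra.
  move=> uz IHy.
  have iT := integrable_lt_indicator P (y / 2) measurable_norm_rv.
  apply: (@le_trans _ _ (C * ((y / 2) ^+ 2 * u (y / 2)) + y ^+ 2 * u (y / 2))).
    rewrite -[u (y / 2) in X in _ + X](Rintegral_tail zp) -(RintegralZl _ _ iT) //.
    apply: le_trans (lerD IHy (lexx _)).
    have iz : P.-integrable setT (EFin \o small_sqr (y / 2)).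
      by apply: integrable_small_sqr; lra.
    rewrite -RintegralD //; last exact: integrableZl_real.
    apply: ler_RintegralT; first by apply: integrable_small_sqr; lra.
      by apply: integrableD_real => //; exact: integrableZl_real.
    move=> w; rewrite /small_sqr -(real_normK (num_real (X w))).
    have := normr_ge0 (X w).
    by case: (leP `|X w| y) => ?; case: (leP `|X w| (y / 2)) => ? ?;
      rewrite /= ?mulr1n ?mulr0n ?expr2; nra.
  have -> : C * ((y / 2) ^+ 2 * u (y / 2)) + y ^+ 2 * u (y / 2) =
    y ^+ 2 * ((C / 4 + 1) * u (y / 2)) by field.
  rewrite [leRHS]mulrCA; apply: ler_wpM2l; first exact: sqr_ge0.
  nra.
pose n := Num.bound (x / x0).
apply: (H n) => //; rewrite -ler_pdivrMr //.
have xx : 0 <= x / x0 by rewrite divr_ge0 //; lra.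
apply: le_trans (ltW (archi_boundP xx)) _.
by rewrite -natrX ler_nat ltnW // ltn_expl.
Qed.

End HeavyTail.

(** * The law of the couplings *)

Section IntegrableTail.
Context {R : realType} d (T : measurableType d) (P : probability T R) (X : {RV P >-> R}).

Definition large (x : R) w : R := `|X w| * (x < `|X w|)%R%:R.

Lemma measurable_large x : measurable_fun setT (large x).
Proof.
apply: measurable_funM; first exact: measurable_norm_rv.
exact/measurable_lt_indicator/measurable_norm_rv.
Qed.

(** Monotone convergence in the truncation level. *)
Lemma large_of_truncated (x c : R) : 0 < x ->
  (forall n, \int[P]_w large_abs X x (2 ^+ n * x) w <= c) ->
  P.-integrable setT (EFin \o large x) /\ \int[P]_w large x w <= c.
Proof.
move=> x0 H.
have g0 n w : (0 <= (large_abs X x (2 ^+ n * x) w)%:E)%E.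
  by rewrite lee_fin /large_abs !mulr_ge0.
have mg n : measurable_fun setT (fun w => (large_abs X x (2 ^+ n * x) w)%:E).
  exact: (measurable_int P (integrable_large_abs X x (2 ^+ n * x))).
have nd w : {homo (fun n => (large_abs X x (2 ^+ n * x) w)%:E) : m n / (m <= n)%N >-> (m <= n)%E}.
  move=> m n mn; rewrite lee_fin /large_abs ler_wpM2l // ler_wpM2l //.
  case: (leP `|X w| (2 ^+ m * x)) => //= h; rewrite (le_trans h) //.
  by rewrite ler_pM2r // ler_eXn2l // ltr1n.
have lim w : limn (fun n => (large_abs X x (2 ^+ n * x) w)%:E) = (large x w)%:E.
  apply/cvg_lim => //; apply: cvg_near_cst.
  near=> n; rewrite /large_abs /large; congr ((_ * _)%:E).
  suff -> : `|X w| <= 2 ^+ n * x by rewrite mulr1.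
  rewrite -ler_pdivrMr //; have h : 0 <= `|X w| / x by rewrite divr_ge0 // ltW.
  apply: le_trans (ltW (archi_boundP h)) _.
  rewrite -natrX ler_nat (leq_trans _ (ltnW (ltn_expl n _))) //.
  by near: n; exact: nbhs_infty_ge.
have E := @cvg_monotone_convergence _ _ _ P _ measurableT _ mg
  (fun n w _ => g0 n w) (fun w _ => nd w).
have le : (\int[P]_w (large x w)%:E <= c%:E)%E.
  rewrite -(eq_integral _ _ (fun w _ => lim w)).
  rewrite -(cvg_lim _ E) //.
  apply: lime_le; first by apply/cvg_ex; eexists; exact: E.
  near=> n; have := H n; rewrite /Rintegral.
  by rewrite -lee_fin fineK // integrable_fin_num //; exact: integrable_large_abs.
have il : P.-integrable setT (EFin \o large x).
  apply/integrableP; split; first exact/measurable_EFinP/measurable_large.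
  apply: (@le_lt_trans _ _ c%:E); last exact: ltey.
  apply: le_trans le; rewrite le_eqVlt; apply/orP; left; apply/eqP.
  by apply: eq_integral => w _ /=; rewrite ger0_norm // /large mulr_ge0.
split => //.
by rewrite /Rintegral -lee_fin fineK // integrable_fin_num.
Unshelve. all: by end_near. Qed.

Lemma integrable_of_large (x : R) : P.-integrable setT (EFin \o large x) ->
  P.-integrable setT (EFin \o X).
Proof.
move=> il.
apply: (le_integrable_real _ _ (integrableD_real il (integrable_cstT P `|x|))) => //.
move=> w; rewrite /large; case: (ltP x `|X w|) => h /=.
  by rewrite mulr1 lerDl.
by rewrite mulr0 add0r (le_trans h) // ler_norm.
Qed.

End IntegrableTail.

Section CouplingLaw.
Context {R : realType} (alpha : R) (L : R -> R) d0 (T0 : measurableType d0)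
  (P0 : probability T0 R) (X : {RV P0 >-> R}).

Lemma measurable_rescaled N : measurable_fun setT (fun w => (scaling X N)^-1 * X w).
Proof. by apply: measurable_funM. Qed.

Definition rescaled N : {RV P0 >-> R} := mfun_Sub (mem_set (measurable_rescaled N)).

Definition coupling_law N : probability R R := distribution P0 (rescaled N).

Hypothesis halpha : 1 < alpha < 2.
Hypothesis hL0 : forall x : R, 0 < x -> 0 < L x.
Hypothesis hL : slowly_varying L.
Hypothesis hXsym : symmetric_rv X.
Hypothesis hXtail : forall x : R, 0 < x -> tail X x = (L x / x `^ alpha)%:E.

Let u x := L x / x `^ alpha.

Lemma tail_fun_gt0 (x : R) : 0 < x -> 0 < u x.
Proof. by move=> x0; rewrite divr_gt0 ?hL0 // powR_gt0. Qed.

Lemma tail_fun_ratio (t : R) : 0 < t -> u (t * x) / u x @[x --> +oo] --> t `^ (- alpha).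
Proof.
move=> t0.
have H : L (t * x) / L x * t `^ (- alpha) @[x --> +oo] --> t `^ (- alpha).
  by rewrite -[X in _ --> X]mul1r; apply: cvgM; [exact: hL|exact: cvg_cst].
apply/cvgrPdist_lt => e e0; move/cvgrPdist_lt : H => /(_ e e0).
apply: filter_app; near=> x.
have x0 : 0 < x by near: x; exact: nbhs_pinfty_gt.
have Lx := hL0 x0; have px : 0 < x `^ alpha by rewrite powR_gt0.
have pt : 0 < t `^ alpha by rewrite powR_gt0.
have -> // : u (t * x) / u x = L (t * x) / L x * t `^ (- alpha).
rewrite /u powRM ?ltW // powRN; field.
by rewrite !gt_eqF.
Unshelve. all: by end_near. Qed.

Lemma tail_fun_prob (x : R) : 0 < x -> P0 [set w | x < `|X w|] = (u x)%:E.
Proof. exact: hXtail. Qed.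

Let a1 : 1 < alpha. Proof. by case/andP: halpha. Qed.
Let a2 : alpha < 2. Proof. by case/andP: halpha. Qed.
Let a0 : 0 < alpha. Proof. exact: lt_trans a1. Qed.

Lemma scaling_set_nonempty N :
  [set x : R | 0 < x /\ (N%:R%:E * tail X x <= 1)%E] !=set0.
Proof.
have [r [s [x0 [_ /andP[s0 s2] x00 dbl]]]] := doubling tail_fun_gt0 tail_fun_ratio a2 a1.
have H n : u (2 ^+ n * x0) <= 2^-1 ^+ n * u x0.
  elim: n => [|n IH]; first by rewrite !expr0 !mul1r.
  have xn : x0 <= 2 ^+ n * x0 by apply: ler_peMl; [exact: ltW|rewrite exprn_ege1 // ler1n].
  have [_] := dbl _ xn; rewrite mulrA -exprS => /le_trans; apply.
  rewrite exprS -mulrA; apply: ler_pM => //; try lra.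
  by apply/ltW/tail_fun_gt0; rewrite mulr_gt0 // exprn_gt0.
pose n := Num.bound (N%:R * u x0).
have ux0 := tail_fun_gt0 x00.
have h0 : 0 <= N%:R * u x0 by rewrite mulr_ge0 // ltW.
have p0 : 0 < 2 ^+ n * x0 by rewrite mulr_gt0 // exprn_gt0.
exists (2 ^+ n * x0); split => //.
rewrite hXtail // -EFinM lee_fin -/(u _).
apply: (@le_trans _ _ (N%:R * (2^-1 ^+ n * u x0))); first by rewrite ler_wpM2l.
rewrite mulrCA exprVn ler_pdivrMl ?exprn_gt0 // mulr1.
apply: le_trans (ltW (archi_boundP h0)) _.
by rewrite -natrX ler_nat ltnW // ltn_expl.
Qed.

Lemma scaling_pinfty (A : R) : \forall n \near \oo, A <= scaling X n.
Proof.
pose B := Num.max A 1; have B0 : 0 < B by rewrite lt_max ltr01 orbT.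
have uB := tail_fun_gt0 B0.
near=> n; apply: (@le_trans _ _ B); first by rewrite le_max lexx.
apply: lb_le_inf; first exact: scaling_set_nonempty.
move=> x [x0]; rewrite hXtail // -EFinM lee_fin -/(u _) => h; rewrite leNgt; apply/negP => xB.
have := tail_noninc tail_fun_prob x0 (ltW xB) => uBx.
have : 1 < n%:R * u B.
  rewrite -ltr_pdivrMr //; apply: (@lt_le_trans _ _ (Num.bound (1 / u B))%:R).
    by apply: archi_boundP; rewrite divr_ge0 // ltW.
  by rewrite ler_nat; near: n; exact: nbhs_infty_ge.
apply/negP; rewrite -leNgt; apply: le_trans h.
by rewrite ler_wpM2l.
Unshelve. all: by end_near. Qed.

Lemma scaling_above n (x : R) : 0 < x -> scaling X n < x -> n%:R * u x <= 1.
Proof.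
move=> x0 /(inf_lt (scaling_set_nonempty n))[y [y0 +] yx].
rewrite hXtail // -EFinM lee_fin -/(u _); apply: le_trans.
by rewrite ler_wpM2l // (tail_noninc tail_fun_prob) // ltW.
Qed.

Lemma scaling_below n (x : R) : 0 < x -> x < scaling X n -> 1 <= n%:R * u x.
Proof.
move=> x0 xs; rewrite leNgt; apply/negP => h.
have : scaling X n <= x.
  apply: ge_inf; first by exists 0 => y [/ltW].
  by split => //; rewrite hXtail // -EFinM lee_fin ltW.
by rewrite leNgt xs.
Qed.

Lemma tail_scaled (x : R) : 0 < x -> n%:R * u (scaling X n * x) @[n --> \oo] --> x `^ (- alpha).
Proof.
exact: (tail_at_scale a0 tail_fun_gt0 tail_fun_ratio scaling_pinfty scaling_above scaling_below).
Qed.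

Lemma karamata_large : exists C x0 : R, [/\ 0 < C, 0 < x0 &
  forall x, x0 <= x -> \int[P0]_w small_sqr X x w <= C * (x ^+ 2 * u x) /\
    P0.-integrable setT (EFin \o large X x) /\
    \int[P0]_w large X x w <= C * (x * u x)].
Proof.
have [C [x0 [C0 x00 H]]] := karamata a1 a2 tail_fun_gt0 tail_fun_ratio tail_fun_prob.
exists C, x0; split => // x xx0; have [h1 h2] := H x xx0; split => //.
by apply: large_of_truncated => //; exact: lt_le_trans xx0.
Qed.

Lemma integrable_rv : P0.-integrable setT (EFin \o X).
Proof.
have [C [x0 [C0 x00 H]]] := karamata_large.
by have [_ [il _]] := H x0 (lexx _); exact: integrable_of_large il.
Qed.

Lemma coupling_law_sym N (A : set R) : measurable A ->
  coupling_law N A = coupling_law N (-%R @^-1` A).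
Proof.
move=> mA; have mB : measurable ((fun x => (scaling X N)^-1 * x) @^-1` A).
  by rewrite -[X in measurable X]setTI; exact: measurable_mul_cst.
change (P0 (X @^-1` ((fun x => (scaling X N)^-1 * x) @^-1` A)) =
  P0 (X @^-1` ((fun x => (scaling X N)^-1 * x) @^-1` (-%R @^-1` A)))).
rewrite (hXsym mB); congr (P0 _).
by apply/seteqP; split => w; rewrite /preimage /= mulrN.
Qed.

Lemma integrable_rescaled N : P0.-integrable setT (EFin \o rescaled N).
Proof. exact: (integrableZl_real (scaling X N)^-1 integrable_rv). Qed.

Lemma coupling_law_integrable N :
  (coupling_law N).-integrable setT (EFin \o (fun x : R => x)).
Proof.
apply: integrable_pushforward => //.
  by apply/measurable_EFinP; exact: measurable_id.
exact: integrable_rescaled.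
Qed.

Lemma Rintegral_coupling_law N (phi : R -> R) : measurable_fun setT phi ->
  P0.-integrable setT (EFin \o (fun w => phi (rescaled N w))) ->
  \int[coupling_law N]_x phi x = \int[P0]_w phi (rescaled N w).
Proof.
move=> mphi iphi; rewrite /Rintegral; congr fine.
by apply: (@integral_distribution _ _ _ _ _ P0 (rescaled N) (EFin \o phi)) => //;
  exact/measurable_EFinP.
Qed.

Lemma coupling_law_tail (x : R) : 0 < x ->
  N%:R * \int[coupling_law N]_y (x < `|y|)%R%:R @[N --> \oo] --> x `^ (- alpha).
Proof.
move=> x0; apply/cvgrPdist_lt => e e0.
have /cvgrPdist_lt/(_ e e0) := tail_scaled x0.
apply: filter_app; near=> N.
have aN : 0 < scaling X N.
  by apply: (@lt_le_trans _ _ 1) => //; near: N; exact: scaling_pinfty.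
have -> // : \int[coupling_law N]_y (x < `|y|)%R%:R = u (scaling X N * x).
have mn : measurable_fun setT (fun y : R => `|y|) by exact: normr_measurable.
have mr : measurable_fun setT (fun w => `|rescaled N w|) by exact: measurable_norm_rv.
rewrite Rintegral_coupling_law //; last 2 first.
- exact: measurable_lt_indicator.
- exact: (integrable_lt_indicator P0 x mr).
rewrite -(Rintegral_tail tail_fun_prob) ?mulr_gt0 //.
apply: eq_Rintegral => w _; rewrite /= normrM normfV (gtr0_norm aN).
by rewrite ltr_pdivlMl.
Unshelve. all: by end_near. Qed.

Definition small_sqr_fun (e y : R) : R := y ^+ 2 * (`|y| <= e)%R%:R.

Definition large_fun (e y : R) : R := `|y| * (e < `|y|)%R%:R.

Lemma measurable_small_sqr_fun e : measurable_fun setT (small_sqr_fun e).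
Proof.
apply: measurable_funM; first exact: measurable_funX.
by apply: measurable_le_indicator; exact: normr_measurable.
Qed.

Lemma measurable_large_fun e : measurable_fun setT (large_fun e).
Proof.
apply: measurable_funM; first exact: normr_measurable.
by apply: measurable_lt_indicator; exact: normr_measurable.
Qed.

(** The small couplings at a site have a bounded total variance and the large ones a
    bounded total strength, both with the scaling of the limiting power law. *)
Lemma coupling_law_moments : exists2 C : R, 0 < C & forall e : R, 0 < e ->
  \forall N \near \oo,
    N%:R * \int[coupling_law N]_y small_sqr_fun e y <= C * (e ^+ 2 * e `^ (- alpha)) /\
    N%:R * \int[coupling_law N]_y large_fun e y <= C * (e * e `^ (- alpha)).
Proof.
have [C [x0 [C0 x00 H]]] := karamata_large.
exists (2 * C); first by rewrite mulr_gt0.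
move=> e e0; have pe : 0 < e `^ (- alpha) by rewrite powR_gt0.
have /cvgrPdist_lt/(_ _ pe) := tail_scaled e0.
apply: filter_app; near=> N; rewrite ltr_distl => /andP[tle _].
have aN : 0 < scaling X N.
  by apply: (@lt_le_trans _ _ 1) => //; near: N; exact: scaling_pinfty.
set a := scaling X N in aN tle *.
have xa : x0 <= a * e.
  by rewrite -ler_pdivrMr // /a; near: N; exact: scaling_pinfty.
have [h1 [il h2]] := H _ xa.
have i1 : P0.-integrable setT (EFin \o small_sqr X (a * e)).
  by apply: integrable_small_sqr; rewrite mulr_ge0 ?ltW.
have E1 w : small_sqr_fun e (rescaled N w) = a^-1 ^+ 2 * small_sqr X (a * e) w.
  rewrite /small_sqr_fun /small_sqr /= -/a exprMn normrM normfV (gtr0_norm aN).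
  by rewrite ler_pdivrMl // -mulrA.
have E2 w : large_fun e (rescaled N w) = a^-1 * large X (a * e) w.
  rewrite /large_fun /large /= -/a normrM normfV (gtr0_norm aN).
  by rewrite ltr_pdivlMl // -mulrA.
have F1 : (fun w => small_sqr_fun e (rescaled N w)) =
  (fun w => a^-1 ^+ 2 * small_sqr X (a * e) w) by apply/funext => w; exact: E1.
have F2 : (fun w => large_fun e (rescaled N w)) =
  (fun w => a^-1 * large X (a * e) w) by apply/funext => w; exact: E2.
have N0 : 0 <= N%:R :> R by [].
have tle2 : N%:R * u (a * e) <= 2 * e `^ (- alpha) by lra.
split.
  rewrite Rintegral_coupling_law; last 2 first.
  - exact: measurable_small_sqr_fun.
  - by rewrite F1; exact: integrableZl_real.
  rewrite F1 (RintegralZl _ _ i1) //.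
  apply: (@le_trans _ _ (N%:R * (a^-1 ^+ 2 * (C * ((a * e) ^+ 2 * u (a * e)))))).
    by rewrite ler_wpM2l // ler_wpM2l // exprn_ge0 // invr_ge0 ltW.
  have -> : N%:R * (a^-1 ^+ 2 * (C * ((a * e) ^+ 2 * u (a * e)))) =
    C * e ^+ 2 * (N%:R * u (a * e)) by field; rewrite gt_eqF.
  have -> : 2 * C * (e ^+ 2 * e `^ (- alpha)) = C * e ^+ 2 * (2 * e `^ (- alpha)) by ring.
  by rewrite ler_wpM2l // mulr_ge0 ?sqr_ge0 // ltW.
rewrite Rintegral_coupling_law; last 2 first.
- exact: measurable_large_fun.
- by rewrite F2; exact: integrableZl_real.
rewrite F2 (RintegralZl _ _ il) //.
apply: (@le_trans _ _ (N%:R * (a^-1 * (C * ((a * e) * u (a * e)))))).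
  by rewrite ler_wpM2l // ler_wpM2l // invr_ge0 ltW.
have -> : N%:R * (a^-1 * (C * ((a * e) * u (a * e)))) =
  C * e * (N%:R * u (a * e)) by field; rewrite gt_eqF.
have -> : 2 * C * (e * e `^ (- alpha)) = C * e * (2 * e `^ (- alpha)) by ring.
by rewrite ler_wpM2l // mulr_ge0 // ltW.
Unshelve. all: by end_near. Qed.

End CouplingLaw.

(** * Convergence of the heavy couplings *)

(** A function with values in [[0, 1]] is within [n^-1] of the average of [n]
    indicators of its superlevel sets. For [tanh ^+ 2] these sets are complements of
    symmetric intervals, whose masses are known asymptotically; this replaces weak
    convergence of the laws. *)
Section Layers.
Context {R : realType}.

Lemma count_lt_nat (z : R) n : 0 <= z ->
  let c := \sum_(k < n) (k%:R < z)%R%:R in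
  (n%:R <= z -> c = n%:R) /\ (z <= n%:R -> z <= c <= z + 1).
Proof.
move=> z0 c; rewrite {}/c; elim: n => [|n [IH1 IH2]].
  by rewrite big_ord0; split => // ?; apply/andP; split; lra.
rewrite big_ord_recr /= -natr1; split => h.
  have -> : n%:R < z by apply: lt_le_trans h; rewrite ltrDl.
  by rewrite IH1 //; lra.
case: (ltP n%:R z) => nz /=; last by rewrite addr0; exact: IH2.
rewrite (IH1 (ltW nz)); apply/andP; split; lra.
Qed.

Definition layers n (y : R) : R := n%:R^-1 * \sum_(k < n) (k%:R / n%:R < y)%R%:R.

Lemma layers_bounds n y : (0 < n)%N -> 0 <= y <= 1 ->
  y <= layers n y <= y + n%:R^-1.
Proof.
move=> n0 /andP[y0 y1]; have n0' : 0 < n%:R :> R by rewrite ltr0n.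
have z0 : 0 <= n%:R * y by rewrite mulr_ge0 // ltW.
have zn : n%:R * y <= n%:R by rewrite ler_piMr // ltW.
have [_ /(_ zn)] := count_lt_nat n z0.
rewrite /layers ler_pdivlMl // ler_pdivrMl // mulrDr divff ?gt_eqF //.
by under eq_bigr => k _ do rewrite mulrC -ltr_pdivrMr //.
Qed.

Lemma layers_integral d (T : measurableType d) (mu : {measure set T -> \bar R})
    (D : set T) (psi w : T -> R) n (I : R) (Ik : 'I_n -> R) :
  (0 < n)%N -> measurable D -> measurable_fun D psi ->
  (forall x, D x -> 0 <= psi x <= 1) -> (forall x, D x -> 0 <= w x) ->
  mu.-integrable D (EFin \o w) -> \int[mu]_(x in D) w x = I ->
  (forall k : 'I_n, mu.-integrable D (EFin \o (fun x => w x * (k%:R / n%:R < psi x)%R%:R)) /\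
    \int[mu]_(x in D) (w x * (k%:R / n%:R < psi x)%R%:R) = Ik k) ->
  mu.-integrable D (EFin \o (fun x => psi x * w x)) /\
  \int[mu]_(x in D) (psi x * w x) <= n%:R^-1 * \sum_k Ik k <=
    \int[mu]_(x in D) (psi x * w x) + I / n%:R.
Proof.
move=> n0 mD mpsi psi01 w0 iw Iw H.
have n0' : 0 < n%:R :> R by rewrite ltr0n.
have mw : measurable_fun D w by exact/measurable_EFinP/(measurable_int mu).
have ipw : mu.-integrable D (EFin \o (fun x => psi x * w x)).
  apply: (le_integrable mD _ _ iw).
    by apply/measurable_EFinP; apply: measurable_funM.
  move=> x Dx /=; have /andP[p0 p1] := psi01 x Dx; have wx := w0 x Dx.
  by rewrite lee_fin !ger0_norm ?mulr_ge0 // ler_piMl.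
have iS : mu.-integrable D (EFin \o (fun x => \sum_(k < n) w x * (k%:R / n%:R < psi x)%R%:R)).
  have -> : EFin \o (fun x => \sum_(k < n) w x * (k%:R / n%:R < psi x)%R%:R) =
      (fun x => \sum_(k < n) (w x * (k%:R / n%:R < psi x)%R%:R)%:E)%E.
    by apply/funext => x /=; rewrite sumEFin.
  by apply: integrable_sum => // k _; have [] := H k.
have iL : mu.-integrable D (EFin \o (fun x => n%:R^-1 *
    \sum_(k < n) w x * (k%:R / n%:R < psi x)%R%:R)).
  exact: eq_integrable (integrableZl mD n%:R^-1 iS).
have EL : \int[mu]_(x in D) (n%:R^-1 * \sum_(k < n) w x * (k%:R / n%:R < psi x)%R%:R) =
    n%:R^-1 * \sum_k Ik k.
  rewrite RintegralZl //; congr (_ * _).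
  rewrite /Rintegral.
  under eq_integral => x _ do rewrite -sumEFin.
  rewrite integral_sum //; last by move=> k; have [] := H k.
  rewrite -[RHS]/(fine (_%:E)) -sumEFin; congr fine; apply: eq_bigr => k _.
  have [ik <-] := H k; rewrite /Rintegral fineK //.
  exact: integrable_fin_num.
have key x : D x -> psi x * w x <= n%:R^-1 *
    \sum_(k < n) w x * (k%:R / n%:R < psi x)%R%:R <= psi x * w x + n%:R^-1 * w x.
  move=> Dx; have -> : n%:R^-1 * \sum_(k < n) w x * (k%:R / n%:R < psi x)%R%:R =
      w x * layers n (psi x) by rewrite -mulr_sumr mulrCA.
  have /andP[h1 h2] := layers_bounds n0 (psi01 x Dx).
  rewrite (mulrC (psi x)) (mulrC n%:R^-1) -mulrDr.
  by apply/andP; split; apply: ler_wpM2l => //; exact: w0.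
have iw2 : mu.-integrable D (EFin \o (fun x => n%:R^-1 * w x)).
  exact: eq_integrable (integrableZl mD n%:R^-1 iw).
split => //; rewrite -EL; apply/andP; split.
  by apply: le_Rintegral => // x Dx; have /andP[] := key x Dx.
have -> : \int[mu]_(x in D) (psi x * w x) + I / n%:R =
    \int[mu]_(x in D) (psi x * w x + n%:R^-1 * w x).
  by rewrite RintegralD // RintegralZl // Iw mulrC.
apply: le_Rintegral => //.
  exact: eq_integrable (integrableD mD ipw iw2).
by move=> x Dx; have /andP[] := key x Dx.
Qed.

End Layers.

Section Pareto.
Context {R : realType} (alpha : R).
Hypothesis alpha_gt0 : 0 < alpha.

Let dens (x : R) : R := alpha * x `^ (- alpha - 1).

Lemma powRN_cvg0 : x `^ (- alpha) @[x --> +oo] --> (0 : R).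
Proof.
apply/cvgrPdist_lt => e e0; near=> x.
have x0 : 0 < x by near: x; exact: nbhs_pinfty_gt.
rewrite sub0r normrN ger0_norm ?powR_ge0 //.
have xe : e `^ (- alpha^-1) < x by near: x; exact: nbhs_pinfty_gt.
have : (e `^ (- alpha^-1)) `^ alpha < x `^ alpha.
  by apply: gt0_ltr_powR; rewrite ?nnegrE ?powR_ge0 // ltW.
rewrite -powRrM mulNr mulVf ?gt_eqF // powR_inv1 ?ltW // powRN => h.
by rewrite invf_plt ?posrE ?powR_gt0.
Unshelve. all: by end_near. Qed.

Lemma powR_continuous (b x : R) : 0 < x -> {for x, continuous (fun y : R => y `^ b)}.
Proof.
move=> x0; apply: differentiable_continuous; apply/derivable1_diffP.
by have [] := is_derive1_powR b x0.
Qed.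

Lemma pareto_integral (z : R) : 0 < z ->
  (\int[lebesgue_measure]_(x in `]z, +oo[) (dens x)%:E = (z `^ (- alpha))%:E)%E.
Proof.
move=> z0.
have cF (x : R) : 0 < x -> {for x, continuous (fun y : R => - y `^ (- alpha))}.
  by move=> x0; apply: continuousN; exact: powR_continuous.
have cd (x : R) : 0 < x -> {for x, continuous dens}.
  by move=> x0; apply: continuousM; [exact: cvg_cst|exact: powR_continuous].
have dF (x : R) : 0 < x -> is_derive x 1 (fun y : R => - y `^ (- alpha)) (dens x).
  move=> x0; have := is_deriveN (is_derive1_powR (- alpha) x0).
  by rewrite /dens mulNr opprK.
have wc : {within `[z, +oo[, continuous dens}.
  apply: continuous_in_subspaceT => x; rewrite inE /= in_itv /= andbT => zx.
  by apply: cd; exact: lt_le_trans zx.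
rewrite integral_itv_obnd_cbnd; last first.
  apply/measurable_EFinP; apply: subspace_continuous_measurable_fun => //.
  by apply: continuous_in_subspaceT => x; rewrite inE /= in_itv /= andbT => zx; apply: cd; exact: lt_trans zx.
rewrite (@ge0_continuous_FTC2y _ dens (fun y : R => - y `^ (- alpha)) z 0).
- by rewrite -EFinN -EFinD opprK add0r.
- by move=> x zx; rewrite /dens mulr_ge0 ?powR_ge0 // ltW.
- exact: wc.
- by rewrite -oppr0; apply: cvgN; exact: powRN_cvg0.
- by move=> x zx; have [] := dF x (lt_trans z0 zx).
- by apply: cvg_at_right_filter; exact: cF.
- move=> x; rewrite in_itv /= andbT => zx; rewrite derive1E.
  by have [_ ->] := dF x (lt_trans z0 zx).
Qed.

End Pareto.

Section HeavyLimit.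
Context {R : realType} (alpha : R).
Hypothesis alpha_gt0 : 0 < alpha.

Lemma sqr_tanh_gt (q : R) : 0 <= q < 1 ->
  exists2 y, 0 <= y & forall x, (q < tanh x ^+ 2) = (y < `|x|).
Proof.
move=> /andP[q0 q1].
have [|y y0 ty] := @tanh_surj R (Num.sqrt q).
  by rewrite sqrtr_ge0 /= -sqrtr1 ltr_sqrt.
exists y => // x.
rewrite -(real_normK (num_real (tanh x))) -tanh_norm -[in LHS](sqr_sqrtr q0) -ty.
rewrite ltr_pXn2r ?nnegrE ?ge0_tanh //.
have [yx|xy] := ltP y `|x|; first by rewrite tanh_lt.
by apply/negbTE; rewrite -leNgt tanh_le.
Qed.

(** The inverse function of [tanh ^+ 2] on the positive half-line. *)
Definition tanh_level (q : R) : R :=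
  xget 0 [set y | 0 <= y /\ forall x : R, (q < tanh x ^+ 2) = (y < `|x|)].

Lemma tanh_levelP (q : R) : 0 <= q < 1 ->
  0 <= tanh_level q /\ forall x : R, (q < tanh x ^+ 2) = (tanh_level q < `|x|).
Proof.
move=> /sqr_tanh_gt[y y0 yP]; rewrite /tanh_level.
by case: xgetP => [z _ []//|/(_ y)]; case.
Qed.

Definition level_radius (b K q : R) : R := Num.max K (tanh_level q / b).

Lemma level_radius_gt0 b K q : 0 < K -> 0 < level_radius b K q.
Proof. by move=> K0; rewrite lt_max K0. Qed.

Lemma level_radiusE b K q x : 0 < b -> 0 <= q < 1 ->
  (K < `|x|) && (q < tanh (b * x) ^+ 2) = (level_radius b K q < `|x|).
Proof.
move=> b0 /tanh_levelP[_ ->]; rewrite gt_max normrM (gtr0_norm b0).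
by rewrite ltr_pdivrMr // [b * _]mulrC.
Qed.

Definition layer_sum b K n : R :=
  n%:R^-1 * \sum_(k < n) level_radius b K (k%:R / n%:R) `^ (- alpha).

Definition heavy_integral b K : R :=
  alpha * \int[lebesgue_measure]_(x in `]K, +oo[) (tanh (b * x) ^+ 2 / x `^ (1 + alpha)).

Let ratio01 n (k : 'I_n) : 0 <= (k%:R / n%:R : R) < 1.
Proof.
have n0 : 0 < n%:R :> R by rewrite ltr0n (leq_trans _ (ltn_ord k)).
by rewrite divr_ge0 //= ltr_pdivrMr // mul1r ltr_nat.
Qed.

Let sqr_tanh01 (b x : R) : 0 <= tanh (b * x) ^+ 2 <= 1.
Proof. by rewrite sqr_ge0 sqr_tanh_le1. Qed.

Lemma heavy_integral_layers b K n : 0 < b -> 0 < K -> (0 < n)%N ->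
  heavy_integral b K <= layer_sum b K n <= heavy_integral b K + K `^ (- alpha) / n%:R.
Proof.
move=> b0 K0 n0.
pose w (x : R) : R := alpha * x `^ (- alpha - 1).
have mI (z : R) : measurable (`]z, +oo[%classic : set R) by [].
have w0 x : 0 <= w x by rewrite mulr_ge0 ?powR_ge0 // ltW.
have mw : measurable_fun setT w.
  by apply: measurable_funM => //; exact: measurable_powR.
have iw z : 0 < z -> lebesgue_measure.-integrable `]z, +oo[ (EFin \o w).
  move=> z0; apply/integrableP; split.
    by apply/measurable_EFinP; apply: measurable_funTS.
  under eq_integral => x _ do rewrite /= ger0_norm //.
  by rewrite pareto_integral // ltey.
have Iw z : 0 < z -> \int[lebesgue_measure]_(x in `]z, +oo[) w x = z `^ (- alpha).
  by move=> z0; rewrite /Rintegral pareto_integral.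
have H (k : 'I_n) : lebesgue_measure.-integrable `]K, +oo[
      (EFin \o (fun x => w x * (k%:R / n%:R < tanh (b * x) ^+ 2)%R%:R)) /\
    \int[lebesgue_measure]_(x in `]K, +oo[)
      (w x * (k%:R / n%:R < tanh (b * x) ^+ 2)%R%:R) =
    level_radius b K (k%:R / n%:R) `^ (- alpha).
  set r := level_radius b K (k%:R / n%:R).
  have r0 : 0 < r by exact: level_radius_gt0.
  have Kr : K <= r by rewrite le_max lexx.
  have E x : x \in `]K, +oo[%classic ->
      w x * (k%:R / n%:R < tanh (b * x) ^+ 2)%R%:R = (w \_ `]r, +oo[) x.
    rewrite inE /= in_itv /= andbT => Kx; rewrite patchE.
    have := level_radiusE K x b0 (ratio01 k).
    rewrite (gtr0_norm (lt_trans K0 Kx)) Kx /= -/r => ->.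
    case: (ltP r x) => rx /=.
      by rewrite mulr1 ifT // inE /= in_itv /= rx.
    by rewrite mulr0 ifF //; apply/negbTE; rewrite notin_setE /= in_itv /= andbT ltNge rx.
  have sub : `]r, +oo[%classic `<=` (`]K, +oo[%classic : set R).
    by move=> x /=; rewrite !in_itv /= !andbT; exact: le_lt_trans.
  split.
    apply: (le_integrable _ _ _ (iw _ K0)) => //.
      apply/measurable_EFinP; apply: measurable_funTS; apply: measurable_funM => //.
      by apply: measurable_lt_indicator; apply: measurable_funX; exact: measurable_tanhM.
    move=> x _ /=; rewrite lee_fin.
    by case: (_ < _ ^+ 2); rewrite /= ?mulr1 ?mulr0 ?normr0.
  transitivity (\int[lebesgue_measure]_(x in `]K, +oo[) (w \_ `]r, +oo[) x).
    exact: eq_Rintegral.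
  by rewrite -Rintegral_mkcondr setIidr // Iw.
have mpsi : measurable_fun (`]K, +oo[%classic : set R) (fun x => tanh (b * x) ^+ 2).
  by apply: measurable_funTS; apply: measurable_funX; exact: measurable_tanhM.
have [ipw] := @layers_integral R _ _ lebesgue_measure `]K, +oo[%classic
  (fun x : R => tanh (b * x) ^+ 2) w n _ _ n0 (mI K) mpsi (fun x _ => sqr_tanh01 b x) (fun x _ => w0 x)
  (iw _ K0) (Iw _ K0) H.
suff -> : \int[lebesgue_measure]_(x in `]K, +oo[) (tanh (b * x) ^+ 2 * w x) =
  heavy_integral b K by [].
have E x : x \in (`]K, +oo[%classic : set R) ->
    tanh (b * x) ^+ 2 / x `^ (1 + alpha) = alpha^-1 * (tanh (b * x) ^+ 2 * w x).
  rewrite inE /= in_itv /= andbT => Kx.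
  by rewrite /w -powRN opprD addrC; field; rewrite gt_eqF.
rewrite /heavy_integral.
have -> : \int[lebesgue_measure]_(x in `]K, +oo[) (tanh (b * x) ^+ 2 / x `^ (1 + alpha)) =
    \int[lebesgue_measure]_(x in `]K, +oo[) (alpha^-1 * (tanh (b * x) ^+ 2 * w x)).
  exact: eq_Rintegral.
by rewrite RintegralZl // mulVKf // gt_eqF.
Qed.

Definition tail_mass (mu : probability R R) (z : R) : R := \int[mu]_x (z < `|x|)%R%:R.

Lemma law_layers (mu : probability R R) b K n : 0 < b -> 0 < K -> (0 < n)%N ->
  \int[mu]_x (tanh (b * x) ^+ 2 * (K < `|x|)%R%:R) <=
    n%:R^-1 * \sum_(k < n) tail_mass mu (level_radius b K (k%:R / n%:R)) <=
  \int[mu]_x (tanh (b * x) ^+ 2 * (K < `|x|)%R%:R) + tail_mass mu K / n%:R.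
Proof.
move=> b0 K0 n0.
have mn : measurable_fun setT (fun x : R => `|x|) by exact: normr_measurable.
have iT z := integrable_lt_indicator mu z mn.
have H (k : 'I_n) : mu.-integrable setT (EFin \o (fun x => (K < `|x|)%R%:R *
      (k%:R / n%:R < tanh (b * x) ^+ 2)%R%:R)) /\
    \int[mu]_x ((K < `|x|)%R%:R * (k%:R / n%:R < tanh (b * x) ^+ 2)%R%:R) =
    tail_mass mu (level_radius b K (k%:R / n%:R)).
  have -> : (fun x : R => (K < `|x|)%R%:R * (k%:R / n%:R < tanh (b * x) ^+ 2)%R%:R : R) =
      (fun x => (level_radius b K (k%:R / n%:R) < `|x|)%R%:R).
    apply/funext => x; rewrite -level_radiusE //.
    by case: (K < _); case: (_ < _ ^+ 2); rewrite /= ?mulr1 ?mulr0 ?mul0r.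
  by split => //; exact: iT.
have mpsi : measurable_fun setT (fun x : R => tanh (b * x) ^+ 2).
  by apply: measurable_funX; exact: measurable_tanhM.
by have [] := layers_integral n0 measurableT mpsi (fun x _ => sqr_tanh01 b x)
  (fun x _ => ler0n _ _) (iT K) erefl H.
Qed.

Lemma layer_sum_scaling b K n : 0 < b -> 0 < K ->
  layer_sum b K n = b `^ alpha * layer_sum 1 (b * K) n.
Proof.
move=> b0 K0; rewrite /layer_sum mulrCA; congr (_ * _); rewrite mulr_sumr.
apply: eq_bigr => k _; set q := _ / _.
have -> : level_radius 1 (b * K) q = b * level_radius b K q.
  rewrite /level_radius maxr_pMr ?(ltW b0) // divr1; congr Num.max.
  by rewrite mulrC divfK // gt_eqF.
have r0 := level_radius_gt0 b q K0.
rewrite powRM ?(ltW b0) ?(ltW r0) // mulrA (powRN b) divff ?mul1r //.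
by rewrite gt_eqF // powR_gt0.
Qed.

Lemma le_of_le_invn (x y c : R) : 0 <= c ->
  (forall n, (0 < n)%N -> x <= y + c / n%:R) -> x <= y.
Proof.
move=> c0 H; rewrite leNgt; apply/negP => yx.
pose n := (Num.bound (c / (x - y))).+1.
have := H n isT; rewrite leNgt => /negP; apply.
rewrite -ltrBrDl ltr_pdivrMr ?ltr0n // mulrC -ltr_pdivrMr ?subr_gt0 //.
apply: lt_le_trans (archi_boundP _) _; first by rewrite divr_ge0 // subr_ge0 ltW.
by rewrite ler_nat.
Qed.

(** The layer sums scale exactly, and both integrals are within [O (n^-1)] of them. *)
Lemma heavy_integral_scaling b K : 0 < b -> 0 < K ->
  heavy_integral b K = b `^ alpha * heavy_integral 1 (b * K).
Proof.
move=> b0 K0; have bK0 : 0 < b * K by rewrite mulr_gt0.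
have pb : 0 < b `^ alpha by rewrite powR_gt0.
have E : b `^ alpha * (b * K) `^ (- alpha) = K `^ (- alpha).
  rewrite powRM ?ltW // mulrA (powRN b) divff ?mul1r // gt_eqF //.
have pK := powR_ge0 K (- alpha).
apply/eqP; rewrite eq_le; apply/andP; split.
  apply: (le_of_le_invn pK) => n n0.
  have /andP[h1 _] := heavy_integral_layers b0 K0 n0.
  have /andP[_ h2] := heavy_integral_layers ltr01 bK0 n0.
  apply: le_trans h1 _; rewrite layer_sum_scaling // -E -mulrA -mulrDr.
  by rewrite ler_wpM2l // ltW.
apply: (le_of_le_invn pK) => n n0.
have /andP[_ h1] := heavy_integral_layers b0 K0 n0.
have /andP[h2 _] := heavy_integral_layers ltr01 bK0 n0.
apply: le_trans h1; rewrite layer_sum_scaling //.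
by rewrite ler_wpM2l // ltW.
Qed.

End HeavyLimit.

(** * Asymptotics of the coupling law *)

Section LawAsymptotics.
Context {R : realType} (alpha : R) (mu : nat -> probability R R).
Hypothesis halpha : 1 < alpha < 2.
Hypothesis mu_int : forall N, (mu N).-integrable setT (EFin \o (fun x : R => x)).
Hypothesis mu_tail : forall x : R, 0 < x ->
  N%:R * tail_mass (mu N) x @[N --> \oo] --> x `^ (- alpha).
Hypothesis mu_moments : exists2 C : R, 0 < C & forall e : R, 0 < e ->
  \forall N \near \oo,
    N%:R * \int[mu N]_y small_sqr_fun e y <= C * (e ^+ 2 * e `^ (- alpha)) /\
    N%:R * \int[mu N]_y large_fun e y <= C * (e * e `^ (- alpha)).

Let a1 : 1 < alpha. Proof. by case/andP: halpha. Qed.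
Let a2 : alpha < 2. Proof. by case/andP: halpha. Qed.
Let a0 : 0 < alpha. Proof. exact: lt_trans a1. Qed.

Local Notation tsq N b := (\int[mu N]_x (tanh (b * x) ^+ 2)).
Local Notation xtanh N b := (\int[mu N]_x (x * tanh (b * x))).
Local Notation lcosh N h := (\int[mu N]_x logcosh (h * x)).

Definition heavy_tsq N b K := \int[mu N]_x (tanh (b * x) ^+ 2 * (K < `|x|)%R%:R).

(** The expectations and the limiting integral lie within [O (n^-1)] of layer sums,
    and those converge because they are finite sums of tail masses. *)
Lemma heavy_tsq_cvg b K : 0 < b -> 0 < K ->
  N%:R * heavy_tsq N b K @[N --> \oo] --> heavy_integral alpha b K.
Proof.
move=> b0 K0; apply/cvgrPdist_le => e e0.
have pK : 0 < K `^ (- alpha) by rewrite powR_gt0.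
pose n := (Num.bound (4 * K `^ (- alpha) / e)).+1.
have n0 : (0 < n)%N by [].
have n0' : 0 < n%:R :> R by rewrite ltr0n.
have ne : K `^ (- alpha) / n%:R <= e / 4.
  have h : 0 <= 4 * K `^ (- alpha) / e by rewrite divr_ge0 ?mulr_ge0 // ltW.
  have : 4 * K `^ (- alpha) / e <= n%:R.
    by apply: le_trans (ltW (archi_boundP h)) _; rewrite ler_nat.
  rewrite ler_pdivrMr // ler_pdivrMr //; lra.
have /andP[I1 I2] := heavy_integral_layers a0 b0 K0 n0.
have /cvgrPdist_le/(_ _ pK) tK := mu_tail K0.
have cS : N%:R * (n%:R^-1 * \sum_(k < n) tail_mass (mu N) (level_radius b K (k%:R / n%:R)))
    @[N --> \oo] --> layer_sum alpha b K n.
  have -> : (fun N => N%:R * (n%:R^-1 *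
        \sum_(k < n) tail_mass (mu N) (level_radius b K (k%:R / n%:R)))) =
      (fun N => n%:R^-1 *
        \sum_(k < n) N%:R * tail_mass (mu N) (level_radius b K (k%:R / n%:R))).
    by apply/funext => N; rewrite mulrCA mulr_sumr.
  apply: cvgM; first exact: cvg_cst.
  apply: cvg_big => [|k _]; last exact/mu_tail/level_radius_gt0.
  exact: add_continuous.
have e4 : 0 < e / 4 by rewrite divr_gt0.
have /cvgrPdist_le/(_ _ e4) cS' := cS.
near=> N.
have tKN : `|K `^ (- alpha) - N%:R * tail_mass (mu N) K| <= K `^ (- alpha) by near: N.
have cSN : `|layer_sum alpha b K n - N%:R * (n%:R^-1 *
  \sum_(k < n) tail_mass (mu N) (level_radius b K (k%:R / n%:R)))| <= e / 4 by near: N.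
have /andP[h1 h2] := law_layers (mu N) b0 K0 n0.
have N0 : 0 <= N%:R :> R by [].
have H1 := ler_wpM2l N0 h1; have H2 := ler_wpM2l N0 h2.
have tn : N%:R * (tail_mass (mu N) K / n%:R) <= 2 * (e / 4).
  rewrite mulrA ler_pdivrMr //; move: tKN; rewrite ler_distl => /andP[tKN _].
  apply: (@le_trans _ _ (2 * K `^ (- alpha))); first lra.
  by move: ne; rewrite ler_pdivrMr //; lra.
move: cSN H1 H2 tn I1 I2 ne; rewrite /heavy_tsq mulrDr !ler_distl.
move: (N%:R * (n%:R^-1 * _)) (N%:R * (tail_mass _ _ / _)) (N%:R * \int[mu N]_x _) => u v w.
move: (K `^ _ / _) (heavy_integral _ _ _) (layer_sum _ _ _ _) => p q s.
by move=> /andP[? ?] *; apply/andP; split; lra.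
Unshelve. all: by end_near. Qed.

Let iabs N : (mu N).-integrable setT (EFin \o (fun x : R => `|x|)).
Proof. exact: integrable_norm_law. Qed.

Let isq N e : (mu N).-integrable setT (EFin \o small_sqr_fun e).
Proof.
apply: (@bounded_integrable _ _ _ _ _ (`|e| ^+ 2)); first exact: measurable_small_sqr_fun.
move=> x; rewrite /small_sqr_fun; case: (leP `|x| e) => h /=.
  by rewrite mulr1 normrX lerXn2r ?nnegrE // (le_trans h) // ler_norm.
by rewrite mulr0 normr0 sqr_ge0.
Qed.

Let ila N e : (mu N).-integrable setT (EFin \o large_fun e).
Proof.
apply: (le_integrable_real _ _ (iabs N)); first exact: measurable_large_fun.
move=> x; rewrite /large_fun normrM normr_id ler_piMr //.
by case: (_ < _); rewrite /= ?normr1 ?normr0.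
Qed.

Lemma moment_split N (phi : R -> R) p q e : 0 <= N%:R :> R ->
  (mu N).-integrable setT (EFin \o phi) ->
  (forall x, phi x <= p * small_sqr_fun e x + q * large_fun e x) ->
  N%:R * \int[mu N]_x phi x <=
  p * (N%:R * \int[mu N]_x small_sqr_fun e x) + q * (N%:R * \int[mu N]_x large_fun e x).
Proof.
move=> N0 iphi H.
have i1 := integrableZl_real p (isq N e); have i2 := integrableZl_real q (ila N e).
have := ler_RintegralT iphi (integrableD_real i1 i2) H.
rewrite RintegralD // (RintegralZl _ _ (isq N e)) // (RintegralZl _ _ (ila N e)) //.
move=> h; apply: le_trans (ler_wpM2l N0 h) _; rewrite le_eqVlt; apply/orP; left.
by apply/eqP; ring.
Qed.

(** With the quadratic bound on [logcosh] below [h^-1] and the linear one above, the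
    result is of higher order than the temperature step [h], because [alpha > 1]. *)
Lemma lcosh_le : exists2 C : R, 0 < C & forall h : R, 0 < h ->
  \forall N \near \oo, N%:R * lcosh N h <= C * h `^ alpha.
Proof.
have [C C0 H] := mu_moments; exists (2 * C); first by rewrite mulr_gt0.
move=> h h0; have hi0 : 0 < h^-1 by rewrite invr_gt0.
apply: filterS (H _ hi0) => N [H1 H2].
have hE : h^-1 `^ (- alpha) = h `^ alpha.
  by rewrite -powR_inv1 ?ltW // -powRrM mulN1r opprK.
rewrite hE in H1 H2.
apply: (le_trans (@moment_split N (fun x => logcosh (h * x)) (h ^+ 2 / 2) h h^-1
  (ler0n _ _) (integrable_logcosh (mu_int N) h) _)).
  move=> x; rewrite /small_sqr_fun /large_fun; case: (leP `|x| h^-1) => _ /=.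
    rewrite mulr1 mulr0 mulr0 addr0; apply: le_trans (logcosh_le_sqr _) _.
    by rewrite exprMn mulrAC.
  rewrite mulr0 mulr0 add0r mulr1; apply: le_trans (logcosh_le_norm _) _.
  by rewrite normrM gtr0_norm.
have h2 : 0 <= h ^+ 2 / 2 by rewrite divr_ge0 // sqr_ge0.
apply: le_trans (lerD (ler_wpM2l h2 H1) (ler_wpM2l (ltW h0) H2)) _.
have -> : h ^+ 2 / 2 * (C * (h^-1 ^+ 2 * h `^ alpha)) + h * (C * (h^-1 * h `^ alpha)) =
  3 / 2 * (C * h `^ alpha) by field; rewrite gt_eqF.
have : 0 <= C * h `^ alpha by rewrite mulr_ge0 ?powR_ge0 // ltW.
lra.
Qed.

Lemma xtanh_le (b : R) : 0 <= b -> exists2 C : R, 0 < C &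
  \forall N \near \oo, N%:R * xtanh N b <= C.
Proof.
have [C C0 H] := mu_moments; move=> b0; exists (C * (b + 1)).
  by rewrite mulr_gt0 // ltr_wpDl.
apply: filterS (H 1 ltr01) => N [H1 H2].
rewrite powR1 !mulr1 expr1n mulr1 in H1 H2.
apply: (le_trans (@moment_split N (fun x => x * tanh (b * x)) b 1 1
  (ler0n _ _) (integrable_mul_tanh (mu_int N) b) _)).
  move=> x; rewrite /small_sqr_fun /large_fun; case: (leP `|x| 1) => _ /=.
    rewrite mulr1 !mulr0 addr0; apply: le_trans (ler_norm _) _.
    rewrite normrM -(real_normK (num_real x)) expr2 mulrCA ler_wpM2l //.
    by apply: le_trans (norm_tanh_le _) _; rewrite normrM ger0_norm.
  rewrite !mulr0 add0r mulr1 mul1r; apply: le_trans (ler_norm _) _.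
  by rewrite normrM ler_piMr // ltW // norm_tanh_lt1.
by apply: le_trans (lerD (ler_wpM2l b0 H1) (ler_wpM2l ler01 H2)) _; lra.
Qed.

(** About [b `^ alpha] couplings per site exceed [b^-1], and each of them
    contributes at least [tanh 1 / b]; as [alpha > 1], this diverges with [b]. *)
Lemma xtanh_ge (b : R) : 0 < b -> \forall N \near \oo,
  tanh 1 / 2 * b `^ (alpha - 1) <= N%:R * xtanh N b.
Proof.
move=> b0; have bi0 : 0 < b^-1 by rewrite invr_gt0.
have bE : b^-1 `^ (- alpha) = b `^ alpha.
  by rewrite -powR_inv1 ?ltW // -powRrM mulN1r opprK.
have pb : 0 < b `^ alpha by rewrite powR_gt0.
have := mu_tail bi0; rewrite bE => /cvgrPdist_le.
have pb2 : 0 < b `^ alpha / 2 by rewrite divr_gt0.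
move=> /(_ _ pb2); apply: filterS => N; rewrite ler_distl => /andP[_ h].
have t1 : 0 <= tanh (1 : R) by exact: ge0_tanh.
have mn : measurable_fun setT (fun x : R => `|x|) by exact: normr_measurable.
have iT := integrable_lt_indicator (mu N) b^-1 mn.
have : tanh 1 / b * tail_mass (mu N) b^-1 <= xtanh N b.
  rewrite /tail_mass -(RintegralZl _ _ iT) //; apply: ler_RintegralT.
  - exact: integrableZl_real.
  - exact: integrable_mul_tanh.
  move=> x; case: (ltP b^-1 `|x|) => bx /=; last by rewrite mulr0 (mul_tanh_ge0 _ (ltW b0)).
  rewrite mulr1 (mul_tanh_norm _ (ltW b0)) [leLHS]mulrC.
  apply: ler_pM => //; [exact: ltW|exact: ltW|].
  by apply: tanh_le; rewrite -ler_pdivrMl // mulr1 ltW.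
have N0 : 0 <= N%:R :> R by [].
move=> /(ler_wpM2l N0); apply: le_trans.
have -> : b `^ (alpha - 1) = b `^ alpha / b.
  by rewrite powRB ?powRr1 ?ltW // gt_eqF // implybT.
have -> : tanh 1 / 2 * (b `^ alpha / b) = tanh 1 / b * (b `^ alpha / 2).
  by field; rewrite gt_eqF.
rewrite [leRHS]mulrCA.
rewrite ler_wpM2l ?divr_ge0 ?(ltW b0) //; lra.
Qed.

Lemma tsq_le_split N b K : 0 < K ->
  N%:R * tsq N b <= b ^+ 2 * (N%:R * \int[mu N]_x small_sqr_fun K x) +
    N%:R * heavy_tsq N b K.
Proof.
move=> K0.
have mn : measurable_fun setT (fun x : R => `|x|) by exact: normr_measurable.
have i1 := integrableZl_real (b ^+ 2) (isq N K).
have i2 : (mu N).-integrable setT (EFin \o (fun x => tanh (b * x) ^+ 2 * (K < `|x|)%R%:R)).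
  apply: (le_integrable_real _ _ (integrable_sqr_tanh (mu N) b)).
    apply: measurable_funM; last exact: measurable_lt_indicator.
    by apply: measurable_funX; exact: measurable_tanhM.
  move=> x; case: (_ < _); rewrite /= ?mulr1 ?mulr0 ?normr0 ?sqr_ge0 //.
  by rewrite ger0_norm ?sqr_ge0.
have H x : tanh (b * x) ^+ 2 <= b ^+ 2 * small_sqr_fun K x +
    tanh (b * x) ^+ 2 * (K < `|x|)%R%:R.
  rewrite /small_sqr_fun; case: (leP `|x| K) => _ /=.
    by rewrite mulr1 mulr0 addr0 -exprMn sqr_tanh_le.
  by rewrite mulr0 mulr0 add0r mulr1.
have := ler_RintegralT (integrable_sqr_tanh (mu N) b) (integrableD_real i1 i2) H.
rewrite RintegralD // (RintegralZl _ _ (isq N K)) // => /(ler_wpM2l (ler0n R N)).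
by rewrite mulrDr mulrCA.
Qed.

Lemma tsq_bounded (b : R) : 0 < b -> exists2 C : R, 0 < C &
  \forall N \near \oo, N%:R * tsq N b <= C.
Proof.
move=> b0; have [C C0 H] := mu_moments.
exists (b ^+ 2 * C + `|heavy_integral alpha b 1| + 1).
  by rewrite ltr_wpDl // addr_ge0 // mulr_ge0 ?sqr_ge0 // ltW.
have /cvgrPdist_le/(_ 1 ltr01) := heavy_tsq_cvg b0 ltr01.
apply: filter_app; apply: filterS (H 1 ltr01) => N [H1 _].
rewrite powR1 mulr1 expr1n mulr1 in H1.
rewrite ler_distl => /andP[h _]; apply: le_trans (tsq_le_split N b ltr01) _.
have := ler_wpM2l (sqr_ge0 b) H1; have := ler_norm (heavy_integral alpha b 1); lra.
Qed.

(** The definition of the critical temperature, after scaling [b] out of the integral;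
    if the defining integral is not positive and finite there is no such [b]. *)
Lemma critical_integral b : 0 < b < beta_critical alpha ->
  exists2 q : R, 0 <= q < 1 & forall K, 0 < K -> heavy_integral alpha b K <= q.
Proof.
move=> /andP[b0]; rewrite /beta_critical.
set I := \int[lebesgue_measure]_(x in `]0, +oo[) _ => bc.
pose f (x : R) : \bar R := (tanh x ^+ 2 / x `^ (alpha + 1))%:E.
have f0 x : (0 <= f x)%E by rewrite lee_fin mulr_ge0 ?sqr_ge0 // invr_ge0 powR_ge0.
have I0 : 0 <= I by apply: Rintegral_ge0 => x _; rewrite -lee_fin; exact: f0.
have Ip : 0 < I.
  rewrite lt_neqAle I0 andbT; apply/eqP => IE.
  by move: bc; rewrite -IE mulr0 powR0 ?oppr_eq0 ?invr_eq0 ?gt_eqF // ltNge ltW.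
have IE : (\int[lebesgue_measure]_(x in `]0%R, +oo[) f x = I%:E)%E.
  rewrite /I /Rintegral fineK // ge0_fin_numE; last by apply: integral_ge0 => x _; exact: f0.
  rewrite ltey; apply/eqP => Ey; move: Ip.
  by rewrite /I /Rintegral Ey /= ltxx.
have aI : 0 < alpha * I by rewrite mulr_gt0.
exists (b `^ alpha * (alpha * I)).
  rewrite mulr_ge0 ?powR_ge0 ?(ltW aI) //= -ltr_pdivlMr // mul1r.
  have := @gt0_ltr_powR _ alpha a0 b ((alpha * I) `^ (- alpha^-1)).
  rewrite !nnegrE powR_ge0 (ltW b0) => /(_ isT isT bc).
  by rewrite -powRrM mulNr mulVf ?gt_eqF // powR_inv1 // ltW.
move=> K K0; rewrite heavy_integral_scaling // ler_wpM2l ?powR_ge0 //.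
rewrite /heavy_integral ler_wpM2l ?(ltW a0) //.
have bK : 0 < b * K by rewrite mulr_gt0.
have mf : measurable_fun (`]0, +oo[%classic : set R) f.
  apply/measurable_EFinP; apply: measurable_funTS; apply: measurable_funM.
    by apply: measurable_funX; exact: measurable_tanh.
  under eq_fun do rewrite -powRN.
  exact: measurable_powR.
have sub : `]b * K, +oo[%classic `<=` (`]0, +oo[%classic : set R).
  by move=> x /=; rewrite !in_itv /= !andbT; exact: lt_trans.
have le : (\int[lebesgue_measure]_(x in `](b * K)%R, +oo[) f x <=
    \int[lebesgue_measure]_(x in `]0%R, +oo[) f x)%E.
  exact: ge0_subset_integral.
rewrite IE in le.
have -> : \int[lebesgue_measure]_(x in `]b * K, +oo[) (tanh (1 * x) ^+ 2 / x `^ (1 + alpha)) =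
    fine (\int[lebesgue_measure]_(x in `](b * K)%R, +oo[) f x)%E.
  by rewrite /Rintegral; congr fine; apply: eq_integral => x _; rewrite mul1r (addrC 1).
rewrite -lee_fin fineK // ge0_fin_numE; last by apply: integral_ge0 => x _; exact: f0.
exact: le_lt_trans le (ltey _).
Qed.

(** The subcritical condition at finite volume: heavy couplings are handled by the
    limit law, and the light ones have a small total variance. *)
Lemma tsq_subcritical b : 0 < b < beta_critical alpha ->
  exists2 q : R, 0 <= q < 1 & \forall N \near \oo, N%:R * tsq N b <= q.
Proof.
move=> bc; have /andP[b0 _] := bc.
have [q /andP[q0 q1] H] := critical_integral bc; have [C C0 M] := mu_moments.
pose del := (1 - q) / 4; have d0 : 0 < del by rewrite /del; lra.
exists (q + 2 * del); first by rewrite /del; apply/andP; split; lra.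
have a2' : 0 < 2 - alpha by rewrite subr_gt0.
have bC : 0 < b ^+ 2 * C by rewrite mulr_gt0 ?exprn_gt0.
(* the level below which the couplings at a site have total variance of order [del] *)
pose K := (del / (b ^+ 2 * C)) `^ (2 - alpha)^-1.
have dC : 0 < del / (b ^+ 2 * C) by rewrite divr_gt0.
have K0 : 0 < K by rewrite powR_gt0.
have KE : K ^+ 2 * K `^ (- alpha) = del / (b ^+ 2 * C).
  rewrite -powR_mulrn ?(ltW K0) // -powRD; last by rewrite (gt_eqF K0) implybT.
  by rewrite -powRrM mulVf ?gt_eqF // powRr1 // ltW.
have /cvgrPdist_le/(_ _ d0) := heavy_tsq_cvg b0 K0.
apply: filter_app; apply: filterS (M K K0) => N [H1 _].
rewrite KE in H1; rewrite ler_distl => /andP[h _].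
apply: le_trans (tsq_le_split N b K0) _.
have := ler_wpM2l (sqr_ge0 b) H1.
have -> : b ^+ 2 * (C * (del / (b ^+ 2 * C))) = del by field; rewrite !gt_eqF.
have := H K K0; lra.
Qed.

End LawAsymptotics.

(** * Site overlap *)

Section SubcriticalDeficit.
Context {R : realType} (alpha : R) (mu : nat -> probability R R)
  (d : nat -> measure_display) (T : forall N : nat, measurableType (d N))
  (P : forall N : nat, probability (T N) R)
  (J : forall N : nat, bond N -> {RV (P N) >-> R}).
Hypothesis halpha : 1 < alpha < 2.
Hypothesis indJ : forall N, (0 < N)%N -> mutually_independent (@J N).
Hypothesis lawJ : forall N, (0 < N)%N ->
  forall e (A : set R), measurable A -> P N (@J N e @^-1` A) = mu N A.
Hypothesis mu_sym : forall N (A : set R), measurable A -> mu N A = mu N (-%R @^-1` A).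
Hypothesis mu_int : forall N, (mu N).-integrable setT (EFin \o (fun x : R => x)).
Hypothesis mu_tail : forall x : R, 0 < x ->
  N%:R * tail_mass (mu N) x @[N --> \oo] --> x `^ (- alpha).
Hypothesis mu_moments : exists2 C : R, 0 < C & forall e : R, 0 < e ->
  \forall N \near \oo,
    N%:R * \int[mu N]_y small_sqr_fun e y <= C * (e ^+ 2 * e `^ (- alpha)) /\
    N%:R * \int[mu N]_y large_fun e y <= C * (e * e `^ (- alpha)).

Let a1 : 1 < alpha. Proof. by case/andP: halpha. Qed.

Local Notation tsq N b := (\int[mu N]_x (tanh (b * x) ^+ 2)).
Local Notation xtanh N b := (\int[mu N]_x (x * tanh (b * x))).
Local Notation lcosh N h := (\int[mu N]_x logcosh (h * x)).
Local Notation Jat N w := (fun e => @J N e w).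

Definition edge_sum N b := \sum_e \int[P N]_w edge_mean b (Jat N w) e ^+ 2.

Lemma tanh_sqr_mono (b b' x : R) : 0 <= b -> b <= b' ->
  tanh (b * x) ^+ 2 <= tanh (b' * x) ^+ 2.
Proof.
move=> b0 bb'; rewrite -(real_normK (num_real (tanh (b * x)))).
rewrite -(real_normK (num_real (tanh (b' * x)))) lerXn2r ?nnegrE // -!tanh_norm.
apply: tanh_le; rewrite !normrM (ger0_norm b0) (ger0_norm (le_trans b0 bb')).
by rewrite ler_wpM2r.
Qed.

Lemma tsq_mono N (b b' : R) : 0 <= b -> b <= b' -> tsq N b <= tsq N b'.
Proof.
move=> b0 bb'; apply: ler_RintegralT; [exact: integrable_sqr_tanh..|].
by move=> x; exact: tanh_sqr_mono.
Qed.

Lemma xtanh_mono N (b b' : R) : 0 <= b -> b <= b' -> xtanh N b <= xtanh N b'.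
Proof.
move=> b0 bb'; apply: ler_RintegralT; [exact: integrable_mul_tanh..|].
move=> x; rewrite (mul_tanh_norm _ b0) (mul_tanh_norm _ (le_trans b0 bb')).
by rewrite ler_wpM2l // tanh_le // ler_wpM2r.
Qed.

Lemma ln_nat_small (e : R) : 0 < e -> \forall N \near \oo, ln (2 * N.+1)%:R <= e * N%:R.
Proof.
move=> e0; near=> N.
have N1 : 1 <= N%:R :> R by rewrite ler1n; near: N; exact: nbhs_infty_gt.
have Ne : 16 / e ^+ 2 <= N%:R.
  apply: le_trans (ltW (archi_boundP _)) _; first by rewrite divr_ge0 // sqr_ge0.
  by rewrite ler_nat; near: N; exact: nbhs_infty_ge.
set x : R := (2 * N.+1)%:R; have x0 : 0 < x by rewrite ltr0n.
have sx : 0 < Num.sqrt x by rewrite sqrtr_gt0.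
have -> : ln x = 2 * ln (Num.sqrt x).
  by rewrite mulr_natl -lnXn // sqr_sqrtr // ltW.
have := ln_sublinear sx.
suff : 2 * Num.sqrt x <= e * N%:R by lra.
have eN : 0 <= e * N%:R by rewrite mulr_ge0 // ltW.
have s0 : 0 <= 2 * Num.sqrt x by rewrite mulr_ge0 // ltW.
rewrite -(@ler_pXn2r _ 2) ?nnegrE // !exprMn sqr_sqrtr; last exact: ltW.
have xN : x <= 4 * N%:R by rewrite /x natrM -natr1; lra.
have : 16 <= e ^+ 2 * N%:R by move: Ne; rewrite ler_pdivrMr ?exprn_gt0 // mulrC.
have N0 : 0 <= N%:R :> R by [].
move=> /(ler_wpM2r N0) h.
have -> : e ^+ 2 * N%:R ^+ 2 = e ^+ 2 * N%:R * N%:R by ring.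
lra.
Unshelve. all: by end_near. Qed.

Lemma gronwall_grid (D : nat -> R) (A c : R) m : 0 <= A -> 0 <= c -> D 0%N = 0 ->
  (forall j, (j < m)%N -> D j.+1 <= D j * (1 + A) + c) ->
  D m <= expR (m%:R * A) * (m%:R * c).
Proof.
move=> A0 c0 D0 H.
have K j : (j <= m)%N -> D j <= (1 + A) ^+ j * (j%:R * c).
  elim: j => [|j IH] jm; first by rewrite D0 mul0r mulr0.
  apply: le_trans (H _ jm) _.
  have p1 : 1 <= (1 + A) ^+ j.+1 by rewrite exprn_ege1 // lerDl.
  have A1 : 0 <= 1 + A by lra.
  have := ler_wpM2r A1 (IH (ltnW jm)).
  have : 0 <= ((1 + A) ^+ j.+1 - 1) * c by rewrite mulr_ge0 // subr_ge0.
  rewrite exprS -natr1; lra.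
apply: le_trans (K m (leqnn _)) _; rewrite ler_wpM2r ?mulr_ge0 //.
rewrite expRM_natl lerXn2r ?nnegrE ?expR_ge0 ?expR_ge1Dx //; lra.
Qed.

Lemma deficit0 N : (0 < N)%N -> deficit (@J N) 0 = 0.
Proof.
move=> N0; rewrite /deficit.
have E w : ln_reduced 0 (Jat N w) = 0.
  apply: expR_inj; rewrite expR0 expR_ln_reduced.
  rewrite (eq_bigr (fun=> 1)); last first.
    by move=> s _; rewrite big1 // => e _; rewrite mul0r tanh0 mul0r addr0.
  by rewrite sumr_const card_config mulVf // expf_neq0.
under eq_Rintegral do rewrite E.
by rewrite Rintegral_cstT oppr0.
Qed.

Lemma budget_le (n t q : R) : 0 < n -> n * t <= q -> n * (t + (1 - q) / n) <= 1.
Proof.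
move=> n0 tq; have -> : n * (t + (1 - q) / n) = n * t + (1 - q).
  by field; rewrite gt_eqF.
by lra.
Qed.

(** The replica coupling bound, fed into the growth of the deficit over one step;
    [n] is the number of sites, [nb] the number of bonds, and [S] and [V] are the sums
    of squared bond means with and without the bond itself. *)
Lemma deficit_step_bound (n t x S V lc C1 C2 k0 l h g D nb : R) :
  0 < n -> 0 < k0 -> 0 <= h -> 0 <= x -> n * x <= C1 -> 0 <= t -> n * t <= 1 ->
  0 <= l -> 0 <= D -> k0 / n * S <= l + 2 * D -> V <= 2 * S + 8 * (nb * t) ->
  0 <= lc -> n * lc <= C2 * g -> nb <= n ^+ 2 / 2 ->
  D + 3 * h * x * V + nb * lc <=
  D * (1 + h * (12 * C1 / k0)) + (h * (6 * C1 / k0 * l + 12 * C1) + n * (C2 / 2) * g).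
Proof.
move=> n0 k00 h0 x0 xC t0 t1 l0 D0 HS HV lc0 lC nb2.
have S_le : S <= n / k0 * (l + 2 * D).
  have -> : S = n / k0 * (k0 / n * S) by field; rewrite !gt_eqF.
  by rewrite ler_wpM2l // divr_ge0 // ltW.
have tn : nb * t <= n / 2.
  by apply: le_trans (ler_wpM2r t0 nb2) _; have := ler_wpM2l (ltW n0) t1; lra.
pose W := 2 / k0 * (l + 2 * D) + 4.
have W0 : 0 <= W by rewrite addr_ge0 // mulr_ge0 ?divr_ge0 ?(ltW k00) // addr_ge0 // mulr_ge0.
have V_le : V <= n * W.
  have -> : n * W = 2 * (n / k0 * (l + 2 * D)) + 8 * (n / 2).
    by rewrite /W; field; rewrite gt_eqF.
  by apply: le_trans HV _; rewrite lerD // ler_pM2l.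
have H3 : 3 * h * x * V <= 3 * h * W * C1.
  have hx : 0 <= 3 * h * x by rewrite !mulr_ge0.
  apply: le_trans (ler_wpM2l hx V_le) _.
  have -> : 3 * h * x * (n * W) = 3 * h * W * (n * x) by ring.
  by rewrite ler_wpM2l // !mulr_ge0.
have H4 : nb * lc <= n * (C2 / 2) * g.
  by apply: le_trans (ler_wpM2r lc0 nb2) _; have := ler_wpM2l (ltW n0) lC; lra.
have -> : D * (1 + h * (12 * C1 / k0)) + (h * (6 * C1 / k0 * l + 12 * C1) + n * (C2 / 2) * g)
    = D + 3 * h * W * C1 + n * (C2 / 2) * g by rewrite /W; field; rewrite gt_eqF.
by rewrite lerD // lerD.
Qed.

(** On a grid of [m] temperatures, each step multiplies the deficit by at most
    [1 + h * A] and adds [N * O (h `^ alpha)]. The accumulated error is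
    [N * O (m `^ (1 - alpha))], as small as desired because [alpha > 1]. *)
Lemma deficit_sublinear (b e : R) : 0 < b < beta_critical alpha -> 0 < e ->
  \forall N \near \oo, deficit (@J N) b <= e * N%:R.
Proof.
move=> bc e0; have /andP[b0 _] := bc.
have [q /andP[q0 q1] Hq] := tsq_subcritical halpha mu_tail mu_moments bc.
have [C1 C10 H1] := xtanh_le mu_int mu_moments (ltW b0).
have [C2 C20 H2] := lcosh_le mu_int mu_moments.
pose k0 := 1 - q; have k00 : 0 < k0 by rewrite subr_gt0.
pose A := 12 * C1 / k0; have A0 : 0 < A by rewrite divr_gt0 // mulr_gt0.
pose G := expR (b * A); have G0 : 0 < G by exact: expR_gt0.
have am : 0 < alpha - 1 by rewrite subr_gt0.
pose c0 := G * (b `^ alpha * (C2 / 2)).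
have c00 : 0 < c0 by rewrite mulr_gt0 // mulr_gt0 ?powR_gt0 // divr_gt0.
have ec : 0 < e / (2 * c0) by rewrite divr_gt0 // mulr_gt0.
have /cvgrPdist_lt/(_ _ ec)[M [_ HM]] := powRN_cvg0 am.
(* enough steps to keep the accumulated error below [e / 2 * N] *)
pose m := (Num.bound `|M|).+1.
have m0 : 0 < m%:R :> R by rewrite ltr0n.
have mM : M < m%:R.
  apply: le_lt_trans (ler_norm _) _; apply: lt_le_trans (archi_boundP (normr_ge0 _)) _.
  by rewrite ler_nat.
have mp : m%:R `^ (- (alpha - 1)) <= e / (2 * c0).
  by have := HM _ mM; rewrite sub0r normrN ger0_norm ?powR_ge0 // => /ltW.
pose h := b / m%:R; have h0 : 0 < h by rewrite divr_gt0.
have mh : m%:R * h = b by rewrite /h mulrC divfK // gt_eqF.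
pose B l : R := 6 * C1 / k0 * l + 12 * C1.
pose e1 := e / (4 * G * b * (6 * C1 / k0)).
have e10 : 0 < e1 by rewrite divr_gt0 // !mulr_gt0 // ?invr_gt0 // mulr_gt0.
near=> N.
have N0 : (0 < N)%N by near: N; exact: nbhs_infty_gt.
have NR : 0 < N%:R :> R by rewrite ltr0n.
have q_le : N%:R * tsq N b <= q by near: N.
have x_le : N%:R * xtanh N b <= C1 by near: N.
have l_le : N%:R * lcosh N h <= C2 * h `^ alpha by near: N; exact: H2.
have l_small : ln (2 * N.+1)%:R <= e1 * N%:R by near: N; exact: ln_nat_small.
pose l : R := ln (2 * N.+1)%:R; rewrite -/l in l_small.
have l0 : 0 <= l by rewrite ln_ge0 // ler1n.
have N_big : 12 * C1 * (4 * G * b / e) <= N%:R.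
  apply: le_trans (ltW (archi_boundP _)) _.
    by rewrite !mulr_ge0 ?invr_ge0 // ltW.
  by rewrite ler_nat; near: N; exact: nbhs_infty_ge.
have nb : #|bond N|%:R <= N%:R ^+ 2 / 2 :> R by exact: card_bond_le.
have nb0 : 0 <= #|bond N|%:R :> R by [].
have indN := indJ N0; have lawN := lawJ N0.
have iN := mu_int N; have sN := mu_sym N.
pose c := h * B l + N%:R * (C2 / 2) * h `^ alpha.
have c_ge0 : 0 <= c.
  have : 0 <= h `^ alpha by exact: powR_ge0.
  have Bl : 0 <= B l by rewrite addr_ge0 // mulr_ge0 // ?divr_ge0 // ?mulr_ge0 // ltW.
  by move=> ?; rewrite addr_ge0 // mulr_ge0 // ?(ltW h0) // mulr_ge0 ?divr_ge0 // ltW.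
have step j : (j < m)%N -> deficit (@J N) (j.+1%:R * h) <=
    deficit (@J N) (j%:R * h) * (1 + h * A) + c.
  move=> jm; set b' := j%:R * h.
  have b'0 : 0 <= b' by exact: mulr_ge0 (ler0n _ _) (ltW h0).
  have b'b : b' <= b.
    by rewrite -mh /b' (ler_wpM2r (ltW h0)) // ler_nat ltnW.
  have -> : j.+1%:R * h = b' + h by rewrite -natr1 mulrDl mul1r.
  have tq := le_trans (ler_wpM2l (ltW NR) (tsq_mono N b'0 b'b)) q_le.
  have xq := le_trans (ler_wpM2l (ltW NR) (xtanh_mono N b'0 b'b)) x_le.
  have k0' : 0 <= k0 / N%:R by exact: divr_ge0 (ltW k00) (ltW NR).
  have HS := sum_sqr_edge_le indN lawN sN iN N0 k0' (budget_le NR tq).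
  have HV := sum_sqr_cavity_le lawN b'.
  have D0 := deficit_ge0 indN lawN sN iN b'.
  have x0 : 0 <= xtanh N b' by apply: Rintegral_ge0 => x _; exact: mul_tanh_ge0.
  have t0 : 0 <= tsq N b' by apply: Rintegral_ge0 => x _; exact: sqr_ge0.
  have lc0 : 0 <= lcosh N h by apply: Rintegral_ge0 => x _; exact: logcosh_ge0.
  apply: le_trans (deficit_step indN lawN sN iN b'0 (ltW h0)) _.
  exact: (deficit_step_bound NR k00 (ltW h0) x0 xq t0 (le_trans tq (ltW q1)) l0 D0
    HS HV lc0 l_le nb).
have D00 : deficit (@J N) (0%:R * h) = 0 by rewrite mul0r deficit0.
have := gronwall_grid (D := fun j => deficit (@J N) (j%:R * h)) (mulr_ge0 (ltW h0) (ltW A0))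
  c_ge0 D00 step.
rewrite mh (mulrA _ h A) mh -/G => /le_trans; apply.
have -> : G * (m%:R * c) = G * b * (6 * C1 / k0) * l + 12 * C1 * (G * b) +
    N%:R * (c0 * m%:R `^ (- (alpha - 1))).
  have hE : m%:R * h `^ alpha = b `^ alpha * m%:R `^ (- (alpha - 1)).
    rewrite /h powRM ?invr_ge0 ?(ltW b0) // mulrCA; congr (_ * _).
    rewrite opprB -[X in X * _](powRr1 (ltW m0)) -powR_inv1 // -powRrM mulN1r -powRD //.
    by rewrite (gt_eqF m0) implybT.
  rewrite /c /B mulrDr (mulrA m%:R h) mh.
  have -> : m%:R * (N%:R * (C2 / 2) * h `^ alpha) =
    N%:R * (C2 / 2) * (b `^ alpha * m%:R `^ (- (alpha - 1))) by rewrite -hE; ring.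
  by rewrite /c0; ring.
have T1 : G * b * (6 * C1 / k0) * l <= e / 4 * N%:R.
  have g0 : 0 < G * b * (6 * C1 / k0) by rewrite !mulr_gt0 // ?invr_gt0 // mulr_gt0.
  apply: le_trans (ler_wpM2l (ltW g0) l_small) _.
  by rewrite /e1 le_eqVlt; apply/orP; left; apply/eqP; field; rewrite !gt_eqF.
have T2 : 12 * C1 * (G * b) <= e / 4 * N%:R.
  have e4 : 0 <= e / 4 by rewrite divr_ge0 // ltW.
  have := ler_wpM2l e4 N_big; apply: le_trans.
  by rewrite le_eqVlt; apply/orP; left; apply/eqP; field; rewrite gt_eqF.
have T3 : N%:R * (c0 * m%:R `^ (- (alpha - 1))) <= e / 2 * N%:R.
  rewrite mulrC ler_wpM2r // ?(ltW NR) //.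
  apply: le_trans (ler_wpM2l (ltW c00) mp) _.
  by rewrite le_eqVlt; apply/orP; left; apply/eqP; field; rewrite gt_eqF.
lra.
Unshelve. all: by end_near. Qed.

(** The replica coupling bound once more, now with a sublinear deficit. *)
Lemma edge_sum_small (b e : R) : 0 < b < beta_critical alpha -> 0 < e ->
  \forall N \near \oo, edge_sum N b <= e * N%:R ^+ 2.
Proof.
move=> bc e0; have /andP[b0 _] := bc.
have [q /andP[q0 q1] Hq] := tsq_subcritical halpha mu_tail mu_moments bc.
pose k0 := 1 - q; have k00 : 0 < k0 by rewrite subr_gt0.
pose e1 := e * k0 / 3; have e10 : 0 < e1 by rewrite divr_gt0 // mulr_gt0.
near=> N.
have N0 : (0 < N)%N by near: N; exact: nbhs_infty_gt.
have NR : 0 < N%:R :> R by rewrite ltr0n.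
have q_le : N%:R * tsq N b <= q by near: N.
have D_le : deficit (@J N) b <= e1 * N%:R by near: N; exact: deficit_sublinear.
have l_le : ln (2 * N.+1)%:R <= e1 * N%:R by near: N; exact: ln_nat_small.
have kN : N%:R * (tsq N b + k0 / N%:R) <= 1 := budget_le NR q_le.
have k0' : 0 <= k0 / N%:R by rewrite divr_ge0 // ltW.
have := sum_sqr_edge_le (indJ N0) (lawJ N0) (mu_sym N) (mu_int N) N0 k0' kN.
rewrite -/(edge_sum N b) => h.
have : k0 / N%:R * edge_sum N b <= e * k0 * N%:R by rewrite /e1 in D_le l_le; lra.
rewrite mulrAC ler_pdivrMr // => h2.
by rewrite -(ler_pM2l k00); apply: le_trans h2 _; rewrite expr2; lra.
Unshelve. all: by end_near. Qed.

Lemma expectationE N (F : T N -> R) : (P N).-integrable setT (EFin \o F) ->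
  ('E_(P N)[F])%E = (\int[P N]_w F w)%:E.
Proof.
by move=> iF; rewrite unlock /Rintegral fineK //; exact: integrable_fin_num.
Qed.

Lemma measurable_site_overlap N b k : measurable_fun setT (fun w =>
  gibbs_average b (Jat N w) (fun s : 'I_k -> config N => site_overlap s ^+ 2)).
Proof.
have -> : (fun w => gibbs_average b (Jat N w)
      (fun s : 'I_k -> config N => site_overlap s ^+ 2)) =
    (fun w => N%:R^-1 ^+ 2 * \sum_i \sum_j corr b (Jat N w) i j ^+ k).
  by apply/funext => w; rewrite gibbs_average_site_overlap.
apply: measurable_funM => //; apply: measurable_sum => i; apply: measurable_sum => j.
by apply: measurable_funX; exact: measurable_mean.
Qed.

Lemma integrable_site_overlap N b k : (0 < N)%N ->
  (P N).-integrable setT (EFin \o (fun w =>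
    gibbs_average b (Jat N w) (fun s : 'I_k -> config N => site_overlap s ^+ 2))).
Proof.
move=> N0; apply: (@bounded_integrable _ _ _ _ _ 1); first exact: measurable_site_overlap.
by move=> w; rewrite ger0_norm ?site_overlap_ge0 // site_overlap_le1.
Qed.

Definition site_sq N b k : R := \int[P N]_w
  gibbs_average b (Jat N w) (fun s : 'I_k -> config N => site_overlap s ^+ 2).

Lemma mean_site_overlapE N b k : (0 < N)%N ->
  mean_site_overlap_sq (@J N) b k = (site_sq N b k)%:E.
Proof. by move=> N0; rewrite /mean_site_overlap_sq expectationE // integrable_site_overlap. Qed.

Lemma site_sq_ge0 N b k : 0 <= site_sq N b k.
Proof. by apply: Rintegral_ge0 => w _; exact: site_overlap_ge0. Qed.

Lemma site_sq_le1 N b k : (0 < N)%N -> site_sq N b k <= 1.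
Proof.
move=> N0; rewrite -[leRHS](Rintegral_cstT (P N)); apply: ler_RintegralT.
- exact: integrable_site_overlap.
- exact: integrable_cstT.
- by move=> w; exact: site_overlap_le1.
Qed.

Lemma site_sq_le N b k : (0 < N)%N -> (0 < k)%N ->
  site_sq N b (2 * k) <= N%:R^-1 ^+ 2 * (N%:R + 2 * edge_sum N b).
Proof.
move=> N0 k0.
have ie e := integrable_sqr_edge (@J N) b e.
have iS := integrable_sum_real (index_enum (bond N)) predT ie.
have i1 := integrableD_real (integrable_cstT (P N) N%:R) (integrableZl_real 2 iS).
have i2 := integrableZl_real (N%:R^-1 ^+ 2) i1.
have -> : N%:R^-1 ^+ 2 * (N%:R + 2 * edge_sum N b) = \int[P N]_w
    (N%:R^-1 ^+ 2 * (N%:R + 2 * \sum_e edge_mean b (Jat N w) e ^+ 2)).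
  rewrite (RintegralZl _ _ i1) //; congr (_ * _).
  rewrite RintegralD //; [|exact: integrable_cstT|exact: integrableZl_real].
  by rewrite Rintegral_cstT (RintegralZl _ _ iS) // Rintegral_sum.
apply: ler_RintegralT => //; first exact: integrable_site_overlap.
by move=> w; rewrite -sum_sqr_corr; exact: site_overlap_le.
Qed.

Lemma site_overlap_subcritical (b : R) k : (0 < k)%N -> 0 < b < beta_critical alpha ->
  mean_site_overlap_sq (@J N) b (2 * k) @[N --> \oo] --> 0%:E.
Proof.
move=> k0 bc.
have H : site_sq N b (2 * k) @[N --> \oo] --> (0 : R).
  apply/cvgrPdist_le => e e0; have e4 : 0 < e / 4 by rewrite divr_gt0.
  near=> N.
  have N0 : (0 < N)%N by near: N; exact: nbhs_infty_gt.
  have NR : 0 < N%:R :> R by rewrite ltr0n.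
  rewrite sub0r normrN ger0_norm ?site_sq_ge0 //.
  apply: le_trans (site_sq_le b N0 k0) _.
  have S : edge_sum N b <= e / 4 * N%:R ^+ 2 by near: N; exact: edge_sum_small.
  have Nb : 2 / e <= N%:R.
    apply: le_trans (ltW (archi_boundP _)) _; first by rewrite divr_ge0 // ltW.
    by rewrite ler_nat; near: N; exact: nbhs_infty_ge.
  rewrite exprVn ler_pdivrMl ?exprn_gt0 // [leRHS]mulrC.
  have : N%:R <= e / 2 * N%:R ^+ 2.
    move: Nb; rewrite ler_pdivrMr // => Nb.
    have := ler_wpM2l (ltW NR) Nb; rewrite expr2; lra.
  lra.
have : (site_sq N b (2 * k))%:E @[N --> \oo] --> 0%:E by apply: cvg_EFin => //; exact: nearW.
apply: cvg_trans; apply: near_eq_cvg; near=> N; apply/esym/mean_site_overlapE.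
by near: N; exact: nbhs_infty_gt.
Unshelve. all: by end_near. Qed.

Lemma norm_tanh_small (b e : R) : 0 < b -> 0 < e ->
  \forall N \near \oo, \int[mu N]_x `|tanh (b * x)| <= e.
Proof.
move=> b0 e0; have [C C0 H] := tsq_bounded halpha mu_tail mu_moments b0.
near=> N.
have NR : 0 < N%:R :> R by rewrite ltr0n; near: N; exact: nbhs_infty_gt.
have h : N%:R * tsq N b <= C by near: N.
have NC : 4 * C / e ^+ 2 <= N%:R.
  apply: le_trans (ltW (archi_boundP _)) _; first by rewrite divr_ge0 ?sqr_ge0 // mulr_ge0 // ltW.
  by rewrite ler_nat; near: N; exact: nbhs_infty_ge.
have i2 := integrableZl_real (e^-1) (integrable_sqr_tanh (mu N) b).
have i1 := integrable_cstT (mu N) (e / 4).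
have it : (mu N).-integrable setT (EFin \o (fun x => `|tanh (b * x)|)).
  exact/integrable_norm/integrable_tanh.
have key x : `|tanh (b * x)| <= e / 4 + e^-1 * tanh (b * x) ^+ 2.
  rewrite -(real_normK (num_real (tanh _))); set t := `|_|.
  rewrite -(ler_pM2l e0) mulrDr mulVKf ?gt_eqF //.
  by have := sqr_ge0 (t - e / 2); rewrite !expr2; lra.
apply: le_trans (ler_RintegralT it (integrableD_real i1 i2) key) _.
rewrite RintegralD // Rintegral_cstT RintegralZl //; last exact: integrable_sqr_tanh.
suff : e^-1 * tsq N b <= e / 4 by lra.
rewrite ler_pdivrMl // -(ler_pM2l NR); apply: le_trans h _.
by move: NC; rewrite ler_pdivrMr ?exprn_gt0 // expr2; lra.
Unshelve. all: by end_near. Qed.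

Lemma site_sq_ge (b : R) N k : (0 < N)%N ->
  1 - 2 * k%:R * (N%:R^-1 ^+ 2 * \sum_e \int[P N]_w (1 - edge_mean b (Jat N w) e ^+ 2)) <=
  site_sq N b (2 * k).
Proof.
move=> N0.
have ie e := one_sub_sqr_integrable (integrable_sqr_edge (@J N) b e).
have iS := integrable_sum_real (index_enum (bond N)) predT ie.
have iZ := integrableZl_real (2 * k%:R * N%:R^-1 ^+ 2) iS.
have i1 := integrableB_real (integrable_cstT (P N) 1) iZ.
have -> : 1 - 2 * k%:R * (N%:R^-1 ^+ 2 *
      \sum_e \int[P N]_w (1 - edge_mean b (Jat N w) e ^+ 2)) =
    \int[P N]_w (1 - 2 * k%:R * N%:R^-1 ^+ 2 *
      \sum_e (1 - edge_mean b (Jat N w) e ^+ 2)).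
  rewrite RintegralB //; last exact: integrable_cstT.
  by rewrite Rintegral_cstT (RintegralZl _ _ iS) // Rintegral_sum // mulrA.
apply: ler_RintegralT => //; first exact: integrable_site_overlap.
move=> w; apply: le_trans (site_overlap_ge _ _ k N0).
rewrite sum_pairs_bond; last by move=> i j; rewrite corr_sym.
have diag : \sum_i (1 - corr b (Jat N w) i i ^+ 2) = 0.
  by apply: big1 => i _; rewrite corr_diag expr1n subrr.
rewrite diag add0r le_eqVlt; apply/orP; left; apply/eqP.
congr (_ - _); rewrite /edge_mean; under [in RHS]eq_bigr do rewrite corr_bond.
by ring.
Qed.

(** Low temperature: the energy per spin stays bounded in [b], while the couplings
    alone would provide [N * E [J * tanh (b * J)]], which diverges with [b]. *)
Lemma site_sq_low_temperature k : exists2 C : R, 0 < C & forall b : R, 0 < b ->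
  \forall N \near \oo, 1 - C * b `^ (- (alpha - 1)) <= site_sq N b (2 * k).
Proof.
have [C2 C20 H2] := lcosh_le mu_int mu_moments.
have t1 : 0 < tanh (1 : R) by rewrite -tanh0 tanh_lt.
have ln20 : 0 <= ln 2 :> R by rewrite ln_ge0 // ler1n.
pose C3 := 4 * (ln 2 + C2 / 2) / tanh 1.
have C30 : 0 < C3 by rewrite divr_gt0 // mulr_gt0 // ltr_wpDl // divr_gt0.
exists (2 * k%:R * C3 + 1); first by rewrite ltr_wpDl // mulr_ge0 ?(ltW C30) // mulr_ge0.
move=> b b0; have pb : 0 < b `^ (alpha - 1) by rewrite powR_gt0.
set g := b `^ (- (alpha - 1)); have g0 : 0 < g by rewrite powR_gt0.
pose e := g / (4 * (k%:R + 1)); have k1 : 0 < k%:R + 1 :> R by rewrite ltr_wpDl.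
have e0 : 0 < e by rewrite divr_gt0 // mulr_gt0.
have H21 : \forall N \near \oo, N%:R * lcosh N 1 <= C2.
  by have := H2 1 ltr01; rewrite powR1 mulr1.
near=> N.
have N0 : (0 < N)%N by near: N; exact: nbhs_infty_gt.
have NR : 0 < N%:R :> R by rewrite ltr0n.
have l_le : N%:R * lcosh N 1 <= C2 by near: N.
have x_ge : tanh 1 / 2 * b `^ (alpha - 1) <= N%:R * xtanh N b.
  by near: N; exact: (xtanh_ge halpha mu_int mu_tail b0).
have t_le : \int[mu N]_x `|tanh (b * x)| <= e by near: N; exact: norm_tanh_small.
have nb : #|bond N|%:R <= N%:R ^+ 2 / 2 :> R by exact: card_bond_le.
pose E := \sum_e \int[P N]_w (1 - edge_mean b (Jat N w) e ^+ 2).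
pose V := \sum_e \int[P N]_w (1 - cavity_mean b (Jat N w) e ^+ 2).
have HV : xtanh N b / 2 * V <= N%:R * ln 2 + #|bond N|%:R * lcosh N 1.
  have := sum_one_sub_sqr_cavity_le (indJ N0) (lawJ N0) (mu_sym N) (mu_int N) (ltW b0).
  by [].
have EV : E <= V + 4 * (#|bond N|%:R * \int[mu N]_x `|tanh (b * x)|).
  have := sum_one_sub_sqr_edge_le (lawJ N0) b.
  by [].
have V0 : 0 <= V.
  apply: sumr_ge0 => e' _; apply: Rintegral_ge0 => w _.
  by rewrite subr_ge0 sqr_le1_norm // norm_cavity_mean.
have lc0 : 0 <= lcosh N 1 by apply: Rintegral_ge0 => x _; exact: logcosh_ge0.
have nl : #|bond N|%:R * lcosh N 1 <= N%:R * (C2 / 2).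
  apply: le_trans (ler_wpM2r lc0 nb) _.
  have := ler_wpM2l (ltW NR) l_le; rewrite expr2; lra.
have gE : g = (b `^ (alpha - 1))^-1 by rewrite /g powRN.
have V_le : V <= N%:R ^+ 2 * (C3 * g).
  have h1 : xtanh N b / 2 * V <= N%:R * (ln 2 + C2 / 2) by lra.
  have h2 := ler_wpM2l (ltW NR) h1.
  have h3 := ler_wpM2r V0 x_ge.
  have cg : 0 < tanh 1 / 4 * b `^ (alpha - 1) by rewrite mulr_gt0 // divr_gt0.
  rewrite -(ler_pM2l cg); apply: (@le_trans _ _ (N%:R * (N%:R * (ln 2 + C2 / 2)))); first lra.
  rewrite le_eqVlt; apply/orP; left; apply/eqP.
  by rewrite gE /C3; field; rewrite !gt_eqF.
have nt : #|bond N|%:R * \int[mu N]_x `|tanh (b * x)| <= N%:R ^+ 2 / 2 * e.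
  by apply: ler_pM => //; apply: Rintegral_ge0 => x _; exact: normr_ge0.
apply: le_trans (site_sq_ge b k N0); rewrite -/E.
rewrite lerD2l lerN2.
have N2 : 0 < N%:R ^+ 2 :> R by rewrite exprn_gt0.
have E_le : N%:R^-1 ^+ 2 * E <= C3 * g + 2 * e.
  by rewrite exprVn ler_pdivrMl // mulrDr; lra.
have kk : 0 <= 2 * k%:R :> R by rewrite mulr_ge0.
apply: le_trans (ler_wpM2l kk E_le) _.
have -> : 2 * k%:R * (C3 * g + 2 * e) = 2 * k%:R * C3 * g + k%:R / (k%:R + 1) * g.
  by rewrite /e; field; rewrite gt_eqF.
rewrite [leRHS]mulrDl lerD2l ler_wpM2r ?(ltW g0) // ler_pdivrMr // mul1r; lra.
Unshelve. all: by end_near. Qed.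

Lemma limn_einf_ge (v : nat -> \bar R) (c : \bar R) :
  (\forall N \near \oo, (c <= v N)%E) -> (c <= limn_einf v)%E.
Proof.
move=> [n _ H]; rewrite limn_einf_lim.
apply: lime_ge; first exact: is_cvg_einfs.
near=> N; apply: le_ereal_inf_tmp => _ [m /= Nm <-]; apply: H => /=.
by apply: leq_trans Nm; near: N; exact: nbhs_infty_ge.
Unshelve. all: by end_near. Qed.

Lemma limn_einf_le (v : nat -> \bar R) (c : \bar R) :
  (\forall N \near \oo, (v N <= c)%E) -> (limn_einf v <= c)%E.
Proof.
move=> [n _ H]; rewrite limn_einf_lim.
apply: lime_le; first exact: is_cvg_einfs.
near=> N; apply: (@le_trans _ _ (v N)).
  by apply: ereal_inf_lbound; exists N => /=.
by apply: H => /=; near: N; exact: nbhs_infty_ge.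
Unshelve. all: by end_near. Qed.

Lemma site_overlap_low_temperature k :
  limn_einf (fun N : nat => mean_site_overlap_sq (@J N) b (2 * k)) @[b --> +oo] --> 1%E.
Proof.
have [C C0 H] := site_sq_low_temperature k.
have am : 0 < alpha - 1 by rewrite subr_gt0.
have lo : (1 - C * b `^ (- (alpha - 1)))%:E @[b --> +oo] --> 1%:E.
  apply: cvg_EFin; first exact: nearW.
  rewrite -[X in _ --> X]subr0 -(mulr0 C); apply: cvgB; first exact: cvg_cst.
  by apply: cvgM; [exact: cvg_cst|exact: powRN_cvg0].
apply: (squeeze_cvge _ lo (cvg_cst 1%E)).
near=> b; have b0 : 0 < b by near: b; exact: nbhs_pinfty_gt.
apply/andP; split.
  apply: limn_einf_ge; near=> N.
  rewrite mean_site_overlapE; last by near: N; exact: nbhs_infty_gt.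
  by rewrite lee_fin; near: N; exact: H.
apply: limn_einf_le; near=> N.
have N0 : (0 < N)%N by near: N; exact: nbhs_infty_gt.
by rewrite mean_site_overlapE // lee_fin site_sq_le1.
Unshelve. all: by end_near. Qed.

End SubcriticalDeficit.

(** * Two bonds at a time *)

Section DoubleCavity.
Context {R : realType} {N : nat}.
Implicit Types (beta : R) (J : bond N -> R) (e f : bond N).

Definition delete2 J e f := delete (delete J e) f.

Definition pair_mean beta J e f : R :=
  mean beta J (fun s => bond_spin s e * bond_spin s f).

(** What the rest of the system contributes to the moments of the two bonds. *)
Definition residual beta J e f : R :=
  `|edge_mean beta (delete2 J e f) e| + `|edge_mean beta (delete2 J e f) f| +
  `|pair_mean beta (delete2 J e f) e f|.

(** The two-replica mean of [(q e - c) * (q f - c)], where [q] is the product of the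
    bond spins of the two replicas. *)
Definition pair_deviation (c : R) beta J e f : R :=
  pair_mean beta J e f ^+ 2 - c * edge_mean beta J e ^+ 2 -
  c * edge_mean beta J f ^+ 2 + c ^+ 2.

Lemma norm_pair_mean beta J e f : `|pair_mean beta J e f| <= 1.
Proof. by apply: norm_mean_le => s; rewrite normrM !norm_bond_spin mulr1. Qed.

Lemma delete_ne J e f : e != f -> delete J e f = J f.
Proof. by rewrite /delete eq_sym => /negbTE ->. Qed.

Lemma mean_delete2 beta J e f (h : config N -> R) : e != f ->
  let B := mean beta (delete2 J e f) in
  let x := tanh (beta * J e) in let y := tanh (beta * J f) in
  let D := 1 + x * B (fun s => bond_spin s e) + y * B (fun s => bond_spin s f) +
    x * y * B (fun s => bond_spin s e * bond_spin s f) in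
  0 < D /\
  mean beta J h * D = B h + y * B (fun s => h s * bond_spin s f) +
    x * B (fun s => h s * bond_spin s e) +
    x * y * B (fun s => h s * bond_spin s e * bond_spin s f).
Proof.
move=> ef B x y D.
have A g : mean beta (delete J e) g =
    (B g + y * B (fun s => g s * bond_spin s f)) / (1 + y * B (fun s => bond_spin s f)).
  by rewrite (mean_delete beta (delete J e) f g) delete_ne.
have d1 : 0 < 1 + y * B (fun s => bond_spin s f) by exact/mul_tanh_lt1/norm_mean_bond.
have d2 : 0 < 1 + x * mean beta (delete J e) (fun s => bond_spin s e).
  exact/mul_tanh_lt1/norm_mean_bond.
have DE : D = (1 + y * B (fun s => bond_spin s f)) *
    (1 + x * mean beta (delete J e) (fun s => bond_spin s e)).
  by rewrite A /D; field; rewrite gt_eqF.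
split; first by rewrite DE mulr_gt0.
rewrite DE (mean_delete beta J e h) -/x mulrCA divfK ?gt_eqF //.
rewrite (A h) (A (fun s => h s * bond_spin s e)).
by field; rewrite gt_eqF.
Qed.

Lemma ratio_small (n D s r : R) : 0 < D -> 1 - s <= D -> `|n| <= s -> r * D = n ->
  `|r| <= 2 -> `|r| <= 4 * s.
Proof.
move=> D0 Ds ns rD r2; have [s2|s2] := lerP s (1 / 2); last lra.
have : `|r| * D <= s by rewrite -(gtr0_norm D0) -normrM rD.
have : `|r| / 2 <= `|r| * D by rewrite ler_wpM2l //; lra.
have := normr_ge0 r; lra.
Qed.

Lemma norm_one_sub_sqr (x z : R) : `|x| <= 1 -> `|(1 - x ^+ 2) * z| <= `|z|.
Proof.
move=> x1; have := sqr_le1_norm x1; have := sqr_ge0 x => x0 x2.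
by rewrite normrM ler_piMl // ger0_norm; lra.
Qed.

Lemma norm_mul_le1 (x z : R) : `|x| <= 1 -> `|x * z| <= `|z|.
Proof. by move=> x1; rewrite normrM ler_piMl. Qed.

(** Up to the residual moments, the two bonds are free spins in their own fields;
    when the denominator of the cavity formula is small the residual is not. *)
Lemma double_cavity_dist beta J e f : e != f ->
  [/\ `|edge_mean beta J e - tanh (beta * J e)| <= 4 * residual beta J e f,
      `|edge_mean beta J f - tanh (beta * J f)| <= 4 * residual beta J e f &
      `|pair_mean beta J e f - tanh (beta * J e) * tanh (beta * J f)| <=
        4 * residual beta J e f].
Proof.
move=> ef; have D0 := mean_delete2 beta J _ ef.
have [d0 He] := D0 (fun s => bond_spin s e).
have [_ Hf] := D0 (fun s => bond_spin s f).
have [_ Hp] := D0 (fun s => bond_spin s e * bond_spin s f).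
move: d0 He Hf Hp {D0}.
rewrite /residual /edge_mean /pair_mean; set B := delete2 J e f.
have -> : mean beta B (fun s => bond_spin s e * bond_spin s e) = 1.
  by rewrite -(mean_cst beta B 1); apply: eq_mean => s; rewrite -expr2 sqr_bond_spin.
have -> : mean beta B (fun s => bond_spin s f * bond_spin s f) = 1.
  by rewrite -(mean_cst beta B 1); apply: eq_mean => s; rewrite -expr2 sqr_bond_spin.
have -> : mean beta B (fun s => bond_spin s e * bond_spin s e * bond_spin s f) =
    mean beta B (fun s => bond_spin s f).
  by apply: eq_mean => s; rewrite -expr2 sqr_bond_spin mul1r.
have -> : mean beta B (fun s => bond_spin s f * bond_spin s e * bond_spin s f) =
    mean beta B (fun s => bond_spin s e).
  by apply: eq_mean => s; rewrite mulrAC -expr2 sqr_bond_spin mul1r.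
have -> : mean beta B (fun s => bond_spin s f * bond_spin s e) =
    mean beta B (fun s => bond_spin s e * bond_spin s f).
  by apply: eq_mean => s; rewrite mulrC.
have -> : mean beta B (fun s => bond_spin s e * bond_spin s f * bond_spin s f) =
    mean beta B (fun s => bond_spin s e).
  by apply: eq_mean => s; rewrite -mulrA -expr2 sqr_bond_spin mulr1.
have -> : mean beta B (fun s => bond_spin s e * bond_spin s f * bond_spin s e) =
    mean beta B (fun s => bond_spin s f).
  by apply: eq_mean => s; rewrite mulrAC -expr2 sqr_bond_spin mul1r.
have -> : mean beta B (fun s => bond_spin s e * bond_spin s f * bond_spin s e * bond_spin s f)
    = 1.
  rewrite -(mean_cst beta B 1); apply: eq_mean => s.
  by rewrite -mulrA -expr2 exprMn !sqr_bond_spin mulr1.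
have := norm_mean_bond beta J e; have := norm_mean_bond beta J f.
have : `|mean beta J (fun s => bond_spin s e * bond_spin s f)| <= 1 := norm_pair_mean _ _ _ _.
have := ltW (norm_tanh_lt1 (beta * J e)); have := ltW (norm_tanh_lt1 (beta * J f)).
move: (mean beta B _) (mean beta B _) (mean beta B _) => a b p.
move: (mean beta J _) (mean beta J _) (mean beta J _) => u v z.
move: (tanh _) (tanh _) => x y y1 x1.
move=> z1 v1 u1 D0 He Hf Hp.
set s := `|p| + `|b| + `|a|; set D := 1 + _ + _ + _ in D0 He Hf Hp.
have xy1 : `|x * y| <= 1 by rewrite normrM mulr_ile1.
have Ds : 1 - s <= D.
  have lo (k r : R) : `|k| <= 1 -> - `|r| <= k * r.
    by move=> k1; have := norm_mul_le1 r k1; rewrite ler_norml => /andP[].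
  have := lo x p x1; have := lo y b y1; have := lo (x * y) a xy1.
  by rewrite /D /s; lra.
have d2 (k r : R) : `|k| <= 1 -> `|r| <= 1 -> `|k - r| <= 2.
  by move=> k1 r1; apply: le_trans (ler_normB _ _) _; lra.
split.
- apply: (@ratio_small ((1 - x ^+ 2) * (p + y * a)) D) => //; last exact: d2.
  + apply: le_trans (norm_one_sub_sqr _ x1) _; apply: le_trans (ler_normD _ _) _.
    by have := norm_mul_le1 a y1; have := normr_ge0 b; rewrite /s; lra.
  + by rewrite mulrBl He /D; ring.
- apply: (@ratio_small ((1 - y ^+ 2) * (b + x * a)) D) => //; last exact: d2.
  + apply: le_trans (norm_one_sub_sqr _ y1) _; apply: le_trans (ler_normD _ _) _.
    by have := norm_mul_le1 a x1; have := normr_ge0 p; rewrite /s; lra.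
  + by rewrite mulrBl Hf /D; ring.
- apply: (@ratio_small ((1 - (x * y) ^+ 2) * a + (1 - x ^+ 2) * (y * p) +
    (1 - y ^+ 2) * (x * b)) D) => //; last exact: d2.
  + apply: le_trans (ler_normD _ _) _; apply: le_trans (lerD (ler_normD _ _) (lexx _)) _.
    have := norm_one_sub_sqr a xy1; have := norm_one_sub_sqr (y * p) x1.
    have := norm_one_sub_sqr (x * b) y1.
    by have := norm_mul_le1 p y1; have := norm_mul_le1 b x1; rewrite /s; lra.
  + by rewrite mulrBl Hp /D; ring.
Qed.

Lemma dist_sqr_le (u x r : R) : `|u| <= 1 -> `|x| <= 1 -> `|u - x| <= r ->
  `|u ^+ 2 - x ^+ 2| <= 2 * r.
Proof.
move=> u1 x1 uxr; rewrite subr_sqr normrM [2 * r]mulrC ler_pM //.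
by apply: le_trans (ler_normD _ _) _; lra.
Qed.

Lemma pair_deviation_dist c beta J e f : e != f ->
  `|pair_deviation c beta J e f -
    (tanh (beta * J e) ^+ 2 - c) * (tanh (beta * J f) ^+ 2 - c)| <=
  8 * (1 + 2 * `|c|) * residual beta J e f.
Proof.
move=> ef; have [He Hf Hp] := double_cavity_dist beta J ef.
set r := residual _ _ _ _ in He Hf Hp *.
have x1 := ltW (norm_tanh_lt1 (beta * J e)); have y1 := ltW (norm_tanh_lt1 (beta * J f)).
have xy1 : `|tanh (beta * J e) * tanh (beta * J f)| <= 1 by rewrite normrM mulr_ile1.
have := dist_sqr_le (norm_edge_mean _ _ _) x1 He.
have := dist_sqr_le (norm_edge_mean _ _ _) y1 Hf.
have := dist_sqr_le (norm_pair_mean _ _ _ _) xy1 Hp.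
rewrite /pair_deviation.
move: (edge_mean beta J e) (edge_mean beta J f) (pair_mean beta J e f) => u v z.
move: (tanh (beta * J e)) (tanh (beta * J f)) => x y hz hv hu.
have -> : z ^+ 2 - c * u ^+ 2 - c * v ^+ 2 + c ^+ 2 - (x ^+ 2 - c) * (y ^+ 2 - c) =
  (z ^+ 2 - (x * y) ^+ 2) - c * (u ^+ 2 - x ^+ 2) - c * (v ^+ 2 - y ^+ 2) by ring.
apply: le_trans (ler_normB _ _) _; apply: le_trans (lerD (ler_normB _ _) (lexx _)) _.
rewrite !normrM.
have := ler_wpM2l (normr_ge0 c) hu; have := ler_wpM2l (normr_ge0 c) hv; lra.
Qed.

Lemma norm_pair_deviation c beta J e f : `|pair_deviation c beta J e f| <= (1 + `|c|) ^+ 2.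
Proof.
have := sqr_le1_norm (norm_edge_mean beta J e); have := sqr_ge0 (edge_mean beta J e).
have := sqr_le1_norm (norm_edge_mean beta J f); have := sqr_ge0 (edge_mean beta J f).
have := sqr_le1_norm (norm_pair_mean beta J e f); have := sqr_ge0 (pair_mean beta J e f).
rewrite /pair_deviation.
move: (pair_mean _ _ _ _ ^+ 2) (edge_mean beta J e ^+ 2) (edge_mean beta J f ^+ 2).
move=> z u v z0 z1 v0 v1 u0 u1.
apply: le_trans (ler_normD _ _) _; apply: le_trans (lerD (ler_normB _ _) (lexx _)) _.
apply: le_trans (lerD (lerD (ler_normB _ _) (lexx _)) (lexx _)) _.
rewrite normrX (normrM c u) (normrM c v) (ger0_norm z0) (ger0_norm v0) (ger0_norm u0).
rewrite sqrrD expr1n mul1r.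
have := ler_wpM2l (normr_ge0 c) u1; have := ler_wpM2l (normr_ge0 c) v1.
by rewrite mulr1 mulr2n; lra.
Qed.

Lemma residual_ge0 beta J e f : 0 <= residual beta J e f.
Proof. by rewrite !addr_ge0. Qed.

Lemma norm_residual beta J e f : `|residual beta J e f| <= 3.
Proof.
rewrite ger0_norm ?residual_ge0 // /residual.
have := norm_edge_mean beta (delete2 J e f) e; have := norm_edge_mean beta (delete2 J e f) f.
by have := norm_pair_mean beta (delete2 J e f) e f; lra.
Qed.

Lemma sqr_mean_delete2_le beta J e f (h : config N -> R) : e != f ->
  (forall s, `|h s| <= 1) ->
  mean beta (delete2 J e f) h ^+ 2 <= 4 * mean beta J h ^+ 2 +
    16 * tanh (beta * J e) ^+ 2 + 8 * tanh (beta * J f) ^+ 2.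
Proof.
move=> ef h1.
have := sqr_le_dist (mean_delete_dist beta J e h1).
have := sqr_le_dist (mean_delete_dist beta (delete J e) f h1).
rewrite delete_ne // !real_normK ?num_real //; lra.
Qed.

Lemma norm_le_sqr (m del : R) : 0 < del -> `|m| <= del + m ^+ 2 / del.
Proof.
move=> d0; rewrite -(ler_pM2l d0) mulrDr mulrCA divff ?gt_eqF // mulr1.
rewrite -(real_normK (num_real m)); have := normr_ge0 m.
by have := sqr_ge0 (`|m| - del); rewrite !expr2; nra.
Qed.

(** Restoring the two bonds changes bounded means by at most twice their [tanh], so
    the residual inherits its smallness from the full system. *)
Lemma residual_le beta J e f (del : R) : e != f -> 0 < del ->
  residual beta J e f <= 3 * del +
    (4 * (edge_mean beta J e ^+ 2 + edge_mean beta J f ^+ 2 + pair_mean beta J e f ^+ 2) +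
     48 * tanh (beta * J e) ^+ 2 + 24 * tanh (beta * J f) ^+ 2) / del.
Proof.
move=> ef d0; rewrite /residual.
have b1 (g : bond N) (s : config N) : `|bond_spin s g : R| <= 1 by rewrite norm_bond_spin.
have b2 s : `|bond_spin s e * bond_spin s f : R| <= 1.
  by rewrite normrM !norm_bond_spin mulr1.
have h1 := sqr_mean_delete2_le beta J ef (b1 e).
have h2 := sqr_mean_delete2_le beta J ef (b1 f).
have h3 := sqr_mean_delete2_le beta J ef b2.
have k1 := norm_le_sqr (edge_mean beta (delete2 J e f) e) d0.
have k2 := norm_le_sqr (edge_mean beta (delete2 J e f) f) d0.
have k3 := norm_le_sqr (pair_mean beta (delete2 J e f) e f) d0.
move: h1 h2 h3 k1 k2 k3; rewrite /edge_mean /pair_mean.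
move: (tanh (beta * J e) ^+ 2) (tanh (beta * J f) ^+ 2) => x y.
move: (mean beta (delete2 _ _ _) _) (mean beta (delete2 _ _ _) _) => a b.
move: (mean beta (delete2 _ _ _) _) (mean beta J _ ^+ 2) (mean beta J _ ^+ 2) => p u v.
move: (mean beta J _ ^+ 2) => z h1 h2 h3 k1 k2 k3.
have : (a ^+ 2 + b ^+ 2 + p ^+ 2) / del <=
    (4 * (u + v + z) + 48 * x + 24 * y) / del.
  by rewrite ler_wpM2r ?invr_ge0 ?(ltW d0) //; lra.
by rewrite 2!mulrDl => h; lra.
Qed.

End DoubleCavity.

(** * Bond overlap at finite volume *)

Section BondOverlap.
Context {R : realType} {N : nat}.
Implicit Types (beta K c : R) (J : bond N -> R).

Definition heavy K (x : R) : R := (K <= `|x|)%R%:R.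

Lemma heavy01 K x : 0 <= heavy K x <= 1.
Proof. by rewrite /heavy ler0n lern1 leq_b1. Qed.

Lemma norm_heavy K x : `|heavy K x| <= 1.
Proof. by have /andP[h0 h1] := heavy01 K x; rewrite ger0_norm. Qed.

Lemma sqr_heavy K x : heavy K x * heavy K x = heavy K x.
Proof. by rewrite /heavy; case: (_ <= _); rewrite ?mulr1 ?mulr0. Qed.

Lemma sum_heavy_ge0 K J : 0 <= \sum_e heavy K (J e).
Proof. by apply: sumr_ge0 => e _; case/andP: (heavy01 K (J e)). Qed.

Lemma norm_sum_heavy_le K J s1 s2 :
  `|\sum_e heavy K (J e) * (bond_spin s1 e * bond_spin s2 e)| <= \sum_e heavy K (J e).
Proof.
apply: le_trans (ler_norm_sum _ _ _) _; apply: ler_sum => e _.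
rewrite normrM (normrM (bond_spin _ _)) !norm_bond_spin !mulr1 ger0_norm //.
Qed.

Lemma bond_overlapE K J s1 s2 : bond_overlap K J s1 s2 =
  (\sum_e heavy K (J e))^-1 * \sum_e heavy K (J e) * (bond_spin s1 e * bond_spin s2 e).
Proof.
have M : \sum_e heavy K (J e) = #|[pred e : bond N | K <= `|J e|]|%:R.
  rewrite -sum1_card natr_sum [RHS]big_mkcond /=; apply: eq_bigr => e _.
  by rewrite inE /heavy; case: (_ <= _).
rewrite /bond_overlap M; case: eqP => [->|_]; first by rewrite invr0 mul0r.
congr (_ * _); rewrite big_mkcond /=; apply: eq_bigr => e _.
by rewrite /heavy; case: (_ <= _); rewrite ?mul1r ?mul0r.
Qed.

(** If the number [M] of heavy bonds is at least [m / 2], the quotient [S / M] is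
    controlled by its numerator; otherwise the deviation of [M] from [m] pays for
    the trivial bound. *)
Lemma bond_overlap_dev_le K c J s1 s2 (m : R) : 0 < m ->
  (bond_overlap K J s1 s2 - c) ^+ 2 <=
  4 / m ^+ 2 * ((\sum_e heavy K (J e) * (bond_spin s1 e * bond_spin s2 e - c)) ^+ 2 +
    (1 + `|c|) ^+ 2 * (\sum_e heavy K (J e) - m) ^+ 2).
Proof.
move=> m0; rewrite bond_overlapE.
have -> : \sum_e heavy K (J e) * (bond_spin s1 e * bond_spin s2 e - c) =
    \sum_e heavy K (J e) * (bond_spin s1 e * bond_spin s2 e) - c * \sum_e heavy K (J e).
  by rewrite mulr_sumr -sumrB; apply: eq_bigr => e _; ring.
have AM := norm_sum_heavy_le K J s1 s2; have M0 := sum_heavy_ge0 K J.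
move: (\sum_e heavy K (J e) * (bond_spin s1 e * bond_spin s2 e)) AM => A.
move: (\sum_e heavy K (J e)) M0 => M M0 AM.
have m2 : 0 < m ^+ 2 by rewrite exprn_gt0.
rewrite mulrAC ler_pdivlMr //.
have c0 := normr_ge0 c; have q0 := sqr_ge0 (A - c * M).
have r0 : 0 <= (1 + `|c|) ^+ 2 * (M - m) ^+ 2 by rewrite mulr_ge0 ?sqr_ge0.
have [Mm|Mm] := lerP (m / 2) M.
  have M1 : 0 < M by lra.
  have -> : M^-1 * A - c = (A - c * M) / M by field; rewrite gt_eqF.
  rewrite exprMn exprVn mulrAC ler_pdivrMr ?exprn_gt0 //.
  have m4 : m ^+ 2 <= 4 * M ^+ 2.
    have -> : 4 * M ^+ 2 = (2 * M) ^+ 2 by ring.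
    by rewrite lerXn2r ?nnegrE //; lra.
  apply: le_trans (ler_wpM2l q0 m4) _.
  rewrite [leLHS](_ : _ = 4 * (A - c * M) ^+ 2 * M ^+ 2); last ring.
  by rewrite ler_wpM2r ?sqr_ge0 //; lra.
have Q1 : (M^-1 * A - c) ^+ 2 <= (1 + `|c|) ^+ 2.
  rewrite -(real_normK (num_real (_ - _))) lerXn2r ?nnegrE ?addr_ge0 //.
  apply: le_trans (ler_normB _ _) _; rewrite lerD2r normrM normfV (ger0_norm M0).
  have [M1|M1] := eqVneq M 0; first by rewrite M1 invr0 mul0r.
  by rewrite ler_pdivrMl ?lt0r ?M1 // mulr1.
have m4 : m ^+ 2 <= 4 * (M - m) ^+ 2.
  have -> : 4 * (M - m) ^+ 2 = (2 * (m - M)) ^+ 2 by ring.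
  by rewrite lerXn2r ?nnegrE //; lra.
apply: (@le_trans _ _ ((1 + `|c|) ^+ 2 * (4 * (M - m) ^+ 2))); last first.
  by rewrite mulrCA mulrDr; lra.
by apply: ler_pM => //; rewrite sqr_ge0.
Qed.

Lemma gibbs_average_deviation beta J c (g : bond N -> R) :
  gibbs_average beta J (fun s : 'I_2 -> config N =>
    (\sum_e g e * (bond_spin (s ord0) e * bond_spin (s ord_max) e - c)) ^+ 2) =
  \sum_e \sum_f g e * g f * pair_deviation c beta J e f.
Proof.
under eq_gibbs_average => s do rewrite expr2 big_distrlr /=.
rewrite gibbs_average_sum; apply: eq_bigr => e _.
rewrite gibbs_average_sum; apply: eq_bigr => f _.
pose y (s : 'I_2 -> config N) e : R := bond_spin (s ord0) e * bond_spin (s ord_max) e.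
pose z (s : 'I_2 -> config N) : R := bond_spin (s ord0) e * bond_spin (s ord0) f *
  (bond_spin (s ord_max) e * bond_spin (s ord_max) f).
have E s : g e * (bond_spin (s ord0) e * bond_spin (s ord_max) e - c) *
      (g f * (bond_spin (s ord0) f * bond_spin (s ord_max) f - c)) =
    g e * g f * (z s + (- c * y s e + (- c * y s f + c ^+ 2))).
  by rewrite /z /y; ring.
under eq_gibbs_average => s do rewrite E.
rewrite !gibbs_averageZl; congr (_ * _).
rewrite !gibbs_averageD !gibbs_averageZl !gibbs_average_cst.
rewrite (gibbs_average_prod2 _ _ (fun s => bond_spin s e * bond_spin s f)).
rewrite (gibbs_average_prod2 _ _ (fun s => bond_spin s e)).
rewrite (gibbs_average_prod2 _ _ (fun s => bond_spin s f)).
by rewrite /pair_deviation /pair_mean /edge_mean; ring.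
Qed.

Lemma gibbs_average_bond_overlap_le beta K c J (m : R) : 0 < m ->
  gibbs_average beta J (fun s : 'I_2 -> config N =>
    (bond_overlap K J (s ord0) (s ord_max) - c) ^+ 2) <=
  4 / m ^+ 2 * (\sum_e \sum_f heavy K (J e) * heavy K (J f) * pair_deviation c beta J e f +
    (1 + `|c|) ^+ 2 * (\sum_e heavy K (J e) - m) ^+ 2).
Proof.
move=> m0; rewrite -gibbs_average_deviation -[X in _ + X](gibbs_average_cst beta J 2).
rewrite -gibbs_averageD -gibbs_averageZl; apply: ler_gibbs_average => s.
exact: bond_overlap_dev_le.
Qed.

Lemma gibbs_average_bond_overlap_ge0 beta K c J :
  0 <= gibbs_average beta J (fun s : 'I_2 -> config N =>
    (bond_overlap K J (s ord0) (s ord_max) - c) ^+ 2).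
Proof.
rewrite -(gibbs_average_cst beta J 2 0); apply: ler_gibbs_average => s.
exact: sqr_ge0.
Qed.

Lemma norm_gibbs_average_bond_overlap beta K c J :
  `|gibbs_average beta J (fun s : 'I_2 -> config N =>
    (bond_overlap K J (s ord0) (s ord_max) - c) ^+ 2)| <= (1 + `|c|) ^+ 2.
Proof.
rewrite ger0_norm ?gibbs_average_bond_overlap_ge0 //.
rewrite -[leRHS](gibbs_average_cst beta J 2); apply: ler_gibbs_average => s.
rewrite -(real_normK (num_real (_ - _))) lerXn2r ?nnegrE ?addr_ge0 //.
apply: le_trans (ler_normB _ _) _; rewrite lerD2r bond_overlapE normrM normfV.
have M0 := sum_heavy_ge0 K J; rewrite (ger0_norm M0).
have [->|M1] := eqVneq (\sum_e heavy K (J e)) 0; first by rewrite invr0 mul0r.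
by rewrite ler_pdivrMl ?lt0r ?M1 // mulr1 norm_sum_heavy_le.
Qed.

End BondOverlap.

Lemma heavy_pair_arith (R : realType) (h k x y c l r q : R) :
  h * k * (q - (x - c) * (y - c)) <= h * k * (l * r) ->
  h * k * q <= h * (x - c) * (k * (y - c)) + l * (h * (k * r)).
Proof. lra. Qed.

Section BondDeviation.
Context {R : realType} {N : nat} {d} {T : measurableType d} (P : probability T R)
  (J : bond N -> {RV P >-> R}) (mu : probability R R).
Hypothesis indJ : mutually_independent J.
Hypothesis lawJ : forall e (A : set R), measurable A -> P (J e @^-1` A) = mu A.

Local Notation Jat w := (fun e => J e w).
Local Notation tsq b := (\int[mu]_x (tanh (b * x) ^+ 2)).

Lemma measurable_heavy K : measurable_fun setT (@heavy R K).
Proof.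
have -> : @heavy R K = (fun x => (- `|x| <= - K)%R%:R).
  by apply/funext => x; rewrite /heavy lerN2.
have mN : measurable_fun setT (fun x : R => - `|x|).
  by apply: measurableT_comp => //; exact: normr_measurable.
exact: (measurable_le_indicator (- K) mN).
Qed.

Definition heavy_mass K : R := \int[mu]_x heavy K x.

Definition heavy_deviation b K c : R := \int[mu]_x (heavy K x * (tanh (b * x) ^+ 2 - c)).

Lemma integrable_bounded_law (g : R -> R) (C : R) : measurable_fun setT g ->
  (forall x, `|g x| <= C) -> mu.-integrable setT (EFin \o g).
Proof. exact: bounded_integrable. Qed.

Lemma integrable_heavy K : mu.-integrable setT (EFin \o heavy K).
Proof. exact: integrable_bounded_law (measurable_heavy K) (norm_heavy K). Qed.

Lemma heavy_mass_ge0 K : 0 <= heavy_mass K.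
Proof. by apply: Rintegral_ge0 => x _; case/andP: (heavy01 K x). Qed.

(** The coupling on [f] is first split off, then the one on [e], since [h (J f) * F]
    ignores [e]. *)
Lemma Rintegral_two_bonds e f (g h : R -> R) (F : T -> R) (C : R) : e != f ->
  measurable_fun setT g -> measurable_fun setT h ->
  (forall x, `|g x| <= C) -> (forall x, `|h x| <= C) -> (forall w, `|F w| <= C) ->
  measurable_without J e F -> measurable_without J f F ->
  P.-integrable setT (EFin \o (fun w => g (J e w) * (h (J f w) * F w))) /\
  \int[P]_w (g (J e w) * (h (J f w) * F w)) =
  \int[mu]_x g x * (\int[mu]_x h x * \int[P]_w F w).
Proof.
move=> ef mg mh gC hC FC Fe Ff.
have ig := integrable_bounded_law mg gC; have ih := integrable_bounded_law mh hC.
have iF : P.-integrable setT (EFin \o F).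
  exact: bounded_integrable (measurable_of_without Ff) FC.
have [i1 E1] := Rintegral_mul_without indJ (i := f) (g := h) (F := F) mh
  (integrable_coupling lawJ f ih) Ff iF.
have m1 : measurable_without J e (fun w => h (J f w) * F w).
  apply: measurable_funM => //; apply: measurableT_comp => //.
  by apply: measurable_without_coord; rewrite eq_sym.
have [i2 E2] := Rintegral_mul_without indJ (i := e) (g := g)
  (F := fun w => h (J f w) * F w) mg (integrable_coupling lawJ e ig) m1 i1.
split => //; rewrite E2 E1.
by rewrite (Rintegral_coupling lawJ e ig) (Rintegral_coupling lawJ f ih).
Qed.

Lemma measurable_without_mean_delete2 b e f i h : (i == e) || (i == f) ->
  measurable_without J i (fun w => mean b (delete2 (Jat w) e f) h).
Proof.
move=> ief.
apply: (@measurable_mean _ _ _ (g_sigma_algebraType (cylinders_without J i))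
  (fun b' w => delete2 (Jat w) e f b')) => b'.
rewrite /delete2 /delete; case: (eqVneq b' f) => [_|bf]; first exact: measurable_cst.
case: (eqVneq b' e) => [_|be]; first exact: measurable_cst.
apply: measurable_without_coord; apply/eqP => bi; move: ief.
by rewrite -bi (negbTE bf) (negbTE be).
Qed.

Lemma measurable_without_residual b e f i : (i == e) || (i == f) ->
  measurable_without J i (fun w => residual b (Jat w) e f).
Proof.
move=> ief; have H h := measurable_without_mean_delete2 b h ief.
by apply: measurable_funD; first apply: measurable_funD;
  apply: measurableT_comp => //; exact: H.
Qed.

Definition pair_sq b e f : R := \int[P]_w pair_mean b (Jat w) e f ^+ 2.
Definition edge_sq b e : R := \int[P]_w edge_mean b (Jat w) e ^+ 2.

Lemma integrable_sqr_pair b e f :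
  P.-integrable setT (EFin \o (fun w => pair_mean b (Jat w) e f ^+ 2)).
Proof.
apply: bounded_sqr_integrable => [|w]; first exact: measurable_mean.
exact: norm_pair_mean.
Qed.

Lemma Rintegral_residual_le b e f (del : R) : e != f -> 0 < del ->
  \int[P]_w residual b (Jat w) e f <= 3 * del +
    (4 * (edge_sq b e + edge_sq b f + pair_sq b e f) + 72 * tsq b) / del.
Proof.
move=> ef d0.
have ir : P.-integrable setT (EFin \o (fun w => residual b (Jat w) e f)).
  apply: (@bounded_integrable _ _ _ _ _ 3); last by move=> w; exact: norm_residual.
  by apply: (@measurable_of_without _ _ _ _ _ J e); apply: measurable_without_residual; rewrite eqxx.
have ie g := integrable_sqr_edge J b g.
have ip := integrable_sqr_pair b e f.
have it g := integrable_coupling lawJ g (integrable_sqr_tanh mu b).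
have i4 := integrableZl_real 4 (integrableD_real (integrableD_real (ie e) (ie f)) ip).
have i48 := integrableZl_real 48 (it e); have i24 := integrableZl_real 24 (it f).
have iB := integrableD_real (integrableD_real i4 i48) i24.
have iB' := integrableZl_real del^-1 iB.
have i3 := integrable_cstT P (3 * del).
apply: le_trans (ler_RintegralT ir (integrableD_real i3 iB') _) _.
  by move=> w; rewrite [del^-1 * _]mulrC; exact: residual_le.
rewrite RintegralD // Rintegral_cstT lerD2l (RintegralZl _ _ iB) // mulrC.
rewrite ler_wpM2r ?invr_ge0 ?(ltW d0) //.
rewrite (RintegralD _ (integrableD_real i4 i48) i24) // (RintegralD _ i4 i48) //.
rewrite (RintegralZl _ _ (integrableD_real (integrableD_real (ie e) (ie f)) ip)) //.
rewrite (RintegralD _ (integrableD_real (ie e) (ie f)) ip) // (RintegralD _ (ie e) (ie f)) //.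
rewrite (RintegralZl _ _ (it e)) // (RintegralZl _ _ (it f)) //.
rewrite !(Rintegral_coupling lawJ _ (integrable_sqr_tanh mu b)).
by rewrite /edge_sq /pair_sq; lra.
Qed.

Lemma measurable_pair_deviation b c e f :
  measurable_fun setT (fun w => pair_deviation c b (Jat w) e f).
Proof.
have me g : measurable_fun setT (fun w => c * edge_mean b (Jat w) g ^+ 2).
  by apply: measurable_funM => //; apply: measurable_funX; exact: measurable_edge_mean.
apply: measurable_funD => //; apply: measurable_funB => //; apply: measurable_funB => //.
by apply: measurable_funX; exact: measurable_mean.
Qed.

Lemma integrable_heavy_pair b K c e f : P.-integrable setT (EFin \o (fun w =>
  heavy K (J e w) * heavy K (J f w) * pair_deviation c b (Jat w) e f)).
Proof.
apply: (@bounded_integrable _ _ _ _ _ ((1 + `|c|) ^+ 2)).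
  have mh g : measurable_fun setT (fun w => heavy K (J g w)).
    by apply: measurableT_comp => //; exact: measurable_heavy.
  by apply: measurable_funM; [exact: measurable_funM|exact: measurable_pair_deviation].
move=> w; rewrite normrM -[leRHS]mul1r; apply: ler_pM => //.
  by rewrite normrM mulr_ile1 // norm_heavy.
exact: norm_pair_deviation.
Qed.

(** The main term factorizes over the two independent couplings, and the residual is
    independent of both, so that each error carries the square of the small
    probability of a heavy bond. *)
Lemma heavy_pair_le b K c e f (del : R) : 0 < del ->
  \int[P]_w (heavy K (J e w) * heavy K (J f w) * pair_deviation c b (Jat w) e f) <=
  heavy_deviation b K c ^+ 2 +
  8 * (1 + 2 * `|c|) * heavy_mass K ^+ 2 * (3 * del +
    (4 * (edge_sq b e + edge_sq b f + pair_sq b e f) + 72 * tsq b) / del) +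
  (e == f)%:R * ((1 + `|c|) ^+ 2 * heavy_mass K).
Proof.
move=> d0; set L := 8 * _; set B := 3 * del + _.
have L0 : 0 <= L by rewrite mulr_ge0 // addr_ge0 // mulr_ge0.
have p0 := heavy_mass_ge0 K.
have B0 : 0 <= B.
  have s0 g : 0 <= edge_sq b g by apply: Rintegral_ge0 => w _; exact: sqr_ge0.
  have q0 : 0 <= pair_sq b e f by apply: Rintegral_ge0 => w _; exact: sqr_ge0.
  have t0 : 0 <= tsq b by apply: Rintegral_ge0 => w _; exact: sqr_ge0.
  rewrite addr_ge0 ?mulr_ge0 ?invr_ge0 ?(ltW d0) //.
  by rewrite addr_ge0 // mulr_ge0 // !addr_ge0.
have i0 := integrable_heavy_pair b K c e f.
have [E|ef] := eqVneq e f.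
  rewrite mul1r; move: i0; rewrite -E => i0.
  have ih := integrable_coupling lawJ e (integrable_heavy K).
  have := ler_RintegralT i0 (integrableZl_real ((1 + `|c|) ^+ 2) ih).
  rewrite (RintegralZl _ _ ih) // (Rintegral_coupling lawJ e (integrable_heavy K)) => H.
  apply: le_trans (H _) _; last by rewrite lerDr addr_ge0 ?sqr_ge0 // !mulr_ge0 ?sqr_ge0.
  move=> w; rewrite sqr_heavy [leRHS]mulrC; have /andP[h0 _] := heavy01 K (J e w).
  rewrite ler_wpM2l //; apply: le_trans (ler_norm _) _; exact: norm_pair_deviation.
rewrite mul0r addr0.
pose g x := heavy K x * (tanh (b * x) ^+ 2 - c).
pose C := 3 + `|c|.
have mg : measurable_fun setT g.
  apply: measurable_funM; first exact: measurable_heavy.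
  by apply: measurable_funB => //; apply: measurable_funX; exact: measurable_tanhM.
have gC x : `|g x| <= C.
  rewrite normrM; apply: le_trans (ler_piMl _ (norm_heavy _ _)) _ => //.
  apply: le_trans (ler_normB _ _) _; rewrite ger0_norm ?sqr_ge0 //.
  by have := sqr_tanh_le1 (b * x); rewrite /C; lra.
have hC x : `|heavy K x| <= C.
  by apply: le_trans (norm_heavy _ _) _; rewrite /C; have := normr_ge0 c; lra.
have m1 i : measurable_without J i (fun=> 1 : R) by exact: measurable_cst.
have C1 (w : T) : `|1 : R| <= C by rewrite normr1 /C; have := normr_ge0 c; lra.
have [ig Eg] := Rintegral_two_bonds ef mg mg gC gC C1 (m1 e) (m1 f).
have rC w : `|residual b (Jat w) e f| <= C.
  by apply: le_trans (norm_residual _ _ _ _) _; rewrite /C lerDl.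
have me : measurable_without J e (fun w => residual b (Jat w) e f).
  by apply: measurable_without_residual; rewrite eqxx.
have mf : measurable_without J f (fun w => residual b (Jat w) e f).
  by apply: measurable_without_residual; rewrite eqxx orbT.
have mh := measurable_heavy K.
have [ir Er] := Rintegral_two_bonds ef mh mh hC hC rC me mf.
apply: le_trans (ler_RintegralT i0 (integrableD_real ig (integrableZl_real L ir)) _) _.
  move=> w; rewrite mulr1 /g.
  have := pair_deviation_dist c b (Jat w) ef; rewrite ler_norml => /andP[_ H].
  have /andP[h0 _] := heavy01 K (J e w); have /andP[k0 _] := heavy01 K (J f w).
  by apply: heavy_pair_arith; have := ler_wpM2l (mulr_ge0 h0 k0) H.
rewrite RintegralD //; last exact: integrableZl_real.
rewrite (RintegralZl _ _ ir) // Eg Er Rintegral_cstT mulr1.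
rewrite -/(heavy_mass K) -/(heavy_deviation b K c) -expr2 lerD2l.
rewrite (mulrA (heavy_mass K)) -expr2 mulrA ler_wpM2l ?mulr_ge0 ?sqr_ge0 //.
exact: Rintegral_residual_le.
Qed.

End BondDeviation.

Section BondDeviationSum.
Context {R : realType} {N : nat} {d} {T : measurableType d} (P : probability T R)
  (J : bond N -> {RV P >-> R}) (mu : probability R R).
Hypothesis indJ : mutually_independent J.
Hypothesis lawJ : forall e (A : set R), measurable A -> P (J e @^-1` A) = mu A.

Local Notation Jat w := (fun e => J e w).
Local Notation tsq b := (\int[mu]_x (tanh (b * x) ^+ 2)).
Local Notation n := (#|bond N|%:R : R).
Local Notation edge_total b := (\sum_e edge_sq J b e).

Lemma sum_pair_sq_le b :
  \sum_e \sum_f pair_sq J b e f <= N%:R ^+ 2 / 2 * (N%:R + edge_total b).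
Proof.
have ip e f := integrable_sqr_pair J b e f.
have iF e := integrable_sum_real (index_enum (bond N)) predT (ip e).
have ie e := integrable_sqr_edge J b e.
have iS := integrable_sum_real (index_enum (bond N)) predT ie.
have iN := integrableD_real (integrable_cstT P N%:R) iS.
have -> : \sum_e \sum_f pair_sq J b e f =
    \int[P]_w \sum_e \sum_f pair_mean b (Jat w) e f ^+ 2.
  rewrite Rintegral_sum //; apply: eq_bigr => e _; by rewrite Rintegral_sum.
have -> : N%:R ^+ 2 / 2 * (N%:R + edge_total b) =
    \int[P]_w (N%:R ^+ 2 / 2 * (N%:R + \sum_e edge_mean b (Jat w) e ^+ 2)).
  rewrite (RintegralZl _ _ iN) // (RintegralD _ (integrable_cstT P N%:R) iS) //.
  by rewrite Rintegral_cstT Rintegral_sum.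
apply: ler_RintegralT => [||w]; [exact: integrable_sum_real|exact: integrableZl_real|].
apply: le_trans (sum_sqr_mean_bond_pairs b (Jat w)) _.
rewrite sum_sqr_corr /edge_mean.
by move: (\sum_e _) => S; rewrite le_eqVlt; apply/orP; left; apply/eqP; field.
Qed.

Lemma sum_heavy_pair_bound (A B V : R) (E : bond N -> R) (G : bond N -> bond N -> R) :
  \sum_e \sum_f (A + B * E e + B * E f + B * G e f + (e == f)%:R * V) =
  n ^+ 2 * A + 2 * (n * (B * \sum_e E e)) + B * \sum_e \sum_f G e f + n * V.
Proof.
have sumc (a : R) : \sum_(f : bond N) a = n * a by rewrite sumr_const mulr_natl.
have H e : \sum_f (A + B * E e + B * E f + B * G e f + (e == f)%:R * V) =
    n * A + n * (B * E e) + B * \sum_f E f + B * \sum_f G e f + V.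
  have He : \sum_(f : bond N) (e == f)%:R = 1 :> R.
    rewrite (bigD1 e) //= eqxx big1 ?addr0 // => f.
    by rewrite eq_sym => /negbTE ->.
  by rewrite !big_split /= !sumc -!mulr_sumr -mulr_suml He mul1r.
rewrite (eq_bigr _ (fun e _ => H e)) !big_split /= !sumc -!mulr_sumr.
by ring.
Qed.

(** The variance of a sum of independent indicators is at most its mean. *)
Lemma Rintegral_sqr_heavy_count K :
  P.-integrable setT (EFin \o (fun w => (\sum_e heavy K (J e w) - n * heavy_mass mu K) ^+ 2)) /\
  \int[P]_w (\sum_e heavy K (J e w) - n * heavy_mass mu K) ^+ 2 <= n * heavy_mass mu K.
Proof.
set p := heavy_mass mu K.
pose g x := heavy K x - p.
have p0 : 0 <= p by exact: heavy_mass_ge0.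
have mg : measurable_fun setT g by apply: measurable_funB => //; exact: measurable_heavy.
have gC x : `|g x| <= 1 + p.
  by apply: le_trans (ler_normB _ _) _; rewrite (ger0_norm p0) lerD2r norm_heavy.
have ih := integrable_heavy mu K.
have g0 : \int[mu]_x g x = 0.
  rewrite /g (RintegralB _ ih (integrable_cstT mu p)) //.
  by rewrite Rintegral_cstT subrr.
have i2 e f : P.-integrable setT (EFin \o (fun w => g (J e w) * g (J f w))).
  apply: (@bounded_integrable _ _ _ _ _ ((1 + p) * (1 + p))).
    by apply: measurable_funM; exact: measurableT_comp.
  by move=> w; rewrite normrM ler_pM.
have E w : (\sum_e heavy K (J e w) - n * p) ^+ 2 =
    \sum_e \sum_f g (J e w) * g (J f w).
  have -> : n * p = \sum_(e : bond N) p by rewrite sumr_const mulr_natl.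
  by rewrite -sumrB expr2 big_distrlr.
have -> : (fun w => (\sum_e heavy K (J e w) - n * p) ^+ 2) =
    (fun w => \sum_e \sum_f g (J e w) * g (J f w)) by apply/funext.
have iF e := integrable_sum_real (index_enum (bond N)) predT (i2 e).
split; first exact: integrable_sum_real.
rewrite Rintegral_sum //.
have -> : n * p = \sum_(e : bond N) p by rewrite sumr_const mulr_natl.
apply: ler_sum => e _; rewrite Rintegral_sum // (bigD1 e) //= big1 ?addr0; last first.
  move=> f fe; have ef : e != f by rewrite eq_sym.
  have m1 i : measurable_without J i (fun=> 1 : R) by exact: measurable_cst.
  have C1 (w : T) : `|1 : R| <= 1 + p by rewrite normr1 lerDl.
  have [_] := Rintegral_two_bonds indJ lawJ ef mg mg gC gC C1 (m1 e) (m1 f).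
  by under eq_Rintegral do rewrite mulr1; rewrite g0 mul0r.
have ig := integrable_coupling lawJ e ih.
have iZ := integrableZl_real (1 - 2 * p) ig.
have -> : \int[P]_w (g (J e w) * g (J e w)) =
    \int[P]_w ((1 - 2 * p) * heavy K (J e w) + p ^+ 2).
  apply: eq_Rintegral => w _; rewrite /g.
  have := sqr_heavy K (J e w); move: (heavy K _) => h hh.
  have -> : (h - p) * (h - p) = h * h - 2 * p * h + p ^+ 2 by ring.
  by rewrite hh; ring.
rewrite (RintegralD _ iZ (integrable_cstT P _)) // (RintegralZl _ _ ig) //.
rewrite (Rintegral_coupling lawJ e ih) Rintegral_cstT -/(heavy_mass mu K) -/p.
by have := sqr_ge0 p; rewrite expr2; lra.
Qed.

Definition bond_deviation b K c : R := \int[P]_w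
  gibbs_average b (Jat w) (fun s : 'I_2 -> config N =>
    (bond_overlap K (Jat w) (s ord0) (s ord_max) - c) ^+ 2).

Lemma measurable_bond_deviation b K c : measurable_fun setT (fun w =>
  gibbs_average b (Jat w) (fun s : 'I_2 -> config N =>
    (bond_overlap K (Jat w) (s ord0) (s ord_max) - c) ^+ 2)).
Proof.
have mh e : measurable_fun setT (fun w => heavy K (J e w)).
  by apply: measurableT_comp => //; exact: measurable_heavy.
have mM : measurable_fun setT (fun w => \sum_e heavy K (J e w)).
  by apply: measurable_sum => e; exact: mh.
apply: measurable_sum => s; apply: measurable_funM.
  apply: measurable_prod => l _.
  have -> : (fun w => gibbs b (Jat w) (s l)) =
      (fun w => mean b (Jat w) (fun s' => (s' == s l)%:R)).
    apply/funext => w; rewrite /mean (bigD1 (s l)) //= eqxx mulr1 big1 ?addr0 // => s'.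
    by move=> /negbTE ->; rewrite mulr0.
  exact: measurable_mean.
apply: measurable_funX; apply: measurable_funB => //.
under eq_fun do rewrite bond_overlapE.
apply: measurable_funM.
  have -> : (fun w => (\sum_e heavy K (J e w))^-1) =
      (fun w => (\sum_e heavy K (J e w)) `^ (-1)).
    by apply/funext => w; rewrite powR_inv1 // sum_heavy_ge0.
  exact: (measurableT_comp (@measurable_powR R (-1)) mM).
by apply: measurable_sum => e; exact: measurable_funM.
Qed.

Lemma integrable_bond_deviation b K c : P.-integrable setT (EFin \o (fun w =>
  gibbs_average b (Jat w) (fun s : 'I_2 -> config N =>
    (bond_overlap K (Jat w) (s ord0) (s ord_max) - c) ^+ 2))).
Proof.
apply: bounded_integrable (measurable_bond_deviation b K c) _ => w.
exact: norm_gibbs_average_bond_overlap.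
Qed.

Lemma bond_deviation_ge0 b K c : 0 <= bond_deviation b K c.
Proof. by apply: Rintegral_ge0 => w _; exact: gibbs_average_bond_overlap_ge0. Qed.

(** The three terms are the bias of a single heavy bond, the correlations between
    distinct heavy bonds, and the fluctuations of order one over their number. *)
Lemma bond_deviation_le b K c (del : R) : 0 < del -> 0 < n -> 0 < heavy_mass mu K ->
  bond_deviation b K c <=
  4 * (heavy_deviation mu b K c / heavy_mass mu K) ^+ 2 +
  32 * (1 + 2 * `|c|) * (3 * del +
    (8 * (edge_total b / n) + 4 * ((\sum_e \sum_f pair_sq J b e f) / n ^+ 2) +
     72 * tsq b) / del) +
  8 * ((1 + `|c|) ^+ 2 / (n * heavy_mass mu K)).
Proof.
move=> d0 n0 p0; set p := heavy_mass mu K in p0 *.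
set L := 8 * (1 + 2 * `|c|); set w0 := heavy_deviation mu b K c.
have m0 : 0 < n * p by rewrite mulr_gt0.
have ih e f := integrable_heavy_pair J b K c e f.
have iF e := integrable_sum_real (index_enum (bond N)) predT (ih e).
have iS := integrable_sum_real (index_enum (bond N)) predT iF.
have [iV HV] := Rintegral_sqr_heavy_count K; rewrite -/p in iV HV.
have iV' := integrableZl_real ((1 + `|c|) ^+ 2) iV.
have iR := integrableZl_real (4 / (n * p) ^+ 2) (integrableD_real iS iV').
have := ler_RintegralT (integrable_bond_deviation b K c) iR
  (fun w => gibbs_average_bond_overlap_le b K c (Jat w) m0).
rewrite -/(bond_deviation b K c) => /le_trans; apply.
rewrite (RintegralZl _ _ (integrableD_real iS iV')) // (RintegralD _ iS iV') //.
rewrite (RintegralZl _ _ iV) // Rintegral_sum //.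
under eq_bigr do rewrite Rintegral_sum //.
pose A := w0 ^+ 2 + L * p ^+ 2 * (3 * del + 72 * tsq b / del).
pose B := L * p ^+ 2 * (4 / del).
pose V := (1 + `|c|) ^+ 2 * p.
have HS : \sum_e \sum_f \int[P]_w
    (heavy K (J e w) * heavy K (J f w) * pair_deviation c b (Jat w) e f) <=
    \sum_e \sum_f (A + B * edge_sq J b e + B * edge_sq J b f + B * pair_sq J b e f +
      (e == f)%:R * V).
  apply: ler_sum => e _; apply: ler_sum => f _.
  apply: le_trans (heavy_pair_le indJ lawJ b K c e f d0) _.
  rewrite -/L -/p -/w0 /A /B /V lerD2r.
  by rewrite le_eqVlt; apply/orP; left; apply/eqP; field; rewrite gt_eqF.
rewrite sum_heavy_pair_bound in HS.
have c2 : 0 <= (1 + `|c|) ^+ 2 by exact: sqr_ge0.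
have m4 : 0 <= 4 / (n * p) ^+ 2 by rewrite divr_ge0 // sqr_ge0.
apply: le_trans (ler_wpM2l m4 (lerD HS (ler_wpM2l c2 HV))) _.
rewrite /A /B /V /L le_eqVlt; apply/orP; left; apply/eqP.
by field; rewrite !gt_eqF.
Qed.

End BondDeviationSum.

(** * The limit of the bond overlap *)

Section HeavyBondLaw.
Context {R : realType} (alpha : R) (mu : nat -> probability R R).
Hypothesis halpha : 1 < alpha < 2.
Hypothesis mu_tail : forall x : R, 0 < x ->
  N%:R * tail_mass (mu N) x @[N --> \oo] --> x `^ (- alpha).

Let a0 : 0 < alpha. Proof. by case/andP: halpha => a1 _; exact: lt_trans a1. Qed.

Let mnorm : measurable_fun setT (fun x : R => `|x|).
Proof. exact: normr_measurable. Qed.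

Lemma tail_mass_le_heavy N K : tail_mass (mu N) K <= heavy_mass (mu N) K.
Proof.
apply: ler_RintegralT; [exact: integrable_lt_indicator|exact: integrable_heavy|move=> x].
by rewrite /heavy; case: ltP => [/ltW ->//|]; rewrite ler0n.
Qed.

Lemma heavy_mass_le_tail N K K' : K' < K -> heavy_mass (mu N) K <= tail_mass (mu N) K'.
Proof.
move=> KK; apply: ler_RintegralT; [exact: integrable_heavy|exact: integrable_lt_indicator|].
move=> x; rewrite /heavy; case: (lerP K) => [Kx|_]; last by rewrite ler0n.
by rewrite (lt_le_trans KK Kx).
Qed.

(** The limiting tail is continuous, so that an atom of the laws at [K] has no weight in
    the limit. *)
Lemma heavy_mass_cvg K : 0 < K ->
  N%:R * heavy_mass (mu N) K @[N --> \oo] --> K `^ (- alpha).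
Proof.
move=> K0; apply/cvgrPdist_le => e e0.
have k0 : 0 < K `^ (- alpha) by rewrite powR_gt0.
(* the radius at which the limiting tail exceeds its value at [K] by [e / 2] *)
pose q := K `^ (- alpha) + e / 2; have q0 : 0 < q by rewrite addr_gt0 // divr_gt0.
pose K' := (q `^ alpha^-1)^-1.
have qa0 : 0 < q `^ alpha^-1 by rewrite powR_gt0.
have K'0 : 0 < K' by rewrite invr_gt0.
have K'E : K' `^ (- alpha) = q.
  rewrite /K' -powR_inv1 ?ltW // -powRrM mulN1r opprK -powRrM mulVf ?gt_eqF //.
  by rewrite powRr1 // ltW.
have K'K : K' < K.
  rewrite -[K]invrK ltf_pV2 ?posrE ?invr_gt0 //.
  have -> : K^-1 = (K `^ (- alpha)) `^ alpha^-1.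
    by rewrite -powRrM mulNr divff ?gt_eqF // powR_inv1 // ltW.
  rewrite gt0_ltr_powR ?invr_gt0 ?nnegrE ?(ltW k0) ?(ltW q0) //.
  by rewrite /q ltrDl divr_gt0.
have e2 : 0 < e / 2 by rewrite divr_gt0.
have /cvgrPdist_le/(_ _ e2) := mu_tail K'0; rewrite K'E.
apply: filter_app; have /cvgrPdist_le/(_ _ e2) := mu_tail K0.
apply: filterS => N; rewrite !ler_distl => /andP[h1 h2] /andP[h3 h4].
have N0 : 0 <= N%:R :> R by [].
have := ler_wpM2l N0 (tail_mass_le_heavy N K).
have := ler_wpM2l N0 (heavy_mass_le_tail N K'K).
move: h1 h2 h3 h4; rewrite /q.
move: (N%:R * _) (N%:R * _) (N%:R * _) => u v w *.
by apply/andP; split; lra.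
Qed.

Lemma heavy_deviation_dist N b K c :
  `|heavy_deviation (mu N) b K c - (heavy_tsq mu N b K - c * tail_mass (mu N) K)| <=
  (1 + `|c|) * (heavy_mass (mu N) K - tail_mass (mu N) K).
Proof.
have ih := integrable_heavy (mu N) K.
have iT := integrable_lt_indicator (mu N) K mnorm.
have mt : measurable_fun setT (fun x => tanh (b * x) ^+ 2 : R).
  by apply: measurable_funX; exact: measurable_tanhM.
have t1 x : `|tanh (b * x) ^+ 2 : R| <= 1 by rewrite ger0_norm ?sqr_ge0 // sqr_tanh_le1.
have it : (mu N).-integrable setT (EFin \o (fun x => tanh (b * x) ^+ 2 * (K < `|x|)%R%:R)).
  apply: (@bounded_integrable _ _ _ _ _ 1).
    by apply: measurable_funM => //; exact: measurable_lt_indicator.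
  by move=> x; rewrite normrM mulr_ile1 //; case: (_ < _); rewrite ?normr1 ?normr0.
have id : (mu N).-integrable setT (EFin \o (fun x => heavy K x * (tanh (b * x) ^+ 2 - c))).
  apply: (@bounded_integrable _ _ _ _ _ (1 + `|c|)).
    by apply: measurable_funM; [exact: measurable_heavy|exact: measurable_funB].
  move=> x; rewrite normrM; apply: le_trans (ler_piMl _ (norm_heavy _ _)) _ => //.
  by apply: le_trans (ler_normB _ _) _; rewrite lerD2r.
have icT := integrableZl_real c iT.
have iB := integrableB_real it icT.
have iD := integrableB_real ih iT.
have iL := integrableZl_real (1 + `|c|) iD.
have E1 : heavy_deviation (mu N) b K c - (heavy_tsq mu N b K - c * tail_mass (mu N) K) =
    \int[mu N]_x (heavy K x * (tanh (b * x) ^+ 2 - c) -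
      (tanh (b * x) ^+ 2 * (K < `|x|)%R%:R - c * (K < `|x|)%R%:R)).
  rewrite (RintegralB _ id iB) // (RintegralB _ it icT) //.
  by rewrite (RintegralZl _ _ iT).
have E2 : (1 + `|c|) * (heavy_mass (mu N) K - tail_mass (mu N) K) =
    \int[mu N]_x ((1 + `|c|) * (heavy K x - (K < `|x|)%R%:R)).
  by rewrite (RintegralZl _ _ iD) // (RintegralB _ ih iT).
have key x : `|heavy K x * (tanh (b * x) ^+ 2 - c) -
      (tanh (b * x) ^+ 2 * (K < `|x|)%R%:R - c * (K < `|x|)%R%:R)| <=
    (1 + `|c|) * (heavy K x - (K < `|x|)%R%:R).
  have -> : heavy K x * (tanh (b * x) ^+ 2 - c) -
      (tanh (b * x) ^+ 2 * (K < `|x|)%R%:R - c * (K < `|x|)%R%:R) =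
    (tanh (b * x) ^+ 2 - c) * (heavy K x - (K < `|x|)%R%:R) by ring.
  have h0 : 0 <= heavy K x - (K < `|x|)%R%:R.
    by rewrite subr_ge0 /heavy; case: ltP => [/ltW ->//|]; rewrite ler0n.
  rewrite normrM (ger0_norm h0) ler_wpM2r //.
  by apply: le_trans (ler_normB _ _) _; rewrite lerD2r.
rewrite E1 E2 ler_norml; apply/andP; split.
  rewrite -mulN1r -(RintegralZl _ _ iL) //; apply: ler_RintegralT.
  - exact: integrableZl_real.
  - exact: integrableB_real.
  - by move=> x; rewrite mulN1r; have := key x; rewrite ler_norml => /andP[].
apply: ler_RintegralT => //; first exact: integrableB_real.
by move=> x; have := key x; rewrite ler_norml => /andP[].
Qed.

(** The value [c] is the mean of [tanh ^+ 2] under the limit law of a heavy coupling. *)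
Lemma heavy_deviation_cvg b K : 0 < b -> 0 < K ->
  let c := heavy_integral alpha b K / K `^ (- alpha) in
  N%:R * heavy_deviation (mu N) b K c @[N --> \oo] --> 0.
Proof.
move=> b0 K0 c.
have k0 : 0 < K `^ (- alpha) by rewrite powR_gt0.
have h1 : N%:R * (heavy_tsq mu N b K - c * tail_mass (mu N) K) @[N --> \oo] --> 0.
  have -> : (fun N => N%:R * (heavy_tsq mu N b K - c * tail_mass (mu N) K)) =
      (fun N => N%:R * heavy_tsq mu N b K - c * (N%:R * tail_mass (mu N) K)).
    by apply/funext => N; rewrite mulrBr mulrCA.
  have -> : 0 = heavy_integral alpha b K - c * K `^ (- alpha) :> R.
    by rewrite /c divfK ?gt_eqF // subrr.
  apply: cvgB; first exact: (heavy_tsq_cvg halpha mu_tail b0 K0).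
  by apply: cvgM; [exact: cvg_cst|exact: mu_tail].
have h2 : N%:R * (heavy_mass (mu N) K - tail_mass (mu N) K) @[N --> \oo] --> 0.
  have -> : (fun N => N%:R * (heavy_mass (mu N) K - tail_mass (mu N) K)) =
      (fun N => N%:R * heavy_mass (mu N) K - N%:R * tail_mass (mu N) K).
    by apply/funext => N; rewrite mulrBr.
  rewrite -(subrr (K `^ (- alpha))); apply: cvgB; first exact: heavy_mass_cvg.
  exact: mu_tail.
have h3 : N%:R * (heavy_tsq mu N b K - c * tail_mass (mu N) K) +
    (1 + `|c|) * (N%:R * (heavy_mass (mu N) K - tail_mass (mu N) K)) @[N --> \oo] --> 0.
  rewrite -[X in _ --> X](addr0 0) -[X in _ --> _ + X](mulr0 (1 + `|c|)).
  by apply: cvgD => //; apply: cvgM => //; exact: cvg_cst.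
have h4 : N%:R * (heavy_tsq mu N b K - c * tail_mass (mu N) K) -
    (1 + `|c|) * (N%:R * (heavy_mass (mu N) K - tail_mass (mu N) K)) @[N --> \oo] --> 0.
  rewrite -[X in _ --> X](subr0 0) -[X in _ --> _ - X](mulr0 (1 + `|c|)).
  by apply: cvgB => //; apply: cvgM => //; exact: cvg_cst.
apply: (squeeze_cvgr _ h4 h3); apply: nearW => N.
have := heavy_deviation_dist N b K c; rewrite ler_distl => /andP[g1 g2].
have N0 : 0 <= N%:R :> R by [].
have := ler_wpM2l N0 g1; have := ler_wpM2l N0 g2.
move: (heavy_deviation _ _ _ _) (heavy_tsq _ _ _ _ - _) (heavy_mass _ _ - _) (1 + _).
by move=> u v w l G1 G2; apply/andP; split; lra.
Qed.

End HeavyBondLaw.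

Section BondOverlapLimit.
Context {R : realType} (alpha : R) (mu : nat -> probability R R)
  (d : nat -> measure_display) (T : forall N : nat, measurableType (d N))
  (P : forall N : nat, probability (T N) R)
  (J : forall N : nat, bond N -> {RV (P N) >-> R}).
Hypothesis halpha : 1 < alpha < 2.
Hypothesis indJ : forall N, (0 < N)%N -> mutually_independent (@J N).
Hypothesis lawJ : forall N, (0 < N)%N ->
  forall e (A : set R), measurable A -> P N (@J N e @^-1` A) = mu N A.
Hypothesis mu_sym : forall N (A : set R), measurable A -> mu N A = mu N (-%R @^-1` A).
Hypothesis mu_int : forall N, (mu N).-integrable setT (EFin \o (fun x : R => x)).
Hypothesis mu_tail : forall x : R, 0 < x ->
  N%:R * tail_mass (mu N) x @[N --> \oo] --> x `^ (- alpha).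
Hypothesis mu_moments : exists2 C : R, 0 < C & forall e : R, 0 < e ->
  \forall N \near \oo,
    N%:R * \int[mu N]_y small_sqr_fun e y <= C * (e ^+ 2 * e `^ (- alpha)) /\
    N%:R * \int[mu N]_y large_fun e y <= C * (e * e `^ (- alpha)).

Local Notation tsq N b := (\int[mu N]_x (tanh (b * x) ^+ 2)).
Local Notation n N := (#|bond N|%:R : R).
Local Notation edge_total N b := (\sum_e edge_sq (@J N) b e).
Local Notation pair_total N b := (\sum_e \sum_f pair_sq (@J N) b e f).

Lemma card_bond_ge N : (1 < N)%N -> N%:R ^+ 2 / 4 <= n N.
Proof.
move=> N2; have := @card_bond R N.
have : 2 * N%:R <= N%:R ^+ 2 :> R by rewrite expr2 ler_wpM2r // ler_nat.
lra.
Qed.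

Lemma nat_large (a : R) : 0 <= a -> \forall N \near \oo, a <= N%:R.
Proof.
move=> a0'; near=> N; apply: le_trans (ltW (archi_boundP a0')) _.
by rewrite ler_nat; near: N; exact: nbhs_infty_ge.
Unshelve. all: by end_near. Qed.

(** Here [x] is the number of sites and [m] the number of bonds; [E] and [G] are the sums
    of squared one-bond and two-bond means. *)
Lemma residual_small_arith (x m E G t e C : R) : 1 <= x -> 0 <= e -> 0 <= t ->
  x ^+ 2 / 4 <= m -> 0 <= E -> 0 <= G ->
  E <= e * x ^+ 2 -> G <= x ^+ 2 / 2 * (x + E) -> x * t <= C -> C <= e * x -> 1 <= e * x ->
  8 * (E / m) + 4 * (G / m ^+ 2) + 72 * t <= 200 * e.
Proof.
move=> x1 e0 t0 m4 E0 G0 Ee Ge tC Cx ex.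
have x0 : 0 < x by exact: lt_le_trans x1.
have x2 : 0 < x ^+ 2 by rewrite exprn_gt0.
have m0 : 0 < m by apply: lt_le_trans m4; rewrite divr_gt0.
have h1 : E / m <= 4 * e.
  rewrite ler_pdivrMr //; apply: le_trans Ee _.
  have := ler_wpM2l e0 m4; lra.
have h2 : G / m ^+ 2 <= 16 * e.
  rewrite ler_pdivrMr ?exprn_gt0 //; apply: le_trans Ge _.
  have m2 : (x ^+ 2 / 4) ^+ 2 <= m ^+ 2 by rewrite lerXn2r ?nnegrE // ltW // divr_gt0.
  have xe : x <= e * x ^+ 2 by rewrite expr2 mulrA -[leLHS]mul1r ler_wpM2r // ltW.
  have : x ^+ 2 / 2 * (x + E) <= x ^+ 2 / 2 * (2 * e * x ^+ 2).
    by rewrite ler_wpM2l ?divr_ge0 ?(ltW x2) //; lra.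
  have := ler_wpM2l e0 m2.
  by move: (x ^+ 2) => y; rewrite !expr2; lra.
have h3 : t <= e by rewrite -(ler_pM2l x0) [leRHS]mulrC; lra.
lra.
Qed.

Lemma residual_small (b e : R) : 0 < b < beta_critical alpha -> 0 < e ->
  \forall N \near \oo, 8 * (edge_total N b / n N) + 4 * (pair_total N b / n N ^+ 2) +
    72 * tsq N b <= e.
Proof.
move=> bc e0; have /andP[b0 _] := bc.
have [C C0 HC] := tsq_bounded halpha mu_tail mu_moments b0.
pose e' := e / 200; have e'0 : 0 < e' by rewrite divr_gt0.
have small := edge_sum_small halpha indJ lawJ mu_sym mu_int mu_tail mu_moments bc e'0.
have big1 : \forall N \near \oo, C / e' <= N%:R by apply: nat_large; rewrite divr_ge0 // ltW.
have big2 : \forall N \near \oo, 1 / e' <= N%:R by apply: nat_large; rewrite divr_ge0 // ltW.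
near=> N.
have N2 : (1 < N)%N by near: N; exact: nbhs_infty_gt.
have -> : e = 200 * e' by rewrite /e'; field.
apply: (@residual_small_arith N%:R _ _ _ _ e' C).
- by rewrite ler1n ltnW.
- exact: ltW.
- by apply: Rintegral_ge0 => x _; exact: sqr_ge0.
- exact: card_bond_ge.
- by apply: sumr_ge0 => g _; apply: Rintegral_ge0 => w _; exact: sqr_ge0.
- by apply: sumr_ge0 => g _; apply: sumr_ge0 => f _; apply: Rintegral_ge0 => w _; exact: sqr_ge0.
- by near: N.
- exact: sum_pair_sq_le.
- by near: N.
- by rewrite mulrC -ler_pdivrMr //; near: N.
- by rewrite mulrC -ler_pdivrMr //; near: N.
Unshelve. all: by end_near. Qed.

Lemma bond_deviation_cvg b K : 0 < b < beta_critical alpha -> 0 < K ->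
  let c := heavy_integral alpha b K / K `^ (- alpha) in
  bond_deviation (@J N) b K c @[N --> \oo] --> (0 : R).
Proof.
move=> bc K0 c; have /andP[b0 _] := bc.
have k0 : 0 < K `^ (- alpha) by rewrite powR_gt0.
have hm := heavy_mass_cvg halpha mu_tail K0.
have hd := heavy_deviation_cvg halpha mu_tail b0 K0; rewrite -/c in hd.
have ratio : (N%:R * heavy_deviation (mu N) b K c) / (N%:R * heavy_mass (mu N) K)
    @[N --> \oo] --> (0 : R).
  rewrite -(mul0r (K `^ (- alpha))^-1); apply: cvgM => //.
  by apply: cvgV => //; rewrite gt_eqF.
have ratio2 : 4 * ((N%:R * heavy_deviation (mu N) b K c) /
    (N%:R * heavy_mass (mu N) K)) ^+ 2 @[N --> \oo] --> (0 : R).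
  have -> : 0 = 4 * (0 * 0) :> R by rewrite !mulr0.
  apply: cvgM; first exact: cvg_cst.
  by under eq_fun do rewrite expr2; exact: cvgM.
apply/cvgrPdist_le => e e0.
pose L := 32 * (1 + 2 * `|c|).
have L0 : 0 < L by rewrite mulr_gt0 // ltr_wpDr // mulr_ge0.
(* residual moments below [del] cost at most [3 * del], the others are paid for by their
   squares divided by [del] *)
pose del := e / (8 * L); have d0 : 0 < del by rewrite divr_gt0 // mulr_gt0.
have e4 : 0 < e / 4 by rewrite divr_gt0.
have res := residual_small bc (mulr_gt0 d0 d0).
have /cvgrPdist_le/(_ _ e4) near1 := ratio2.
have k2 : 0 < K `^ (- alpha) / 2 by rewrite divr_gt0.
have /cvgrPdist_le/(_ _ k2) near2 := hm.
pose q := 8 * (1 + `|c|) ^+ 2 * (32 / e) / K `^ (- alpha).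
have q0 : 0 <= q by rewrite !mulr_ge0 ?invr_ge0 ?sqr_ge0 // ltW.
have near3 := nat_large q0.
near=> N.
have N2 : (1 < N)%N by near: N; exact: nbhs_infty_gt.
have N0 : (0 < N)%N by exact: ltnW.
have NR : 0 < N%:R :> R by rewrite ltr0n.
have nb := card_bond_ge N2.
have n0 : 0 < n N by apply: lt_le_trans nb; rewrite divr_gt0 // exprn_gt0.
have hN : `|K `^ (- alpha) - N%:R * heavy_mass (mu N) K| <= K `^ (- alpha) / 2 by near: N.
have Np : K `^ (- alpha) / 2 <= N%:R * heavy_mass (mu N) K.
  by move: hN; rewrite ler_distl => /andP[_]; lra.
have p0 : 0 < heavy_mass (mu N) K.
  by rewrite -(pmulr_rgt0 _ NR); exact: lt_le_trans Np.
have h1 : 4 * (heavy_deviation (mu N) b K c / heavy_mass (mu N) K) ^+ 2 <= e / 4.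
  have -> : heavy_deviation (mu N) b K c / heavy_mass (mu N) K =
      N%:R * heavy_deviation (mu N) b K c / (N%:R * heavy_mass (mu N) K).
    by field; rewrite !gt_eqF.
  apply: le_trans (ler_norm _) _; rewrite -normrN -[X in `|X|]add0r.
  by near: N.
have h2 : 8 * (edge_total N b / n N) + 4 * (pair_total N b / n N ^+ 2) +
    72 * tsq N b <= del * del by near: N.
have h3 : q <= N%:R by near: N.
rewrite sub0r normrN ger0_norm ?bond_deviation_ge0 //.
apply: le_trans (bond_deviation_le (indJ N0) (lawJ N0) b c d0 n0 p0) _.
have H2 : 32 * (1 + 2 * `|c|) * (3 * del +
    (8 * (edge_total N b / n N) + 4 * (pair_total N b / n N ^+ 2) +
     72 * tsq N b) / del) <= e / 2.
  apply: (@le_trans _ _ (L * (3 * del + del * del / del))).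
    by rewrite ler_pM2l // lerD2l ler_pM2r // invr_gt0.
  rewrite le_eqVlt; apply/orP; left; apply/eqP; rewrite /del.
  by field; rewrite !gt_eqF.
have H3 : 8 * ((1 + `|c|) ^+ 2 / (n N * heavy_mass (mu N) K)) <= e / 4.
  rewrite mulrA ler_pdivrMr ?mulr_gt0 //.
  have h5 : N%:R * (K `^ (- alpha) / 8) <= n N * heavy_mass (mu N) K.
    apply: (@le_trans _ _ (N%:R ^+ 2 / 4 * heavy_mass (mu N) K)).
      have := ler_wpM2l (ltW NR) Np; rewrite expr2; lra.
    by rewrite ler_wpM2r // ltW.
  apply: le_trans (ler_wpM2l (ltW e4) h5).
  move: h3; rewrite /q ler_pdivrMr //.
  have -> : 8 * (1 + `|c|) ^+ 2 * (32 / e) = 8 * (1 + `|c|) ^+ 2 / (e / 32).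
    by field; rewrite gt_eqF.
  rewrite ler_pdivrMr ?divr_gt0 //; lra.
apply: le_trans (lerD (lerD h1 H2) H3) _.
by rewrite le_eqVlt; apply/orP; left; apply/eqP; field.
Unshelve. all: by end_near. Qed.

Lemma bond_overlap_limitE b K : 0 < K ->
  bond_overlap_limit alpha b K = heavy_integral alpha b K / K `^ (- alpha).
Proof.
by move=> K0; rewrite /bond_overlap_limit /heavy_integral powRN invrK; ring.
Qed.

Lemma bond_overlap_subcritical b K : 0 < b < beta_critical alpha -> 0 < K ->
  mean_bond_overlap_dev_sq (@J N) b K (bond_overlap_limit alpha b K)
    @[N --> \oo] --> 0%:E.
Proof.
move=> bc K0; rewrite bond_overlap_limitE //.
have -> : (fun N => mean_bond_overlap_dev_sq (@J N) b K
      (heavy_integral alpha b K / K `^ (- alpha))) =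
    (fun N => (bond_deviation (@J N) b K
      (heavy_integral alpha b K / K `^ (- alpha)))%:E).
  apply/funext => N; rewrite /mean_bond_overlap_dev_sq expectationE //.
  exact: integrable_bond_deviation.
by apply: cvg_EFin; [exact: nearW|exact: bond_deviation_cvg].
Qed.

End BondOverlapLimit.

Theorem theorem2p4 (R : realType) (alpha : R) (L : R -> R)
    (d0 : measure_display) (T0 : measurableType d0) (P0 : probability T0 R)
    (X : {RV P0 >-> R})
    (d : nat -> measure_display) (T : forall N : nat, measurableType (d N))
    (P : forall N : nat, probability (T N) R)
    (J : forall N : nat, bond N -> {RV (P N) >-> R})
    (halpha : 1 < alpha < 2)
    (hL0 : forall x : R, 0 < x -> 0 < L x)
    (hL : slowly_varying L)
    (hXsym : symmetric_rv X)
    (hXtail : forall x : R, 0 < x -> tail X x = (L x / x `^ alpha)%:E)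
    (hJ : forall N : nat, (1 <= N)%N -> levy_couplings X (J N)) :
  (forall k : nat, (1 <= k)%N ->
     (forall beta : R, 0 < beta < beta_critical alpha ->
        mean_site_overlap_sq (J N) beta (2 * k) @[N --> \oo] --> 0%:E) /\
     limn_einf (fun N : nat => mean_site_overlap_sq (J N) beta (2 * k))
       @[beta --> +oo] --> 1%E) /\
  (forall beta K : R, 0 < beta < beta_critical alpha -> 0 < K ->
     mean_bond_overlap_dev_sq (J N) beta K (bond_overlap_limit alpha beta K)
       @[N --> \oo] --> 0%:E).
Proof.
have indJ N : (0 < N)%N -> mutually_independent (J N) by case/hJ.
have lawJ N : (0 < N)%N -> forall (e : bond N) (A : set R), measurable A ->
    P N (J N e @^-1` A) = coupling_law X N A.
  by case/hJ.
have mu_sym := coupling_law_sym hXsym.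
have mu_int := coupling_law_integrable halpha hL0 hL hXtail.
have mu_tail := coupling_law_tail halpha hL0 hL hXtail.
have mu_moments := coupling_law_moments halpha hL0 hL hXtail.
split=> [k k0|beta K bc K0].
  split=> [beta bc|].
    exact: (site_overlap_subcritical halpha indJ lawJ mu_sym mu_int mu_tail mu_moments).
  exact: (site_overlap_low_temperature halpha indJ lawJ mu_sym mu_int mu_tail mu_moments).
exact: (bond_overlap_subcritical halpha indJ lawJ mu_sym mu_int mu_tail mu_moments).
Qed.
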